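(* Let $\mu$ be any probability measure on $\mathbb{C}$ satisfying $\int_{\mathbb{C}}\log_+|z|\,d\mu(z)<\infty$. Let $X_1,X_2,\dots$ be i.i.d. random variables distributed according to $\mu$. Define $P_n(z):=(z-X_1)(z-X_2)\cdots(z-X_n)$. Then $\mathscr{M}(P_n)\xrightarrow{w}\mu$ almost surely and $\mathscr{M}(P_n')\xrightarrow{w}\mu$ in probability, as $n\to\infty$.
   Context: For a nonconstant complex polynomial $P$, $\mathscr{M}(P)$ denotes the uniform probability measure on the multiset of zeros of $P$ (zeros counted with multiplicity); $P'$ is the derivative ($n\ge 2$ when $P_n'$ is considered). A sequence of probability measures $\mu_n$ on $\mathbb{C}$ converges weakly to a probability measure $\mu$ (written $\mu_n\xrightarrow{w}\mu$) if $\int f\,d\mu_n\to\int f\,d\mu$ for every $f\in C_c^\infty(\mathbb{C})$. For random probability measures $\mu_n$: $\mu_n\xrightarrow{w}\mu$ in probability means $\lim_{n\to\infty}\mathbb{P}(\mu_n\in N)=1$ for every neighbourhood $N$ of $\mu$ in the weak topology; $\mu_n\xrightarrow{w}\mu$ almost surely means that with probability one $\mu_n\to\mu$ weakly. $\log_+x=\max(\log x,0)$ (with $\log_+0=0$). *)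

(* Defs.v *)
From HB Require Import structures.
From mathcomp Require Import all_boot all_order all_algebra.
From mathcomp Require Import complex.
From mathcomp Require Import all_classical all_reals all_analysis.
Set Implicit Arguments.
Unset Strict Implicit.
Unset Printing Implicit Defensive.
Import Order.TTheory GRing.Theory Num.Theory.
Import numFieldNormedType.Exports.
Local Open Scope classical_set_scope.
Local Open Scope ring_scope.
Local Open Scope complex_scope.

(* The complex plane with its Borel sigma-algebra. The library puts the usual
   topology of R[i] on the convertible alias R[i]^o. *)
Notation borelC R := (g_sigma_algebraType (@open R[i]^o)).

Definition probC (R : realType) : Type := probability (borelC R) R.

(* ln 0 = 0 in the library, so that log_plus 0 = 0. *)
Definition log_plus (R : realType) (x : R) : R := Num.max (ln x) 0.

(* Iterated partial derivatives of a function of two real variables: true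
   stands for the first variable and false for the second. *)
Definition axis (R : realType) (b : bool) : R * R :=
  if b then (1, 0) else (0, 1).

Definition iter_partial (R : realType) (s : seq bool) (g : R * R -> R) :
  R * R -> R := foldr (fun b h p => 'D_(axis R b) h p) g s.

(* Smoothness on C is meant in the real sense, through C = R^2. *)
Definition smooth (R : realType) (f : R[i] -> R) : Prop :=
  let g := fun p : R * R => f (p.1 +i* p.2) in
  forall s : seq bool, continuous (iter_partial s g) /\
    forall (b : bool) (p : R * R), derivable (iter_partial s g) p (axis R b).

Record test_function (R : realType) := TestFunction {
  test_fun :> R[i] -> R;
  test_smooth : smooth test_fun;
  test_compact_support :
    @compact R[i]^o (closure [set z : R[i]^o | test_fun z != 0]) }.

Definition test_integral (R : realType) (nu : probC R) (f : test_function R) :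
  R := \int[nu]_z f z.

Definition weak_cvg (R : realType) (nu : nat -> probC R) (mu : probC R) : Prop :=
  forall f : test_function R,
    test_integral (nu n) f @[n --> \oo] --> test_integral mu f.

(* The weak topology: the coarsest one making nu |-> \int f dnu continuous for
   every test function f. *)
Definition weak_topC (R : realType) : topologicalType :=
  initial_topology (@test_integral R : {classic probC R} ->
    prod_topology (fun _ : test_function R => R)).

(* Zeros with multiplicity, in an arbitrary order: for p != 0, p is
   lead_coef p *: \prod_(z <- zeros p) ('X - z%:P). *)
Definition zeros (R : realType) (p : {poly R[i]}) : seq R[i] :=
  sval (closed_field_poly_normal p).

(* The uniform probability measure on the multiset of zeros. A constant
   polynomial gets the default value dirac 0. *)
Definition zero_measure (R : realType) (p : {poly R[i]}) : probC R :=
  mnormalize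
    (msum (fun i => dirac ((zeros p)`_i : borelC R)) (size (zeros p)))
    (dirac (0 : borelC R)).

(* Mutual independence of a sequence of random variables. *)
Definition independent_seq d (Omega : measurableType d) (R : realType)
    (P : probability Omega R) d' (T : measurableType d')
    (X : nat -> {RV P >-> T}) : Prop :=
  forall (J : seq nat) (A : nat -> set T), uniq J ->
    (forall i, measurable (A i)) ->
    P (\bigcap_(i in [set` J]) (X i @^-1` A i)) =
      (\prod_(i <- J) P (X i @^-1` A i))%E.

Definition iid d (Omega : measurableType d) (R : realType)
    (P : probability Omega R) d' (T : measurableType d')
    (mu : probability T R) (X : nat -> {RV P >-> T}) : Prop :=
  independent_seq X /\
  forall (i : nat) (A : set T), measurable A -> distribution P (X i) A = mu A.

(* The value of a measure at a non-measurable set is meaningless in the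
   library, and the event that a random measure falls into an arbitrary
   neighbourhood need not be measurable, so its probability is taken to be the
   inner one; it is P E when E is measurable. *)
Definition inner_prob d (Omega : measurableType d) (R : realType)
    (P : probability Omega R) (E : set Omega) : \bar R :=
  ereal_sup [set P B | B in [set B | measurable B /\ B `<=` E]].

Definition weak_cvg_as d (Omega : measurableType d) (R : realType)
    (P : probability Omega R) (nu : nat -> Omega -> probC R) (mu : probC R) :
  Prop := {ae P, forall w, weak_cvg (fun n => nu n w) mu}.

Definition weak_cvg_in_prob d (Omega : measurableType d) (R : realType)
    (P : probability Omega R) (nu : nat -> Omega -> probC R) (mu : probC R) :
  Prop :=
  forall N : set (weak_topC R), nbhs (mu : weak_topC R) N ->
    inner_prob P [set w | N (nu n w)] @[n --> \oo] --> 1%E.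

(* X i is the (i+1)-st of the random zeros. *)
Definition random_poly d (Omega : measurableType d) (R : realType)
    (P : probability Omega R) (X : nat -> {RV P >-> borelC R}) (n : nat)
    (w : Omega) : {poly R[i]} :=
  \prod_(i < n) ('X - (X i w : R[i])%:P).

(* Main.v *)
(** The functions [w |-> ln max(2r, |w - c|) - ln max(r, |w - c|)] suffice as test functions: sums of
    them over a fine grid approximate any continuous function of compact support. By Jensen's
    formula, the sum of such a bump over the critical points of [P_n] minus its sum over the zeros
    is the mean of [ln |P_n' / P_n|] over the circle of center [c] and radius [2r] minus its mean
    over the circle of radius [r]. The logarithmic derivative [L(z) = sum_i 1 / (z - X_i)] is at most
    [n exp M] except very close to a zero, and unless [mu] is a Dirac mass it is, for each fixed [z],
    at least [1/n] in modulus with probability tending to 1, because a sum of nondegenerate i.i.d.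
    variables does not concentrate on a bounded interval. So both means are [o(n)] in probability;
    on the exceptional arcs, of small total length, the logarithmic moment of [mu] bounds the
    potential of the zeros. The critical points thus have the same limit in probability as the zeros,
    which obey the strong law of large numbers for countably many bumps simultaneously. *)

Require Import Defs.
From HB Require Import structures.
From mathcomp Require Import all_boot all_order all_algebra.
From mathcomp Require Import complex.
From mathcomp Require Import all_classical all_reals all_analysis.
From mathcomp Require Import measurable_realfun ring lra zify.
Set Implicit Arguments.
Unset Strict Implicit.
Unset Printing Implicit Defensive.
Import Order.TTheory GRing.Theory Num.Theory.
Import numFieldNormedType.Exports.
Local Open Scope classical_set_scope.
Local Open Scope ring_scope.
Local Open Scope complex_scope.

(** Jensen's formula reduces the problem to means of [ln |L|] over circles, and the obstacle is that
    [L] vanishes at the critical points, whose position is unknown. No lower bound for [|L|] uniform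
    on a circle is available; anticoncentration gives one at each fixed point only, and without a
    rate. Tonelli's theorem turns it into a bound on the expected length of the arcs where
    [|L| < 1/n], which yields convergence in probability. On these arcs [ln |L|] is split into
    [ln |P_n'| - ln |P_n|]. Logarithmic singularities are truncated at distance [exp (- M)]: what
    lies beyond the truncation integrates to at most a constant times [n * exp (- M) / r], wherever
    the roots are, so [M] is fixed before [n] grows. For a Dirac mass at [x0], almost surely all
    critical points equal [x0]. Two classical inputs get elementary proofs: Jensen's formula comes
    from angle doubling, anticoncentration from a comparison with a killed random walk. *)

Local Notation nm := (@Normc.normc _).

(** * The complex norm and Jensen's formula on circles *)

Section Norm.
Context {R : realType}.
Implicit Types z w : R[i].

Lemma nm_ge0 z : 0 <= nm z.
Proof. by case: z => a b; rewrite /= sqrtr_ge0. Qed.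

Lemma nm_le_add z w : nm (z + w) <= nm z + nm w.
Proof. exact: (le_normcD (z : Rcomplex R)). Qed.

Lemma nm_opp z : nm (- z) = nm z.
Proof. exact: (normcN (z : Rcomplex R)). Qed.

Lemma nm_distC z w : nm (z - w) = nm (w - z).
Proof. by rewrite -nm_opp opprB. Qed.

Lemma nm_le_dist z w : nm z - nm w <= nm (z - w).
Proof. by rewrite lerBlDr -[in leLHS](subrK w z) nm_le_add. Qed.

Lemma nm_dist_dist z w : `|nm z - nm w| <= nm (z - w).
Proof.
rewrite ler_norml nm_le_dist andbT lerNl opprB nm_distC; exact: nm_le_dist.
Qed.

Lemma nm_eq0 z : (nm z == 0) = (z == 0).
Proof.
by apply/eqP/eqP => [/Normc.eq0_normc //|->]; rewrite Normc.normc0.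
Qed.

Lemma nm_gt0 z : (0 < nm z) = (z != 0).
Proof. by rewrite lt_neqAle nm_ge0 andbT eq_sym nm_eq0. Qed.

Lemma nmX z n : nm (z ^+ n) = nm z ^+ n.
Proof.
elim: n => [|n IH]; first by rewrite !expr0 Normc.normc1.
by rewrite !exprS Normc.normcM IH.
Qed.

Lemma nm_real (r : R) : nm r%:C = `|r|.
Proof. by rewrite /= expr0n /= addr0 sqrtr_sqr. Qed.

Lemma nm_Re_le z : `|complex.Re z| <= nm z.
Proof.
case: z => a b /=; rewrite -sqrtr_sqr ler_wsqrtr // lerDl; exact: sqr_ge0.
Qed.

Lemma nm_Im_le z : `|complex.Im z| <= nm z.
Proof.
case: z => a b /=; rewrite -sqrtr_sqr ler_wsqrtr // lerDr; exact: sqr_ge0.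
Qed.

Lemma nm_le_ReIm z : nm z <= `|complex.Re z| + `|complex.Im z|.
Proof.
case: z => a b /=; rewrite -[leRHS]ger0_norm ?addr_ge0 // -sqrtr_sqr.
rewrite ler_wsqrtr // sqrrD !real_normK ?num_real // addrAC lerDl.
by rewrite mulrn_wge0 // mulr_ge0.
Qed.

End Norm.

(** * Jensen's formula for one point, by angle doubling *)

Section Circle.
Context {R : realType}.
Local Notation mu := (@lebesgue_measure R).
Local Notation I01 := (`[0, 1[%classic : set R).

(** The parameter counts full turns, so that integrals over [I01] are means over the unit circle. *)
Definition circ (t : R) : R[i] :=
  cos (t * (pi *+ 2)) +i* sin (t * (pi *+ 2)).

Lemma circD s t : circ (s + t) = circ s * circ t.
Proof.
apply/eqP; rewrite eq_complex /= mulrDl cosD sinD eqxx /=.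
by rewrite [X in _ == X]addrC.
Qed.

Lemma circ2 t : circ (2 * t) = circ t ^+ 2.
Proof. by rewrite mulr_natl mulr2n circD expr2. Qed.

Lemma circ_half t : circ (t + 2^-1) = - circ t.
Proof.
rewrite circD (_ : circ 2^-1 = -1) ?mulrN1 //.
rewrite /circ (_ : 2^-1 * (pi *+ 2) = pi); last first.
  by lra.
by rewrite cospi sinpi; apply/eqP; rewrite eq_complex /= oppr0 !eqxx.
Qed.

Lemma nm_circ t : nm (circ t) = 1.
Proof. by rewrite /= cos2Dsin2 sqrtr1. Qed.

(** By the mean value theorem [sin y = cos c * y] for some [c] in [[0, y]], and [cos] decreases on
    [[0, 1]]. *)
Lemma sin_ge_lin (y : R) : 0 <= y <= 1 -> cos 1 * y <= sin y.
Proof.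
move=> /andP[y0 y1].
have [c /itvP cy] := MVT_segment y0 (fun x _ => is_derive_sin x)
  (continuous_subspaceT (@continuous_sin R)).
rewrite sin0 !subr0 => ->; apply: ler_wpM2r => //.
have pi1 := pihalf_ge1 R.
have pi0 := pi_gt0 R.
have [->//|c1] := eqVneq c 1.
apply/ltW; rewrite ltr_cos ?in_itv //= ?cy ?lt_neqAle ?c1 ?(le_trans _ y1) ?cy //=.
  by apply: (le_trans (_ : c <= 1)); [apply: le_trans y1; rewrite cy|lra].
by lra.
Qed.

(** A rotation brings one point to 1, and the distance is at least the imaginary part of the other,
    a sine. The bound [8^-1] keeps the angle below 1 because [pi < 4]; the factor [2 * pi >= 1] is
    given away. *)
Lemma circ_dist (s t : R) : `|s - t| <= 8^-1 ->
  cos 1 * `|s - t| <= nm (circ s - circ t).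
Proof.
wlog st : s t / t <= s => [hw|].
  have [/hw//|/ltW /hw h] := leP t s.
  by rewrite distrC nm_distC => /h.
rewrite ger0_norm ?subr_ge0 // => d8.
have -> : circ s - circ t = circ t * (circ (s - t) - 1).
  by rewrite mulrBr mulr1 -circD [t + _]addrC subrK.
rewrite Normc.normcM nm_circ mul1r.
apply: le_trans (nm_Im_le _); apply: le_trans (ler_norm _).
have -> : complex.Im (circ (s - t) - 1) = sin ((s - t) * (pi *+ 2)).
  by rewrite /= subr0.
have p1 := pihalf_ge1 R.
have p2 : pi / 2 < 2 :> R := pihalf_lt2 R.
have st0 : 0 <= s - t by rewrite subr_ge0.
have h : s - t <= (s - t) * (pi *+ 2).
  rewrite ler_peMr // mulr2n; lra.
apply: (@le_trans _ _ (cos 1 * ((s - t) * (pi *+ 2)))).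
  by rewrite ler_pM2l // cos1_gt0.
apply: sin_ge_lin; rewrite (le_trans st0 h) /=.
by rewrite mulr2n; nra.
Qed.


Lemma measure_diam (E : set R) (d : R) : measurable E -> 0 <= d ->
  (forall s t, E s -> E t -> `|s - t| <= d) -> (mu E <= (2 * d)%:E)%E.
Proof.
move=> mE d0 dE.
have [->|/set0P [s Es]] := eqVneq E set0.
  by rewrite measure0 lee_fin mulr_ge0.
apply: (@le_trans _ _ (mu `[s - d, s + d]%classic)).
  apply: le_measure; rewrite ?inE //.
  by move=> t Et; rewrite /= in_itv /= -ler_distlC distrC dE.
rewrite lebesgue_measure_itv /=; case: ifP => _; last by rewrite lee_fin mulr_ge0.
by rewrite -EFinD lee_fin; lra.
Qed.

Lemma measurable_nm_circ (c r w : R[i]) :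
  measurable_fun setT (fun t => nm (c + r * circ t - w)).
Proof.
have mc : measurable_fun setT (fun t : R => cos (t * (pi *+ 2))).
  apply: (measurableT_comp (continuous_measurable_fun (@continuous_cos R))).
  exact: mulrr_measurable.
have ms : measurable_fun setT (fun t : R => sin (t * (pi *+ 2))).
  apply: (measurableT_comp (continuous_measurable_fun (@continuous_sin R))).
  exact: mulrr_measurable.
case: c r w => [c1 c2] [r1 r2] [w1 w2] /=.
apply: (measurableT_comp (continuous_measurable_fun (@sqrt_continuous R))).
apply: measurable_funD; apply: measurable_funX; apply: measurable_funD => //;
  apply: measurable_funD => //.
  by apply: measurable_funB; apply: measurable_funM.
by apply: measurable_funD; apply: measurable_funM.
Qed.

(** Eight arcs, each of measure at most [2 * (2 * s / cos 1)]. *)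
Definition circ_const : R := 32 / cos 1.

(** On an eighth of a turn the distance of two points controls that of their parameters, and two
    points within [s] of [w] are within [2 * s] of each other, wherever [w] is. *)
Lemma circ_near_measure (w : R[i]) (s : R) : 0 <= s ->
  (mu (I01 `&` [set t | (nm (circ t - w) <= s)%R]) <= (circ_const * s)%:E)%E.
Proof.
move=> s0; pose E := [set t : R | nm (circ t - w) <= s]; rewrite -/E.
have mE : measurable E.
  have := measurable_nm_circ 0 1 w.
  rewrite (_ : (fun t => _) = (fun t => nm (circ t - w))); last first.
    by apply/funext => t; rewrite add0r mul1r.
  move=> /(_ measurableT `]-oo, s]%classic (measurable_itv _)).
  by rewrite setTI; congr measurable; apply/funext => t; rewrite /= in_itv.
pose A k : set R := `[k%:R / 8, k.+1%:R / 8]%classic `&` E.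
have mA k : measurable (A k) by apply: measurableI.
have c0 := @cos1_gt0 R.
have muA k : (mu (A k) <= (2 * (2 * s / cos 1))%:E)%E.
  apply: measure_diam => //; first by rewrite divr_ge0 ?mulr_ge0 // ltW.
  move=> t u [/= tI tE] [/= uI uE].
  have tu : `|t - u| <= 8^-1.
    move: tI uI; rewrite !in_itv /= => /andP[t1 t2] /andP[u1 u2].
    rewrite ler_norml; rewrite -[k.+1]addn1 natrD in t2 u2; apply/andP; split; lra.
  rewrite ler_pdivlMr // [leLHS]mulrC; have h := circ_dist tu; apply: (le_trans h).
  rewrite (_ : circ t - circ u = (circ t - w) + (w - circ u)); last by ring.
  apply: le_trans (nm_le_add _ _) _; rewrite [nm (w - _)]nm_distC mulr_natl mulr2n.
  exact: lerD.
apply: (@le_trans _ _ (mu (\big[setU/set0]_(k < 8) A k))).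
  apply: le_measure; rewrite ?inE //.
  - exact: measurableI.
  - by apply: bigsetU_measurable => k _; exact: mA.
  move=> t [/=]; rewrite in_itv /= => /andP[t0 t1] Et.
  rewrite -bigcup_mkord.
  have t8 : 0 <= t * 8 by lra.
  exists (Num.truncn (t * 8)).
    by rewrite /= truncn_lt_nat //; lra.
  split => //=; have := truncn_itv t8; rewrite in_itv /= => /andP[h1 h2].
  by apply/andP; split; lra.
have := @Boole_inequality _ R _ mu A 8 (fun k _ => mA k).
move/le_trans; apply.
apply: (@le_trans _ _ (\sum_(i < 8) (2 * (2 * s / cos 1))%:E)%E).
  by apply: lee_sum => k _; exact: muA.
rewrite sumEFin lee_fin sumr_const card_ord /circ_const -mulr_natl.
by rewrite le_eqVlt; apply/orP; left; apply/eqP; field; rewrite gt_eqF.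
Qed.

Lemma log_plus_ge0 (x : R) : 0 <= log_plus x.
Proof. by rewrite /log_plus le_max lexx orbT. Qed.

Lemma ln_le_log_plus (x : R) : ln x <= log_plus x.
Proof. by rewrite /log_plus le_max lexx. Qed.

(** A discrete layer-cake bound. If [n] is the integer part of [ln y], the terms of index at most
    [n] all equal 1 because [2 <= expR 1], and [n + 1] exceeds [ln y]. *)
Lemma log_plus_dyadic (y : R) :
  ((log_plus y)%:E <= \sum_(k <oo) ((2 ^+ k <= y)%R%:R)%:E)%E.
Proof.
have S0 k : (0 <= ((2 ^+ k <= y)%R%:R : R)%:E)%E by rewrite lee_fin ler0n.
have [l0|l0] := leP (ln y) 0.
  rewrite /log_plus (max_r l0); apply: nneseries_ge0 => k _ _; exact: S0.
rewrite /log_plus (max_l (ltW l0)).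
have y0 : 0 < y by rewrite ltNge; apply/negP => /ln0 h; rewrite h ltxx in l0.
have /andP[n1 n2] := truncn_itv (ltW l0).
set n := Num.truncn _ in n1 n2.
apply: le_trans (nneseries_lim_ge n.+1 (fun k _ _ => S0 k)).
rewrite sumEFin lee_fin big_mkord (eq_bigr (fun _ => 1)); last first.
  move=> /= i _; rewrite (_ : (_ <= _) = true) //.
  apply: (@le_trans _ _ (expR n%:R)); last by rewrite -ler_ln ?posrE ?expR_gt0 // expRK.
  apply: (@le_trans _ _ (2 ^+ n)).
    by rewrite ler_weXn2l ?ler1n // -ltnS.
  rewrite -[n%:R]mul1r expRM_natr lerXn2r ?nnegrE ?expR_ge0 //.
  by apply: le_trans (expR_ge1Dx _).
by rewrite sumr_const card_ord ltW.
Qed.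

Lemma measurable_log_plus : measurable_fun setT (@log_plus R).
Proof. by apply: measurable_maxr. Qed.

Lemma measurable_nm_circ1 (w : R[i]) :
  measurable_fun setT (fun t => nm (circ t - w)).
Proof.
have := measurable_nm_circ 0 1 w.
by under eq_fun do rewrite add0r mul1r.
Qed.

Lemma measurable_inv : measurable_fun setT (fun x : R => x^-1).
Proof.
have mneg : measurable (~` [set 0 : R]) by apply: measurableC; exact: measurable_set1.
rewrite -(setUv [set (0 : R)]); apply/measurable_funU => //; split.
  exact: measurable_fun_set1.
apply: open_continuous_measurable_fun => //.
  exact/closed_openC/closed_eq.
by move=> x /set_mem /eqP x0; exact: inv_continuous.
Qed.

(** In the dyadic bound, integrated term by term, the set of index [k] has measure at most
    [circ_const * s / 2 ^ k]; the geometric series gives the factor 2. *)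
Lemma log_plus_circ_le (w : R[i]) (s : R) : 0 <= s ->
  (\int[mu]_(t in I01) (log_plus (s / nm (circ t - w)))%:E <=
   (2 * circ_const * s)%:E)%E.
Proof.
move=> s0.
pose E k := [set t : R | nm (circ t - w) <= s / 2 ^+ k].
have mE k : measurable (E k).
  have /(_ measurableT `]-oo, s / 2 ^+ k]%classic (measurable_itv _)) :=
    measurable_nm_circ1 w.
  by rewrite setTI; congr measurable; apply/funext => t; rewrite /= in_itv.
have mlp : measurable_fun setT (fun t => log_plus (s / nm (circ t - w))).
  apply: (measurableT_comp measurable_log_plus).
  apply: measurable_funM => //; apply: (measurableT_comp measurable_inv).
  exact: measurable_nm_circ1.
apply: (@le_trans _ _ (\int[mu]_(t in I01) \sum_(k <oo) (\1_(E k) t)%:E)%E).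
  apply: ge0_le_integral => //.
  - by move=> t _; rewrite lee_fin log_plus_ge0.
  - by apply/measurable_EFinP; exact: measurable_funTS.
  - apply: ge0_emeasurable_sum => [k t _ _|k _]; first by rewrite lee_fin.
    by apply/measurable_EFinP; apply: measurable_indic; exact: mE.
  move=> t _; apply: le_trans (log_plus_dyadic _) _.
  apply: lee_nneseries => [k _|k _]; first by rewrite lee_fin.
  rewrite lee_fin indicE ler_nat.
  case: (boolP (2 ^+ k <= _)) => // h; rewrite (_ : _ \in _) //.
  apply/mem_set; rewrite /E /=.
  have [->|w0] := eqVneq (nm (circ t - w)) 0; first by rewrite divr_ge0 // exprn_ge0.
  have wp : 0 < nm (circ t - w) by rewrite lt_neqAle eq_sym w0 nm_ge0.
  by rewrite ler_pdivlMr ?exprn_gt0 // mulrC -ler_pdivlMr.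
rewrite integral_nneseries //.
- apply: (@le_trans _ _ (\sum_(k <oo) (circ_const * s * 2 / (2 ^ (k + 1))%N%:R)%:E)%E).
    apply: lee_nneseries => [k _|k _].
      by move=> _; apply: integral_ge0 => t _; rewrite lee_fin.
    have -> : (\int[mu]_(x in I01) (\1_(E k) x)%:E = mu (E k `&` I01))%E.
      by apply: integral_indic => //; exact: mE.
    rewrite setIC.
    apply: le_trans (circ_near_measure _ _) _; first by rewrite divr_ge0 // exprn_ge0.
    rewrite lee_fin addn1 expnS natrM natrX invfM.
    by rewrite !mulrA mulfK ?pnatr_eq0.
  have := @cvg_geometric_eseries_half R (circ_const * s * 2) 0.
  move/cvg_lim => -> //.
  by rewrite lee_fin expr0 divr1 le_eqVlt; apply/orP; left; apply/eqP; ring.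
- by move=> k; apply/measurable_EFinP; apply: measurable_indic; exact: mE.
Qed.

(** At 0 the default values [ln 0 = 0] and [0^-1 = 0] make both sides vanish. *)
Lemma ln_log_plus (x : R) : 0 <= x -> ln x = log_plus x - log_plus x^-1.
Proof.
rewrite le_eqVlt => /predU1P[<-|x0]; first by rewrite invr0 subrr ln0.
rewrite /log_plus lnV ?posrE //; have [h|h] := leP (ln x) 0.
  by rewrite max_l ?oppr_ge0 // sub0r opprK.
by rewrite max_r ?subr0 // oppr_le0 ltW.
Qed.

Lemma log_plus1D (x : R) : 0 <= x -> log_plus (1 + x) = ln (1 + x).
Proof. by move=> x0; rewrite /log_plus max_l // ln_ge0 // lerDl. Qed.

Lemma ler_log_plus (x y : R) : 0 <= x -> x <= y -> log_plus x <= log_plus y.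
Proof.
rewrite le_eqVlt => /predU1P[<- _|x0 xy].
  by rewrite {1}/log_plus ln0 // maxxx log_plus_ge0.
rewrite /log_plus ge_max le_max [in X in _ && X]le_max lexx orbT andbT.
by rewrite ler_ln ?posrE // ?xy // (lt_le_trans x0).
Qed.

Lemma norm_ln_le (x : R) : 0 <= x -> `|ln x| <= log_plus x + log_plus x^-1.
Proof.
move=> x0; rewrite ln_log_plus //; apply: le_trans (ler_normB _ _) _.
by rewrite !ger0_norm ?log_plus_ge0.
Qed.

Lemma measurable_ln_circ (w : R[i]) :
  measurable_fun setT (fun t => ln (nm (circ t - w))).
Proof. by apply: measurableT_comp => //; exact: measurable_nm_circ1. Qed.

Lemma integrable_bound (f g : R -> R) (C : R) :
  measurable_fun setT f -> measurable_fun setT g -> (forall t, 0 <= g t) ->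
  (forall t, `|f t| <= C + g t) ->
  (\int[mu]_(t in I01) (g t)%:E < +oo)%E ->
  mu.-integrable I01 (EFin \o f).
Proof.
move=> mf mg g0 fg goo.
have ig : mu.-integrable I01 (EFin \o g).
  apply/integrableP; split; first exact/measurable_EFinP/measurable_funTS.
  by under eq_integral do rewrite /= ger0_norm //.
have iC : mu.-integrable I01 (EFin \o (fun=> C)).
  apply/integrableP; split; first exact/measurable_EFinP.
  rewrite integral_cst //= lebesgue_measure_itv /= lte_fin ltr01.
  by rewrite -EFinD subr0 mule1 ltry.
apply: le_integrable (integrableD _ iC ig) => //.
  exact/measurable_EFinP/measurable_funTS.
move=> t _ /=; rewrite lee_fin (le_trans (fg t)) //.
by rewrite (le_trans (ler_norm _)).
Qed.

Lemma integrable_ln_circ (w : R[i]) :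
  mu.-integrable I01 (EFin \o (fun t => ln (nm (circ t - w)))).
Proof.
apply: (@integrable_bound _ (fun t => log_plus (1 / nm (circ t - w)))
  (log_plus (1 + nm w))).
- exact: measurable_ln_circ.
- apply: (measurableT_comp measurable_log_plus); apply: measurable_funM => //.
  apply: (measurableT_comp measurable_inv); exact: measurable_nm_circ1.
- by move=> t; exact: log_plus_ge0.
- move=> t; rewrite div1r; apply: le_trans (norm_ln_le (nm_ge0 _)) _.
  rewrite lerD2r ler_log_plus ?nm_ge0 //.
  by apply: le_trans (nm_le_add _ _) _; rewrite nm_circ nm_opp.
- apply: le_lt_trans (log_plus_circ_le w ler01) _; exact: ltry.
Qed.

(** Uniqueness of Lebesgue measure: [k] times the pushforward gives every half-open interval its
    length. *)
Lemma lebesgue_measure_affine (k b : R) (A : set R) : 0 < k -> measurable A ->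
  pushforward mu (fun t => k * t + b) A = (k^-1%:E * mu A)%E.
Proof.
move=> k0 mA.
have mphi : measurable_fun setT ((fun t => k * t + b) : measurableTypeR R -> measurableTypeR R).
  by apply: measurable_funD => //; exact: mulrl_measurable.
pose phi : {mfun measurableTypeR R >-> measurableTypeR R} :=
  HB.pack ((fun t => k * t + b) : measurableTypeR R -> measurableTypeR R)
   (isMeasurableFun.Build _ _ _ _ _ mphi).
have kn : (0 <= k) by exact: ltW.
have := @lebesgue_measure_unique R (mscale (NngNum kn) (pushforward mu phi)) _ A mA.
rewrite /mscale /= => ->; last first.
  move=> _ [[u v] _ <-] /=.
  rewrite /mscale /=; rewrite /pushforward /=.
  rewrite (_ : _ @^-1` _ = `](u - b) / k, (v - b) / k]%classic); last first.
    apply/seteqP; split => t /=; rewrite !in_itv /= ltr_pdivrMr // ler_pdivlMr //;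
    by rewrite ltrBlDr lerBrDr [t * k]mulrC.
  rewrite !lebesgue_measure_itv /= !lte_fin ltr_pM2r ?invr_gt0 // ltrD2r.
  case: ifP => _; last by rewrite mule0.
  rewrite -!EFinD -EFinM; congr EFin; field; exact: lt0r_neq0.
by rewrite muleA -EFinM mulVf ?mul1e // lt0r_neq0.
Qed.

(** The scaling of the measure is applied to the positive and the negative part separately;
    integrability of the pulled-back function makes both integrals finite, so that their difference
    can be formed. *)
Lemma integral_affine (k b : R) (D : set R) (f : R -> R) :
  0 < k -> measurable D -> measurable_fun setT f ->
  mu.-integrable ((fun t => k * t + b) @^-1` D) (EFin \o (fun t => f (k * t + b))) ->
  \int[mu]_(t in (fun t => k * t + b) @^-1` D) f (k * t + b) =
  k^-1 * \int[mu]_(t in D) f t.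
Proof.
move=> k0 mD mf fi; rewrite /Rintegral.
have mphi : measurable_fun setT ((fun t => k * t + b) : measurableTypeR R -> measurableTypeR R).
  by apply: measurable_funD => //; exact: mulrl_measurable.
pose phi : {mfun measurableTypeR R >-> measurableTypeR R} :=
  HB.pack ((fun t => k * t + b) : measurableTypeR R -> measurableTypeR R)
   (isMeasurableFun.Build _ _ _ _ _ mphi).
have kn : 0 <= k^-1 by rewrite invr_ge0 ltW.
have mEf : measurable_fun setT (EFin \o f : measurableTypeR R -> \bar R) by apply/measurable_EFinP.
have h := @integral_pushforward _ _ _ _ R phi mphi mu D (EFin \o f) mEf fi mD.
have hi := @integrable_pushforward _ _ _ _ R phi mphi mu D (EFin \o f) mEf fi mD.
have E (A : set (measurableTypeR R)) : measurable A -> A `<=` D ->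
    pushforward mu phi A = mscale (NngNum kn) mu A.
  by move=> mA _; rewrite /mscale /=; exact: lebesgue_measure_affine.
transitivity (fine (\int[pushforward mu phi]_(y in D) (EFin \o f) y)); first by rewrite h.
have mfD : measurable_fun D (EFin \o f) by exact: measurable_funTS.
have pE (g : measurableTypeR R -> \bar R) :
    measurable_fun (D : set (measurableTypeR R)) g -> (forall x, 0 <= g x)%E ->
    (\int[pushforward mu phi]_(y in D) g y = k^-1%:E * \int[mu]_(y in D) g y)%E.
  move=> mg g0; have /= <- := @ge0_integral_mscale _ _ R (mu : {measure set (measurableTypeR R) -> \bar R})
    _ mD (NngNum kn) g mg (fun x _ => g0 x).
  exact: eq_measure_integral.
have kk : k^-1 != 0 by rewrite invr_neq0 // lt0r_neq0.
have ip := integrable_pos_fin_num mD (mu := pushforward mu phi) hi.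
have iq := integrable_neg_fin_num mD (mu := pushforward mu phi) hi.
rewrite (integralE mu) (integralE (pushforward mu phi)).
move: (ip mphi) (iq mphi).
rewrite (pE _ (measurable_funepos mfD)); last by move=> x; exact: funepos_ge0.
rewrite (pE _ (measurable_funeneg mfD)); last by move=> x; exact: funeneg_ge0.
have ki : (0 < k^-1%:E)%E by rewrite lte_fin invr_gt0.
rewrite -/(comp EFin f).
case: (\int[mu]_(y in D) _^\+ y)%E => [p| |]; rewrite ?gt0_muley ?gt0_muleNy //.
case: (\int[mu]_(y in D) _^\- y)%E => [q| |]; rewrite ?gt0_muley ?gt0_muleNy //.
by move=> _ _; rewrite -!EFinM -!EFinB /= mulrBr.
Qed.

Lemma measurable_log_plus_circ (w : R[i]) (s : R) :
  measurable_fun setT (fun t => log_plus (s / nm (circ t - w))).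
Proof.
apply: (measurableT_comp measurable_log_plus); apply: measurable_funM => //.
apply: (measurableT_comp measurable_inv); exact: measurable_nm_circ1.
Qed.

Lemma integrable_log_plus_circ (w : R[i]) (s : R) : 0 <= s ->
  mu.-integrable I01 (EFin \o (fun t => log_plus (s / nm (circ t - w)))).
Proof.
move=> s0; apply/integrableP; split.
  apply/measurable_EFinP/measurable_funTS; exact: measurable_log_plus_circ.
under eq_integral do rewrite /= ger0_norm ?log_plus_ge0 //.
by apply: le_lt_trans (log_plus_circ_le w s0) _; exact: ltry.
Qed.

Lemma Rintegral_log_plus_circ (w : R[i]) (s : R) : 0 <= s ->
  \int[mu]_(t in I01) log_plus (s / nm (circ t - w)) <= 2 * circ_const * s.
Proof.
move=> s0; rewrite -lee_fin /Rintegral fineK ?log_plus_circ_le //.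
by apply: integrable_fin_num (integrable_log_plus_circ w s0).
Qed.

(** The bound of [circ_near_measure] at distance 0. The null set matters because
    [ln (x * y) = ln x + ln y] breaks down at the default value [ln 0 = 0]. *)
Lemma circ_avoid (s : seq R[i]) : exists N : set R,
  [/\ measurable N, mu N = 0%E &
   forall t, I01 t -> ~ N t -> all (fun w => nm (circ t - w) != 0) s].
Proof.
elim: s => [|w s [N [mN N0 NP]]]; first by exists set0; split.
pose Z : set R := I01 `&` [set t | nm (circ t - w) <= 0].
have mZ : measurable Z.
  apply: measurableI => //.
  have /(_ measurableT `]-oo, 0]%classic (measurable_itv _)) := measurable_nm_circ1 w.
  by rewrite setTI; congr measurable; apply/funext => t; rewrite /= in_itv.
have Z0 : mu Z = 0%E.
  apply/eqP; rewrite eq_le measure_ge0 andbT.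
  by apply: le_trans (circ_near_measure w (lexx 0)) _; rewrite mulr0.
exists (Z `|` N); split.
- exact: measurableU.
- apply/eqP; rewrite eq_le measure_ge0 andbT.
  by rewrite -(adde0 0%E) -{1}Z0 -N0; exact: measureU2.
- move=> t It ZN /=; rewrite NP ?andbT //; last by move=> Nt; apply: ZN; right.
  by apply/negP => /eqP w0; apply: ZN; left; split => //=; rewrite w0.
Qed.

Lemma mu01 : mu I01 = 1%E.
Proof. by rewrite lebesgue_measure_itv /= lte_fin ltr01 -EFinD subr0. Qed.

Lemma Rintegral_cst01 (c : R) : \int[mu]_(t in I01) c = c.
Proof.
rewrite Rintegral_cst //.
have -> : (lebesgue_measure_lebesgue_measure__canonical__measure_function_Measure R) I01 = 1%E by exact: mu01.
by rewrite mulr1.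
Qed.

Definition circ_mean (a : R[i]) : R := \int[mu]_(t in I01) ln (nm (circ t - a)).

(** Doubling maps half a turn onto the full circle, and [circ t ^+ 2 - a ^+ 2] factors into the
    differences with [a] and [- a]. A half-turn exchanges [- a] and [a], so the two logarithms on
    one half of the circle become the logarithm for [a] on both halves. *)
Lemma circ_mean_sqr (a : R[i]) : circ_mean (a ^+ 2) = 2 * circ_mean a.
Proof.
pose h0 : set R := `[0, 2^-1[%classic; pose h1 : set R := `[2^-1, 1[%classic.
pose f (b : R[i]) t := ln (nm (circ t - b)).
have E01 : I01 = h0 `|` h1.
  apply/seteqP; split => t; rewrite /h0 /h1 /= !in_itv /=.
    by move=> /andP[t0 t1]; case: (ltP t 2^-1) => ht; [left|right]; rewrite ?t0.
  by case=> /andP[t0 t1]; apply/andP; split; lra.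
have s0 : h0 `<=` I01 by rewrite E01; exact: subsetUl.
have s1 : h1 `<=` I01 by rewrite E01; exact: subsetUr.
have mh0 : measurable h0 by exact: measurable_itv.
have mh1 : measurable h1 by exact: measurable_itv.
have i0 b : mu.-integrable h0 (EFin \o f b).
  by apply: integrableS (integrable_ln_circ b); rewrite //; exact: measurable_itv.
have i1 b : mu.-integrable h1 (EFin \o f b).
  by apply: integrableS (integrable_ln_circ b); rewrite //; exact: measurable_itv.
have shift t : f a (1 * t + 2^-1) = f (- a) t.
  by rewrite /f mul1r circ_half -opprD nm_opp opprK.
have p1 : (fun t : R => 1 * t + 2^-1) @^-1` h1 = h0.
  by apply/seteqP; split => t; rewrite /h0 /h1 /= !in_itv /= => /andP[? ?]; apply/andP; split; lra.
have p2 : (fun t : R => 2 * t + 0) @^-1` I01 = h0.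
  by apply/seteqP; split => t; rewrite /h0 /= !in_itv /= => /andP[? ?]; apply/andP; split; lra.
have mf b : measurable_fun setT (f b) by exact: measurable_ln_circ.
have E1 : \int[mu]_(t in h1) f a t = \int[mu]_(t in h0) f (- a) t.
  have := @integral_affine 1 2^-1 h1 (f a) ltr01.
  rewrite p1 invr1 mul1r => <- //; last first.
    by apply: eq_integrable (i0 (- a)) => // t _; rewrite /= shift.
  by apply: eq_Rintegral => t _; rewrite shift.
have dbl t : nm (circ t - a) != 0 -> nm (circ t + a) != 0 ->
    f (a ^+ 2) (2 * t + 0) = f a t + f (- a) t.
  move=> n1 n2; rewrite /f addr0 circ2 subr_sqr Normc.normcM opprK lnM //.
  - by rewrite posrE lt_neqAle eq_sym n1 nm_ge0.
  - by rewrite posrE lt_neqAle eq_sym n2 nm_ge0.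
have [N [mN N0 NP]] := circ_avoid [:: a; - a].
have aeE : ae_eq mu h0 (fun t => (f (a ^+ 2) (2 * t + 0))%:E) (fun t => (f a t + f (- a) t)%:E).
  exists N; split => // t /= /not_implyP[ht ne]; apply: contrapT => Nt; apply: ne.
  by have /and3P[h h' _] := NP t (s0 _ ht) Nt; rewrite dbl // -[X in _ + X]opprK.
have mdbl : measurable_fun setT (fun t : R => f (a ^+ 2) (2 * t + 0)).
  apply: (measurableT_comp (mf _)); apply: measurable_funD => //; exact: mulrl_measurable.
have mfs : measurable_fun setT (fun t => f a t + f (- a) t) by apply: measurable_funD.
have isum : mu.-integrable h0 (EFin \o (fun t => f a t + f (- a) t)).
  by apply: eq_integrable (integrableD _ (i0 a) (i0 (- a))).
have E2 : \int[mu]_(t in h0) f (a ^+ 2) (2 * t + 0) = \int[mu]_(t in h0) (f a t + f (- a) t).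
  rewrite /Rintegral; congr fine; apply: ae_eq_integral => //.
  - exact/measurable_EFinP/measurable_funTS.
  - exact/measurable_EFinP/measurable_funTS.
have := @integral_affine 2 0 I01 (f (a ^+ 2)) (ltr0Sn R 1).
rewrite p2 E2 RintegralD // -E1 -Rintegral_setU //; last 2 first.
- by rewrite -E01; exact: integrable_ln_circ.
- apply/disj_set2P; apply/seteqP; split => // t [].
  rewrite /h0 /h1 /= !in_itv /= => /andP[_ t1] /andP[t2 _].
  by have := lt_le_trans t1 t2; rewrite ltxx.
rewrite -E01 /circ_mean -/(f a) => ->//; first by rewrite mulrA divff ?mul1r ?pnatr_eq0.
apply/integrableP; split; first exact/measurable_EFinP/measurable_funTS.
have /integrableP[_] := isum; congr (_ < _)%E; apply: ae_eq_integral => //.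
- by apply: measurableT_comp => //; exact/measurable_EFinP/measurable_funTS.
- by apply: measurableT_comp => //; exact/measurable_EFinP/measurable_funTS.
- exists N; split => // t /= /not_implyP[ht ne]; apply: contrapT => Nt; apply: ne.
  by have /and3P[h h' _] := NP t (s0 _ ht) Nt; rewrite dbl // -[X in _ + X]opprK.
Qed.

Lemma log_plus_1D_le (x : R) : 0 <= x -> log_plus (1 + x) <= 1 + log_plus x.
Proof.
move=> x0; rewrite log_plus1D //; have [x1|x1] := leP x 1.
  have : ln (1 + x) <= x by rewrite le_ln1Dx //; lra.
  by have := log_plus_ge0 x; lra.
have x_gt0 : 0 < x by lra.
have xi : 0 < x^-1 by rewrite invr_gt0.
have -> : 1 + x = x * (1 + x^-1) by field; rewrite gt_eqF.
rewrite lnM ?posrE //; last by lra.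
rewrite addrC lerD ?ln_le_log_plus //.
apply: (@le_trans _ _ x^-1); last by rewrite invf_le1 // ltW.
by rewrite le_ln1Dx //; lra.
Qed.

(** A crude comparison, uniform in [a], as input for [circ_meanE]: the integrand and
    [log_plus (nm a)] differ by at most [1 + log_plus (1 / nm (circ t - a))], whose mean
    [log_plus_circ_le] bounds. *)
Lemma circ_mean_bound (a : R[i]) :
  `|circ_mean a - log_plus (nm a)| <= 1 + 2 * circ_const.
Proof.
have ic (c : R) : mu.-integrable I01 (EFin \o (fun=> c)).
  by apply: (@integrable_bound _ (fun=> 0) `|c|) => //= [t|]; rewrite ?addr0 ?integral0.
have -> : circ_mean a - log_plus (nm a) =
    \int[mu]_(t in I01) (ln (nm (circ t - a)) - log_plus (nm a)).
  rewrite RintegralB //; last exact: integrable_ln_circ.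
  by rewrite Rintegral_cst01.
have ib : mu.-integrable I01 (EFin \o (fun t => ln (nm (circ t - a)) - log_plus (nm a))).
  by apply: eq_integrable (integrableB _ (integrable_ln_circ a) (ic _)).
apply: le_trans (le_normr_Rintegral _ ib) _ => //.
apply: (@le_trans _ _ (\int[mu]_(t in I01) (1 + log_plus (1 / nm (circ t - a))))).
  apply: le_Rintegral => //.
  - by apply: eq_integrable (integrable_abse ib).
  - by apply: eq_integrable (integrableD _ (ic 1) (integrable_log_plus_circ a ler01)).
  move=> t _; rewrite ln_log_plus ?nm_ge0 // div1r.
  have p0 := log_plus_ge0 (nm (circ t - a))^-1.
  have h1 : log_plus (nm (circ t - a)) <= 1 + log_plus (nm a).
    apply: le_trans (log_plus_1D_le (nm_ge0 _)); apply: ler_log_plus; first exact: nm_ge0.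
    by apply: le_trans (nm_le_add _ _) _; rewrite nm_circ nm_opp.
  have h2 : log_plus (nm a) <= 1 + log_plus (nm (circ t - a)).
    apply: le_trans (log_plus_1D_le (nm_ge0 _)); apply: ler_log_plus; first exact: nm_ge0.
    rewrite -[in leLHS](subKr (circ t) a) -(nm_circ t) -[in leRHS](nm_opp (_ - a)).
    exact: nm_le_add.
  by rewrite ler_norml; apply/andP; split; lra.
rewrite RintegralD //; last exact: integrable_log_plus_circ.
rewrite Rintegral_cst01 lerD2l.
by apply: le_trans (Rintegral_log_plus_circ a ler01) _; rewrite mulr1.
Qed.

Lemma log_plus_sqr (x : R) : 0 <= x -> log_plus (x ^+ 2) = 2 * log_plus x.
Proof.
rewrite le_eqVlt => /predU1P[<-|x0].
  by rewrite expr0n /= /log_plus ln0 // maxxx mulr0.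
by rewrite /log_plus lnXn // maxr_pMr // mulr0 mulr_natl.
Qed.

(** Squaring [a] doubles both sides. The error at [a ^+ (2 ^ k)] is therefore [2 ^ k] times the
    error at [a], yet it stays below the fixed bound of [circ_mean_bound]; so it is zero. *)
Lemma circ_meanE (a : R[i]) : circ_mean a = log_plus (nm a).
Proof.
have H k : 2 ^+ k * `|circ_mean a - log_plus (nm a)| <= 1 + 2 * circ_const.
  suff -> : 2 ^+ k * `|circ_mean a - log_plus (nm a)| =
     `|circ_mean (a ^+ (2 ^ k)) - log_plus (nm (a ^+ (2 ^ k)))|.
    exact: circ_mean_bound.
  elim: k => [|k IH]; first by rewrite expn0 !expr0 mul1r expr1.
  rewrite exprS -mulrA IH expnS mulnC exprM circ_mean_sqr (nmX _ 2) log_plus_sqr ?nm_ge0 //.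
  by rewrite -mulrBr normrM ger0_norm.
apply/eqP; rewrite -subr_eq0 -normr_eq0; apply/eqP/le_anti; rewrite normr_ge0 andbT.
rewrite leNgt; apply/negP => d0.
set d := `|_| in d0 H.
have [k kd] : exists k : nat, (1 + 2 * circ_const) / d < k%:R.
  by exists (Num.truncn ((1 + 2 * circ_const) / d)).+1; exact: truncnS_gt.
have := H k; rewrite leNgt => /negP; apply.
rewrite ltr_pdivrMr // in kd; apply: lt_le_trans kd _.
by rewrite ler_pM2r // -natrX ler_nat ltnW // ltn_expl.
Qed.

(** Rescaling to the unit circle gives [ln r + log_plus (nm (w - c) / r)], which is the logarithm of
    the maximum. *)
Lemma jensen (c w : R[i]) (r : R) : 0 < r ->
  \int[mu]_(t in I01) ln (nm (c + r%:C * circ t - w)) =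
  ln (Num.max r (nm (w - c))).
Proof.
move=> r0; have rC : r%:C != 0 by rewrite -nm_eq0 nm_real gtr0_norm // gt_eqF.
pose a := (w - c) / r%:C.
have E t : c + r%:C * circ t - w = r%:C * (circ t - a).
  by rewrite mulrBr /a [r%:C * (_ / _)]mulrC divfK //; ring.
have [N [mN N0 NP]] := circ_avoid [:: a].
have ic (d : R) : mu.-integrable I01 (EFin \o (fun=> d)).
  by apply: (@integrable_bound _ (fun=> 0) `|d|) => //= [t|]; rewrite ?addr0 ?integral0.
transitivity (\int[mu]_(t in I01) (ln r + ln (nm (circ t - a)))).
  rewrite /Rintegral; congr fine; apply: ae_eq_integral => //.
  - apply/measurable_EFinP; apply: measurable_funTS.
    by apply: measurableT_comp => //; exact: measurable_nm_circ.
  - apply/measurable_EFinP; apply: measurable_funTS.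
    by apply: measurable_funD => //; exact: measurable_ln_circ.
  - exists N; split => // t /= /not_implyP[ht ne]; apply: contrapT => Nt; apply: ne.
    have /andP[h _] := NP t ht Nt.
    rewrite E Normc.normcM nm_real gtr0_norm // lnM //.
    by rewrite posrE lt_neqAle eq_sym h nm_ge0.
rewrite RintegralD //; last exact: integrable_ln_circ.
rewrite Rintegral_cst01 -/(circ_mean a) circ_meanE.
have -> : nm a = nm (w - c) / r by rewrite /a Normc.normcM Normc.normcV nm_real gtr0_norm.
rewrite /log_plus; have := nm_ge0 (w - c); rewrite le_eqVlt => /predU1P[<-|wc].
  by rewrite mul0r (ln0 (lexx 0)) maxxx addr0 max_l // ltW.
rewrite ln_div ?posrE //.
have [h|h] := leP (nm (w - c)) r.
  by rewrite max_r ?addr0 // subr_le0 ler_ln ?posrE.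
by rewrite max_l ?subrKC // subr_ge0 ler_ln ?posrE // ltW.
Qed.

End Circle.

(** * The logarithmic potential of the critical points *)

Section ComplexMeasurable.
Context {R : realType}.

(** Complex functions are handled through their two coordinates, so that only measurability of real
    functions is involved. *)
Definition cmeas d (T : measurableType d) (f : T -> R[i]) : Prop :=
  measurable_fun setT (fun t => complex.Re (f t)) /\
  measurable_fun setT (fun t => complex.Im (f t)).

Context d (T : measurableType d).
Implicit Types f g : T -> R[i].

Lemma cmeas_cst (c : R[i]) : cmeas (fun _ : T => c).
Proof. by split. Qed.

Lemma cmeasD f g : cmeas f -> cmeas g -> cmeas (fun t => f t + g t).
Proof.
move=> [f1 f2] [g1 g2]; split.
  rewrite (_ : (fun t => _) = (fun t => complex.Re (f t) + complex.Re (g t))).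
    exact: measurable_funD.
  by apply/funext => t; case: (f t) (g t) => [a b] [a' b'].
rewrite (_ : (fun t => _) = (fun t => complex.Im (f t) + complex.Im (g t))).
  exact: measurable_funD.
by apply/funext => t; case: (f t) (g t) => [a b] [a' b'].
Qed.

Lemma cmeasN f : cmeas f -> cmeas (fun t => - f t).
Proof.
move=> [f1 f2]; split.
  rewrite (_ : (fun t => _) = (fun t => - complex.Re (f t))).
    exact: measurable_funN.
  by apply/funext => t; case: (f t).
rewrite (_ : (fun t => _) = (fun t => - complex.Im (f t))).
  exact: measurable_funN.
by apply/funext => t; case: (f t).
Qed.

Lemma cmeasB f g : cmeas f -> cmeas g -> cmeas (fun t => f t - g t).
Proof. by move=> mf mg; apply: cmeasD => //; exact: cmeasN. Qed.

Lemma cmeasM f g : cmeas f -> cmeas g -> cmeas (fun t => f t * g t).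
Proof.
move=> [f1 f2] [g1 g2]; split.
  rewrite (_ : (fun t => _) = (fun t => complex.Re (f t) * complex.Re (g t) -
     complex.Im (f t) * complex.Im (g t))).
    by apply: measurable_funB; exact: measurable_funM.
  by apply/funext => t; case: (f t) (g t) => [a b] [a' b'].
rewrite (_ : (fun t => _) = (fun t => complex.Re (f t) * complex.Im (g t) +
   complex.Im (f t) * complex.Re (g t))).
  by apply: measurable_funD; exact: measurable_funM.
by apply/funext => t; case: (f t) (g t) => [a b] [a' b'].
Qed.

Lemma cmeasV f : cmeas f -> cmeas (fun t => (f t)^-1).
Proof.
move=> [f1 f2].
have m2 : measurable_fun setT
    (fun t => (complex.Re (f t) ^+ 2 + complex.Im (f t) ^+ 2)^-1).
  apply: (measurableT_comp measurable_inv).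
  by apply: measurable_funD; exact: measurable_funX.
split.
  rewrite (_ : (fun t => _) = (fun t => complex.Re (f t) *
     (complex.Re (f t) ^+ 2 + complex.Im (f t) ^+ 2)^-1)); first exact: measurable_funM.
  by apply/funext => t; case: (f t).
rewrite (_ : (fun t => _) = (fun t => - (complex.Im (f t) *
   (complex.Re (f t) ^+ 2 + complex.Im (f t) ^+ 2)^-1))).
  by apply: measurable_funN; exact: measurable_funM.
by apply/funext => t; case: (f t).
Qed.

Lemma cmeas_sum I (s : seq I) (F : I -> T -> R[i]) :
  (forall i, cmeas (F i)) -> cmeas (fun t => \sum_(i <- s) F i t).
Proof.
move=> mF; elim: s => [|i s IH].
  by rewrite (_ : (fun t => _) = fun=> 0); [exact: cmeas_cst|apply/funext => t; rewrite big_nil].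
rewrite (_ : (fun t => _) = (fun t => F i t + \sum_(i <- s) F i t)); first exact: cmeasD.
by apply/funext => t; rewrite big_cons.
Qed.

Lemma cmeas_nm f : cmeas f -> measurable_fun setT (fun t => nm (f t)).
Proof.
move=> [f1 f2].
rewrite (_ : (fun t => _) = (fun t => Num.sqrt (complex.Re (f t) ^+ 2 + complex.Im (f t) ^+ 2))).
  apply: (measurableT_comp (continuous_measurable_fun (@sqrt_continuous R))).
  by apply: measurable_funD; exact: measurable_funX.
by apply/funext => t; case: (f t).
Qed.

Lemma cmeas_comp d' (U : measurableType d') f (g : U -> T) :
  cmeas f -> measurable_fun setT g -> cmeas (fun u => f (g u)).
Proof. by move=> [f1 f2] mg; split; [exact: (measurableT_comp f1)|exact: (measurableT_comp f2)]. Qed.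

Lemma cmeas_circ : cmeas (fun t : R => circ t).
Proof.
split; rewrite /circ /=.
  apply: (measurableT_comp (continuous_measurable_fun (@continuous_cos R))).
  exact: mulrr_measurable.
apply: (measurableT_comp (continuous_measurable_fun (@continuous_sin R))).
exact: mulrr_measurable.
Qed.

End ComplexMeasurable.

Section RintegralSum.
Context d (T : measurableType d) (R : realType) (m : {measure set T -> \bar R}).
Context (D : set T) (mD : measurable D).

Lemma integrable_EFin_sum (I : Type) (s : seq I) (F : I -> T -> R) :
  (forall i, m.-integrable D (EFin \o F i)) ->
  m.-integrable D (EFin \o (fun t => \sum_(i <- s) F i t)).
Proof.
move=> iF.
have := @integrable_sum _ _ _ m D mD I s xpredT (fun i => EFin \o F i) (fun i _ => iF i).
by apply: eq_integrable => // t _ /=; rewrite sumEFin.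
Qed.

Lemma Rintegral_bigsum (I : Type) (s : seq I) (F : I -> T -> R) :
  (forall i, m.-integrable D (EFin \o F i)) ->
  \int[m]_(t in D) (\sum_(i <- s) F i t) = \sum_(i <- s) \int[m]_(t in D) F i t.
Proof.
move=> iF; elim: s => [|i s IH].
  rewrite big_nil /Rintegral integral0_eq // => t _; by rewrite big_nil.
rewrite big_cons -IH -RintegralD //; last exact: integrable_EFin_sum.
by apply: eq_Rintegral => t _; rewrite big_cons.
Qed.

End RintegralSum.

(** * Potentials of the zeros and of the critical points, compared on a circle *)

Section CriticalPotential.
Context {R : realType}.
Local Notation mu := (@lebesgue_measure R).
Local Notation I01 := (`[0, 1[%classic : set R).
Implicit Types (xs ws : seq R[i]) (c z w : R[i]).

Definition logderiv xs z : R[i] := \sum_(x <- xs) (z - x)^-1.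

Lemma logderivE xs z : z \notin xs ->
  (\prod_(x <- xs) ('X - x%:P))^`().[z] =
  (\prod_(x <- xs) (z - x)) * logderiv xs z.
Proof.
rewrite /logderiv; elim: xs => [|x xs IH]; first by rewrite !big_nil derivC horner0 mulr0.
rewrite inE negb_or => /andP[zx /IH {}IH]; rewrite !big_cons derivM hornerD !hornerM IH.
rewrite derivXsubC hornerC mul1r !hornerXsubC horner_prod.
rewrite (eq_bigr (fun x => z - x)) => [|i _]; last by rewrite hornerXsubC.
by rewrite mulrDr mulrAC divff ?subr_eq0 // mul1r mulrA.
Qed.

Definition circle c (r t : R) : R[i] := c + r%:C * circ t.

Lemma circleB c r t w : 0 < r ->
  nm (circle c r t - w) = r * nm (circ t - (w - c) / r%:C).
Proof.
move=> r0; have rC : r%:C != 0 :> R[i] by rewrite -nm_eq0 nm_real gtr0_norm // gt_eqF.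
rewrite -[r in r * _]gtr0_norm // -nm_real -Normc.normcM; congr nm.
by rewrite /circle mulrBr [r%:C * (_ / _)]mulrC divfK //; ring.
Qed.

Lemma circle_avoid c r (s : seq R[i]) : 0 < r -> exists N : set R,
  [/\ measurable N, mu N = 0%E & forall t, I01 t -> ~ N t -> circle c r t \notin s].
Proof.
move=> r0; have [N [mN N0 NP]] := circ_avoid [seq (w - c) / r%:C | w <- s].
exists N; split => // t It Nt; have := NP t It Nt; rewrite all_map => /allP h.
apply/negP => zs; have := h _ zs; rewrite /=.
have := circleB c t (circle c r t) r0; rewrite subrr Normc.normc0 => /esym/eqP.
by rewrite mulf_eq0 gt_eqF //= => ->.
Qed.

Lemma nm_circle_le c r t w : 0 < r -> nm (circle c r t - w) <= nm c + r + nm w.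
Proof.
move=> r0; apply: le_trans (nm_le_add _ _) _; rewrite nm_opp lerD2r.
apply: le_trans (nm_le_add _ _) _; rewrite lerD2l.
by rewrite Normc.normcM nm_real nm_circ mulr1 gtr0_norm.
Qed.

Lemma log_plus_circleE c r w s t : 0 < r ->
  log_plus (s / nm (circle c r t - w)) =
  log_plus (s / r / nm (circ t - (w - c) / r%:C)).
Proof. by move=> r0; rewrite circleB // invfM mulrA. Qed.

Lemma integrable_log_plus_circle c r w s : 0 < r -> 0 <= s ->
  mu.-integrable I01 (EFin \o (fun t => log_plus (s / nm (circle c r t - w)))).
Proof.
move=> r0 s0.
have -> : (fun t => log_plus (s / nm (circle c r t - w))) =
    (fun t => log_plus (s / r / nm (circ t - (w - c) / r%:C))).
  by apply/funext => t; exact: log_plus_circleE.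
by apply: integrable_log_plus_circ; rewrite divr_ge0 // ltW.
Qed.

Lemma Rintegral_log_plus_circle c r w s : 0 < r -> 0 <= s ->
  \int[mu]_(t in I01) log_plus (s / nm (circle c r t - w)) <=
  2 * circ_const * (s / r).
Proof.
move=> r0 s0; under eq_Rintegral do rewrite log_plus_circleE //.
by apply: Rintegral_log_plus_circ; rewrite divr_ge0 // ltW.
Qed.

Lemma cmeas_circle c r : cmeas (circle c r).
Proof.
by apply: cmeasD; [exact: cmeas_cst|apply: cmeasM; [exact: cmeas_cst|exact: cmeas_circ]].
Qed.

Lemma measurable_ln_circle c r w :
  measurable_fun setT (fun t => ln (nm (circle c r t - w))).
Proof.
apply: measurableT_comp => //; apply: cmeas_nm; apply: cmeasB; last exact: cmeas_cst.
exact: cmeas_circle.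
Qed.

Lemma measurable_log_plus_circle c r w s :
  measurable_fun setT (fun t => log_plus (s / nm (circle c r t - w))).
Proof.
apply: (measurableT_comp (@measurable_log_plus R)); apply: measurable_funM => //.
apply: (measurableT_comp measurable_inv).
by apply: cmeas_nm; apply: cmeasB; [exact: cmeas_circle|exact: cmeas_cst].
Qed.

Lemma integrable_ln_circle c r w : 0 < r ->
  mu.-integrable I01 (EFin \o (fun t => ln (nm (circle c r t - w)))).
Proof.
move=> r0; apply: (@integrable_bound _ _ (fun t => log_plus (1 / nm (circle c r t - w)))
  (log_plus (nm c + r + nm w))).
- exact: measurable_ln_circle.
- exact: measurable_log_plus_circle.
- by move=> t; exact: log_plus_ge0.
- move=> t; rewrite div1r; apply: le_trans (norm_ln_le (nm_ge0 _)) _.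
  by rewrite lerD2r ler_log_plus ?nm_ge0 // nm_circle_le.
- have /integrableP[_] := integrable_log_plus_circle c w r0 ler01.
  by under eq_integral do rewrite /= ger0_norm ?log_plus_ge0 //.
Qed.

Lemma ler_sum_mem (I : eqType) (s : seq I) (F G : I -> R) :
  {in s, forall i, F i <= G i} -> \sum_(i <- s) F i <= \sum_(i <- s) G i.
Proof. by move=> FG; rewrite big_seq [leRHS]big_seq; apply: ler_sum. Qed.

(** With [S] the sum on the right, every [nm (z - x)^-1] is at most [expR (M + S)]: the excess of
    its logarithm over [M], if any, is one of the nonnegative summands of [S]. *)
Lemma logderiv_le xs z (M : R) : z \notin xs -> 0 <= M ->
  log_plus (nm (logderiv xs z)) <=
  ln (size xs)%:R + M + \sum_(x <- xs) log_plus (expR (- M) / nm (z - x)).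
Proof.
move=> zxs M0; set S := \sum_(x <- xs) _.
have S0 : 0 <= S by apply: sumr_ge0 => x _; exact: log_plus_ge0.
have [->|xs0] := eqVneq xs [::].
  rewrite /logderiv big_nil Normc.normc0 {1}/log_plus ln0 // maxxx.
  by rewrite add0r addr_ge0.
have n0 : 1 <= (size xs)%:R :> R by rewrite ler1n lt0n size_eq0.
have n1 : 0 < (size xs)%:R :> R by apply: lt_le_trans n0.
have H : nm (logderiv xs z) <= (size xs)%:R * expR (M + S).
  apply: (@le_trans _ _ (\sum_(x <- xs) expR (M + S))); last first.
    by rewrite big_const_seq count_predT iter_addr_0 mulr_natl.
  apply: (@le_trans _ _ (\sum_(x <- xs) nm (z - x)^-1)).
    rewrite /logderiv; elim: (xs) => [|x s IH]; first by rewrite !big_nil Normc.normc0.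
    by rewrite !big_cons; apply: le_trans (nm_le_add _ _) _; rewrite lerD2l.
  apply: ler_sum_mem => x xxs.
  have zx : 0 < nm (z - x).
    by rewrite nm_gt0 subr_eq0; apply: contraNneq zxs => ->.
  rewrite Normc.normcV -[leLHS]lnK ?posrE ?invr_gt0 // ler_expR.
  have : log_plus (expR (- M) / nm (z - x)) <= S.
    rewrite /S (big_rem x) //= lerDl; apply: sumr_ge0 => y _; exact: log_plus_ge0.
  have := ln_le_log_plus (expR (- M) / nm (z - x)).
  rewrite ln_div ?posrE ?expR_gt0 // expRK lnV ?posrE //; lra.
rewrite /log_plus ge_max; apply/andP; split; last first.
  by rewrite !addr_ge0 // ln_ge0.
have [l0|] := ltP 0 (nm (logderiv xs z)); last first.
  by move/ln0 => ->; rewrite !addr_ge0 // ln_ge0.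
rewrite -addrA -[M + S]expRK -lnM ?posrE ?expR_gt0 // ler_ln ?posrE //.
by rewrite mulr_gt0 ?expR_gt0.
Qed.

(** Pointwise form of the estimate: where [logderiv] is at least [1/n] its logarithm is small
   compared with [n]; elsewhere it is written as the difference of the logarithms of [P'] and [P]. *)
Lemma ln_logderiv_bound xs ws z (M B : R) :
  (1 < size xs)%N -> size ws = (size xs).-1 -> 0 <= M ->
  (\prod_(x <- xs) ('X - x%:P))^`() = (size xs)%:R *: \prod_(w <- ws) ('X - w%:P) ->
  z \notin xs ++ ws -> \sum_(x <- xs) log_plus (nm (z - x)) <= B ->
  `|ln (size xs)%:R + \sum_(w <- ws) ln (nm (z - w)) - \sum_(x <- xs) ln (nm (z - x))| <=
  2 * ln (size xs)%:R + M + \sum_(x <- xs) log_plus (expR (- M) / nm (z - x)) +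
  \sum_(w <- ws) log_plus (expR (- M) / nm (z - w)) +
  (nm (logderiv xs z) < (size xs)%:R^-1)%R%:R * (B + (size xs)%:R * M).
Proof.
move=> n1 sw M0 dP; rewrite mem_cat negb_or => /andP[zxs zws] VB.
set n := size xs; set A := \sum_(w <- ws) ln _; set C := \sum_(x <- xs) ln _.
set S := \sum_(x <- xs) _; set S' := \sum_(w <- ws) log_plus _.
have nR : 1 < n%:R :> R by rewrite ltr1n.
have ln_n : 0 <= ln (n%:R : R) by rewrite ln_ge0 // ltW.
have S0 : 0 <= S by apply: sumr_ge0 => x _; exact: log_plus_ge0.
have S'0 : 0 <= S' by apply: sumr_ge0 => x _; exact: log_plus_ge0.
have B0 : 0 <= B by apply: le_trans VB; apply: sumr_ge0 => x _; exact: log_plus_ge0.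
have ln_prod s : z \notin s ->
    ln (nm (\prod_(x <- s) (z - x))) = \sum_(x <- s) ln (nm (z - x)) /\
    0 < nm (\prod_(x <- s) (z - x)).
  elim: s => [|x s IH]; first by rewrite !big_nil Normc.normc1 ln1.
  rewrite inE negb_or => /andP[zx /IH[IH1 IH2]]; rewrite !big_cons Normc.normcM.
  have zx0 : 0 < nm (z - x) by rewrite nm_gt0 subr_eq0.
  by split; [rewrite lnM ?posrE // IH1|rewrite mulr_gt0].
have [EC C0] := ln_prod _ zxs; have [EA A0] := ln_prod _ zws.
have := logderivE zxs; rewrite dP hornerZ horner_prod.
rewrite (eq_bigr (fun x => z - x)) => [|i _]; last by rewrite hornerXsubC.
move=> /(congr1 (@Normc.normc R)); rewrite !Normc.normcM.
have -> : nm (n%:R : R[i]) = n%:R :> R.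
  by rewrite -[n%:R]mulr1n -(rmorph_nat (real_complex R)) nm_real ger0_norm.
move=> E.
have L0 : 0 < nm (logderiv xs z).
  have : 0 < n%:R * nm (\prod_(w <- ws) (z - w)) by rewrite mulr_gt0 //; lra.
  by rewrite E pmulr_rgt0.
(* Logarithms of [P' = P * L]; the term [ln n] comes from the leading coefficient of [P']. *)
have F : ln n%:R + A - C = ln (nm (logderiv xs z)).
  apply/eqP; rewrite subr_eq /A /C -EC -EA -!lnM ?posrE // ?E; last by lra.
  by rewrite mulrC.
have up := le_trans (ln_le_log_plus _) (logderiv_le zxs M0).
rewrite F ler_norml; apply/andP; split; last first.
  apply: le_trans up _; rewrite -/n -/S.
  have : 0 <= (nm (logderiv xs z) < n%:R^-1)%R%:R * (B + n%:R * M).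
    by rewrite mulr_ge0 // addr_ge0 // mulr_ge0.
  lra.
have [small|big] := ltP (nm (logderiv xs z)) n%:R^-1.
  rewrite mul1r -F.
  have CB : C <= B by apply: le_trans VB; apply: ler_sum => x _; exact: ln_le_log_plus.
  (* Critical points at distance at least [expR (- M)] contribute at least [- M] each; the deficit
     of the closer ones is the truncated sum [S']. *)
  have AS : - (n%:R * M) - S' <= A.
    have : \sum_(w <- ws) (- M - log_plus (expR (- M) / nm (z - w))) <= A.
      apply: ler_sum_mem => w wws.
      have zw : 0 < nm (z - w) by rewrite nm_gt0 subr_eq0; apply: contraNneq zws => ->.
      have := ln_le_log_plus (expR (- M) / nm (z - w)).
      rewrite ln_div ?posrE ?expR_gt0 // expRK; lra.
    rewrite big_split /= !sumrN -/S' => h; apply: le_trans h.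
    rewrite lerD2r lerN2 big_const_seq count_predT iter_addr_0 sw mulr_natl.
    by rewrite -![M *+ _]mulr_natl ler_wpM2r // ler_nat leq_pred.
  lra.
rewrite mul0r addr0.
have : - ln (n%:R : R) <= ln (nm (logderiv xs z)).
  by rewrite -lnV ?posrE ?ler_ln ?posrE ?invr_gt0 //; lra.
lra.
Qed.

Lemma measurable_small_logderiv xs c r (e : R) :
  measurable [set t : R | nm (logderiv xs (circle c r t)) < e].
Proof.
have m : measurable_fun setT (fun t => nm (logderiv xs (circle c r t))).
  apply: cmeas_nm; apply: cmeas_sum => x; apply: cmeasV; apply: cmeasB.
    exact: cmeas_circle.
  exact: cmeas_cst.
have := m measurableT `]-oo, e[%classic (measurable_itv _).
by rewrite setTI; congr measurable; apply/funext => t; rewrite /= in_itv.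
Qed.

(** The threshold [1 / n] has a logarithm that is [o(n)], and it is eventually below any fixed
    [delta / 2], as anticoncentration requires. *)
Definition small_measure xs c r : R :=
  fine (mu (I01 `&` [set t | nm (logderiv xs (circle c r t)) < (size xs)%:R^-1])).

(** The mean over the circle of [ln_logderiv_bound]. By [jensen] the left-hand side becomes a
    difference of potentials; each zero and each critical point contributes at most
    [2 * circ_const * (expR (- M) / r)] through its truncated singularity, whence the 4. *)
Lemma critical_potential c r xs ws (M : R) :
  0 < r -> (1 < size xs)%N -> size ws = (size xs).-1 -> 0 <= M ->
  (\prod_(x <- xs) ('X - x%:P))^`() = (size xs)%:R *: \prod_(w <- ws) ('X - w%:P) ->
  `|ln (size xs)%:R + \sum_(w <- ws) ln (Num.max r (nm (w - c))) -
     \sum_(x <- xs) ln (Num.max r (nm (x - c)))| <=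
  2 * ln (size xs)%:R + M + (size xs)%:R * (4 * circ_const * (expR (- M) / r)) +
  small_measure xs c r *
    (\sum_(x <- xs) log_plus (nm c + r + nm x) + (size xs)%:R * M).
Proof.
move=> r0 n1 sw M0 dP; rewrite /small_measure.
set n := size xs in n1 sw dP *; set B := \sum_(x <- xs) log_plus (nm c + r + nm x).
pose G := [set t : R | nm (logderiv xs (circle c r t)) < n%:R^-1]; rewrite -/G.
have mI : measurable (I01 : set (measurableTypeR R)) by exact: measurable_itv.
have mG : measurable G by exact: measurable_small_logderiv.
have ic (a : R) : mu.-integrable I01 (EFin \o (fun=> a)).
  by apply: (@integrable_bound _ _ (fun=> 0) `|a|) => //= [t|]; rewrite ?addr0 ?integral0.
have iln s : mu.-integrable I01 (EFin \o (fun t => \sum_(w <- s) ln (nm (circle c r t - w)))).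
  by apply: (@integrable_EFin_sum _ _ _ mu _ mI _ s) => w; exact: integrable_ln_circle.
have e0 := expR_ge0 (- M).
have ilp s : mu.-integrable I01
    (EFin \o (fun t => \sum_(w <- s) log_plus (expR (- M) / nm (circle c r t - w)))).
  by apply: (@integrable_EFin_sum _ _ _ mu _ mI _ s) => w; exact: integrable_log_plus_circle.
pose F t := ln n%:R + \sum_(w <- ws) ln (nm (circle c r t - w)) -
  \sum_(x <- xs) ln (nm (circle c r t - x)).
pose H t := 2 * ln n%:R + M + \sum_(x <- xs) log_plus (expR (- M) / nm (circle c r t - x)) +
  \sum_(w <- ws) log_plus (expR (- M) / nm (circle c r t - w)) + \1_G t * (B + n%:R * M).
have iG : mu.-integrable I01 (EFin \o (\1_G : R -> R)).
  apply: (@integrable_bound _ _ (fun=> 0) 1) => //.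
  - by move=> t; rewrite addr0 indicE; case: (_ \in _); rewrite ?normr1 ?normr0 ?ler01.
  - by rewrite integral0.
have iF1 : mu.-integrable I01 (EFin \o (fun t => ln n%:R + \sum_(w <- ws) ln (nm (circle c r t - w)))).
  by apply: eq_integrable (integrableD _ (ic (ln n%:R)) (iln ws)).
have iF : mu.-integrable I01 (EFin \o F).
  by apply: eq_integrable (integrableB _ iF1 (iln xs)).
have iG' : mu.-integrable I01 (EFin \o (fun t => \1_G t * (B + n%:R * M))).
  by apply: eq_integrable (integrableZr _ (B + n%:R * M) iG).
have iH1 : mu.-integrable I01 (EFin \o (fun t => 2 * ln n%:R + M +
    \sum_(x <- xs) log_plus (expR (- M) / nm (circle c r t - x)))).
  by apply: eq_integrable (integrableD _ (ic _) (ilp xs)).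
have iH2 : mu.-integrable I01 (EFin \o (fun t => 2 * ln n%:R + M +
    \sum_(x <- xs) log_plus (expR (- M) / nm (circle c r t - x)) +
    \sum_(w <- ws) log_plus (expR (- M) / nm (circle c r t - w)))).
  by apply: eq_integrable (integrableD _ iH1 (ilp ws)).
have iH : mu.-integrable I01 (EFin \o H).
  by apply: eq_integrable (integrableD _ iH2 iG').
have jen s : \int[mu]_(t in I01) (\sum_(w <- s) ln (nm (circle c r t - w))) =
    \sum_(w <- s) ln (Num.max r (nm (w - c))).
  rewrite (@Rintegral_bigsum _ _ _ mu _ mI); last by move=> w; exact: integrable_ln_circle.
  by apply: eq_bigr => w _; exact: jensen.
have EF : \int[mu]_(t in I01) F t = ln n%:R + \sum_(w <- ws) ln (Num.max r (nm (w - c))) -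
     \sum_(x <- xs) ln (Num.max r (nm (x - c))).
  by rewrite RintegralB // RintegralD // Rintegral_cst01 !jen.
have lps s : \int[mu]_(t in I01) (\sum_(w <- s) log_plus (expR (- M) / nm (circle c r t - w))) <=
    (size s)%:R * (2 * circ_const * (expR (- M) / r)).
  rewrite (@Rintegral_bigsum _ _ _ mu _ mI); last by move=> w; exact: integrable_log_plus_circle.
  rewrite mulr_natl -(count_predT s) -iter_addr_0 -big_const_seq.
  by apply: ler_sum => w _; exact: Rintegral_log_plus_circle.
have EH : \int[mu]_(t in I01) H t <= 2 * ln n%:R + M +
    n%:R * (4 * circ_const * (expR (- M) / r)) + fine (mu (I01 `&` G)) * (B + n%:R * M).
  rewrite RintegralD // RintegralZr //.
  have -> : \int[mu]_(t in I01) \1_G t = fine (mu (I01 `&` G)).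
    by rewrite /Rintegral; congr fine; rewrite integral_indic // setIC.
  rewrite lerD2r RintegralD // RintegralD // Rintegral_cst01.
  have := lps xs; have := lps ws; rewrite sw -/n => h1 h2.
  have h3 : n.-1%:R * (2 * circ_const * (expR (- M) / r)) <=
      n%:R * (2 * circ_const * (expR (- M) / r)) :> R.
    apply: ler_wpM2r; last by rewrite ler_nat leq_pred.
    have cc : 0 <= circ_const :> R by rewrite /circ_const divr_ge0 // ltW // cos1_gt0.
    by apply: mulr_ge0; [exact: mulr_ge0|apply: divr_ge0 => //; exact: ltW].
  lra.
rewrite -EF; apply: le_trans EH.
apply: le_trans (le_normr_Rintegral _ iF) _ => //.
(* The pointwise bound holds off the null set of parameters at which the circle meets a zero or a
   critical point. *)
have [N [mN N0 NP]] := circle_avoid c (xs ++ ws) r0.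
have iaF := integrable_norm iF.
rewrite -lee_fin /Rintegral !fineK; try exact: integrable_fin_num.
apply: ae_ge0_le_integral => //.
- exact: measurable_int iaF.
- move=> t _; rewrite lee_fin /H indicE.
  have lp0 s : 0 <= \sum_(w <- s) log_plus (expR (- M) / nm (circle c r t - w)).
    by apply: sumr_ge0 => w _; exact: log_plus_ge0.
  have B0 : 0 <= B by apply: sumr_ge0 => w _; exact: log_plus_ge0.
  have ln0' : 0 <= ln (n%:R : R) by rewrite ln_ge0 // ler1n ltnW.
  by repeat apply: addr_ge0 => //; apply: mulr_ge0 => //; apply: addr_ge0 => //; apply: mulr_ge0.
- exact: measurable_int iH.
exists N; split => // t /= /not_implyP[ht ne]; apply: contrapT => Nt; apply: ne.
rewrite lee_fin; have zn := NP t ht Nt.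
have := @ln_logderiv_bound xs ws (circle c r t) M B n1 sw M0 dP zn.
rewrite /H indicE.
have -> : (t \in G) = (nm (logderiv xs (circle c r t)) < n%:R^-1).
  by apply/idP/idP => [/set_mem //|h]; exact/mem_set.
apply; apply: ler_sum => x _; apply: ler_log_plus; first exact: nm_ge0.
exact: nm_circle_le.
Qed.

End CriticalPotential.

(** * Anticoncentration of sums of i.i.d. random variables *)

Section Independence.
Context {R : realType} d (Omega : measurableType d) (P : probability Omega R)
  d' (T : measurableType d') (mu : probability T R)
  (X : nat -> {RV P >-> T}) (hX : iid mu X).

Definition partial_sum (h : T -> R) n (w : Omega) : R := \sum_(i < n) h (X i w).

Lemma measurable_partial_sum h n : measurable_fun setT h ->
  measurable_fun setT (partial_sum h n).
Proof.
move=> mh; elim: n => [|n IH].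
  by rewrite (_ : partial_sum h 0 = fun=> 0) //; apply/funext => w; rewrite /partial_sum big_ord0.
rewrite (_ : partial_sum h n.+1 = fun w => partial_sum h n w + h (X n w)).
  by apply: measurable_funD => //; apply: measurableT_comp => //; exact: measurable_funPT.
by apply/funext => w; rewrite /partial_sum big_ord_recr.
Qed.

Lemma iid_law i A : measurable A -> P (X i @^-1` A) = mu A.
Proof. by move=> mA; rewrite -(hX.2 i A mA). Qed.

Lemma measurable_rect (J : seq nat) (A : nat -> set T) : (forall i, measurable (A i)) ->
  measurable (\bigcap_(i in [set` J]) (X i @^-1` A i)).
Proof.
move=> mA; apply: fin_bigcap_measurable => // i _.
by rewrite -[X in measurable X]setTI; exact: measurable_funPT.
Qed.

Lemma rect_cons (n : nat) (J : seq nat) (A : nat -> set T) B : n \notin J ->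
  \bigcap_(i in [set` n :: J]) (X i @^-1` (if i == n then B else A i)) =
  (X n @^-1` B) `&` \bigcap_(i in [set` J]) (X i @^-1` A i).
Proof.
move=> nJ; apply/seteqP; split => w.
  move=> h; split; first by have := h n; rewrite /= inE eqxx; exact.
  move=> i /= iJ; have := h i; rewrite /= inE iJ orbT => /(_ isT).
  by case: eqP => // iE; rewrite -iE iJ in nJ.
move=> [h1 h2] i /=; rewrite inE; case: eqP => [->//|_ /= iJ]; exact: h2.
Qed.

Lemma rect_cons_prob n (J : seq nat) (A : nat -> set T) B : n \notin J -> uniq J ->
  (forall i, measurable (A i)) -> measurable B ->
  P ((X n @^-1` B) `&` \bigcap_(i in [set` J]) (X i @^-1` A i)) =
  (mu B * P (\bigcap_(i in [set` J]) (X i @^-1` A i)))%E.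
Proof.
move=> nJ uJ mA mB.
have mA' i : measurable (if i == n then B else A i) by case: eqP.
have := hX.1 (n :: J) (fun i => if i == n then B else A i).
rewrite rect_cons // => -> //; last by rewrite /= nJ.
rewrite (hX.1 J A) // big_cons eqxx iid_law //; congr (_ * _)%E.
rewrite big_seq [RHS]big_seq; apply: eq_bigr => i iJ.
by case: eqP => // iE; rewrite -iE iJ in nJ.
Qed.

(** Under [P] conditioned on [C], the law of the pair agrees with the product measure on rectangles,
    hence everywhere. If [P C = 0], both sides vanish. *)
Lemma joint_restr (f : {RV P >-> R}) n (C : set Omega) : measurable C ->
  (forall W A, measurable W -> measurable A ->
     P (f @^-1` W `&` X n @^-1` A `&` C) = (P (f @^-1` W) * mu A * P C)%E) ->
  forall E : set (R * T), measurable E ->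
  P (((fun w => (f w, X n w)) @^-1` E) `&` C) =
  ((distribution P f \x mu)%E E * P C)%E.
Proof.
move=> mC H E mE.
have mp : measurable_fun setT (fun w => (f w, X n w)).
  by apply: measurable_fun_pair; exact: measurable_funPT.
have mpE : measurable ((fun w => (f w, X n w)) @^-1` E).
  by rewrite -[X in measurable X]setTI; exact: mp.
have [C0|C0] := eqVneq (P C) 0%E.
  rewrite C0 mule0; apply/eqP; rewrite eq_le measure_ge0 andbT -C0.
  by apply: le_measure; rewrite ?inE //; exact: measurableI.
have Cfin : P C \is a fin_num by exact: fin_num_measure.
have C1 : 0 < fine (P C) by rewrite fine_gt0 // lt0e C0 measure_ge0 ltey_eq Cfin.
have i0 : 0 <= (fine (P C))^-1 by rewrite invr_ge0 ltW.
pose m0 : {measure set (R * T) -> \bar R} :=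
  mscale (NngNum i0) (pushforward (mrestr P mC) (fun w => (f w, X n w))).
pose m' := m0 mp.
have m'E F : m' F = ((fine (P C))^-1%:E * P (((fun w => (f w, X n w)) @^-1` F) `&` C))%E by [].
have E1 : ((fine (P C))^-1%:E * P C = 1)%E.
  by rewrite -[X in (_ * X)%E](fineK Cfin) -EFinM mulVf ?gt_eqF.
rewrite (@product_measure_unique _ _ _ _ R (distribution P f) mu m' _ E mE).
  by rewrite m'E muleAC E1 mul1e.
move=> W A mW mA; rewrite m'E.
have -> : (fun w => (f w, X n w)) @^-1` (W `*` A) = f @^-1` W `&` X n @^-1` A by [].
by rewrite H // muleCA E1 mule1.
Qed.

Definition partial_sum_rv h (mh : measurable_fun setT h) n : {RV P >-> R} :=
  HB.pack (partial_sum h n)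
    (isMeasurableFun.Build _ _ _ _ (partial_sum h n) (measurable_partial_sum n mh)).

(** The first [n] variables are independent of the later ones; the induction needs the statement
    for every event about the future. *)
Lemma partial_sum_indep h (mh : measurable_fun setT h) n (W : set R) (J : seq nat) (A : nat -> set T) :
  measurable W -> uniq J -> all (leq n) J -> (forall i, measurable (A i)) ->
  P ((partial_sum h n @^-1` W) `&` \bigcap_(i in [set` J]) (X i @^-1` A i)) =
  (P (partial_sum h n @^-1` W) * P (\bigcap_(i in [set` J]) (X i @^-1` A i)))%E.
Proof.
elim: n W J A => [|n IH] W J A mW uJ aJ mA.
  have [W0|W0] := pselect (W 0).
    rewrite (_ : partial_sum h 0 @^-1` W = setT) ?setTI ?probability_setT ?mul1e //.
    by apply/seteqP; split => w //= _; rewrite /partial_sum big_ord0.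
  rewrite (_ : partial_sum h 0 @^-1` W = set0) ?set0I ?measure0 ?mul0e //.
  by apply/seteqP; split => w //=; rewrite /partial_sum big_ord0.
pose E : set (R * T) := [set u | W (u.1 + h u.2)].
have mE : measurable E.
  have mf : measurable_fun setT (fun u : R * T => u.1 + h u.2).
    by apply: measurable_funD => //; exact: measurableT_comp.
  by rewrite -[E]setTI; exact: mf.
have EE : partial_sum h n.+1 @^-1` W = (fun w => (partial_sum h n w, X n w)) @^-1` E.
  by apply/seteqP; split => w; rewrite /E /= /partial_sum big_ord_recr.
have J' : n \notin J by apply/negP => /(allP aJ); rewrite ltnn.
have key K B : uniq K -> n \notin K -> all (leq n.+1) K -> (forall i, measurable (B i)) ->
    forall W0 A0, measurable W0 -> measurable A0 ->
    P (partial_sum h n @^-1` W0 `&` X n @^-1` A0 `&` \bigcap_(i in [set` K]) (X i @^-1` B i)) =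
    (P (partial_sum h n @^-1` W0) * mu A0 * P (\bigcap_(i in [set` K]) (X i @^-1` B i)))%E.
  move=> uK nK aK mB W0 A0 mW0 mA0; rewrite -setIA -rect_cons //.
  rewrite IH //; first by rewrite rect_cons // rect_cons_prob // muleA.
  - by rewrite /= nK.
  - by rewrite /= leqnn; apply: sub_all aK => i /ltnW.
  - by move=> i; case: eqP.
have jr K B uK nK aK mB := @joint_restr (partial_sum_rv mh n) n _ (measurable_rect K mB) (key K B uK nK aK mB) E mE.
rewrite EE (jr J A uJ J' aJ mA); congr (_ * _)%E.
(* Without a future event, the same identity shows that the product measure of [E] is the
   probability of the event about the longer partial sum. *)
have := jr [::] (fun=> setT) isT isT isT (fun=> measurableT).
rewrite (_ : \bigcap_(i in _) _ = setT); last by apply/seteqP; split.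
by rewrite setIT probability_setT mule1.
Qed.

Lemma joint_law h (mh : measurable_fun setT h) n (E : set (R * T)) : measurable E ->
  P ((fun w => (partial_sum h n w, X n w)) @^-1` E) =
  (distribution P (partial_sum_rv mh n) \x mu)%E E.
Proof.
move=> mE.
have := @joint_restr (partial_sum_rv mh n) n setT measurableT _ E mE.
rewrite setIT probability_setT mule1; apply => W A mW mA.
rewrite setIT mule1.
have := @partial_sum_indep h mh n W [:: n] (fun=> A) mW isT _ (fun=> mA).
rewrite /= leqnn => /(_ isT); rewrite set_cons1 bigcap_set1 iid_law //.
Qed.

Lemma partial_sumS_law h (mh : measurable_fun setT h) n (W : set R) : measurable W ->
  measurable_fun setT (fun x => P (partial_sum h n @^-1` [set s | W (s + h x)%R])) /\
  P (partial_sum h n.+1 @^-1` W) =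
  (\int[mu]_x P (partial_sum h n @^-1` [set s | W (s + h x)%R]))%E.
Proof.
move=> mW.
pose E : set (R * T) := [set u | W (u.1 + h u.2)].
have mE : measurable E.
  have mf : measurable_fun setT (fun u : R * T => u.1 + h u.2).
    by apply: measurable_funD => //; exact: measurableT_comp.
  by rewrite -[E]setTI; exact: mf.
have yE x : ysection E x = [set s | W (s + h x)%R].
  by apply/seteqP; split => s /=; rewrite /ysection /E /= inE.
split.
  have := measurable_fun_ysection (distribution P (partial_sum_rv mh n)) mE.
  by congr measurable_fun; apply/funext => x; rewrite /= yE.
have -> : partial_sum h n.+1 @^-1` W = (fun w => (partial_sum h n w, X n w)) @^-1` E.
  by apply/seteqP; split => w; rewrite /E /= /partial_sum big_ord_recr.
rewrite (joint_law mh) //.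
(* [\x^] integrates over the last variable outermost; both iterated integrals define the product
   measure. *)
have -> : ((distribution P (partial_sum_rv mh n) \x mu) E =
    (distribution P (partial_sum_rv mh n) \x^ mu) E)%E.
  by apply: product_measure_unique => // A B mA mB; exact: product_measure2E.
by rewrite /product_measure2; apply: eq_integral => x _; rewrite /= yE.
Qed.

Section Concentration.
Context (h : T -> R) (mh : measurable_fun setT h) (delta : R).
Hypothesis delta0 : 0 < delta.

(** The windows are half-open, so that starting points at distance at least [delta] give disjoint
    ones. *)
Definition conc n (u : R) : R := fine (P (partial_sum h n @^-1` `[u, u + delta[%classic)).

Lemma measurable_preim n (W : set R) : measurable W -> measurable (partial_sum h n @^-1` W).
Proof.
by move=> mW; rewrite -[X in measurable X]setTI; exact: measurable_partial_sum.
Qed.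

Lemma concE n u : (conc n u)%:E = P (partial_sum h n @^-1` `[u, u + delta[%classic).
Proof. by rewrite fineK // fin_num_measure //; exact: measurable_preim. Qed.

Lemma conc_ge0 n u : 0 <= conc n u.
Proof. by rewrite fine_ge0. Qed.

Lemma concS n u :
  measurable_fun setT (fun x => (conc n (u - h x))%:E) /\
  (conc n.+1 u)%:E = (\int[mu]_x (conc n (u - h x))%:E)%E.
Proof.
have E x : (conc n (u - h x))%:E =
    P (partial_sum h n @^-1` [set s | `[u, u + delta[%classic (s + h x)]).
  rewrite concE; congr (P (_ @^-1` _)); apply/seteqP; split => s /=; rewrite !in_itv /=;
  by rewrite lerBlDr addrAC ltrBrDr.
have [m1 m2] := @partial_sumS_law h mh n _ (measurable_itv `[u, u + delta[).
split; first by under eq_fun do rewrite E.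
by rewrite concE m2; apply: eq_integral => x _; rewrite E.
Qed.

(** The induction on [n] involves several disjoint windows at once; their number is the starting
    point of the walk with which this total mass is compared. *)
Definition conc_sum n (t : seq R) : R := \sum_(u <- t) conc n u.

Lemma conc_sumS n t :
  measurable_fun setT (fun x => conc_sum n [seq u - h x | u <- t]) /\
  (conc_sum n.+1 t)%:E = (\int[mu]_x (conc_sum n [seq u - h x | u <- t])%:E)%E.
Proof.
have m u : measurable_fun setT (fun x => (conc n (u - h x))%:E) by have [] := concS n u.
split.
  under eq_fun do rewrite /conc_sum big_map.
  by apply: measurable_sum => u; apply/measurable_EFinP; exact: m.
rewrite /conc_sum -sumEFin (eq_bigr (fun u => \int[mu]_x (conc n (u - h x))%:E)%E); last first.
  by move=> u _; have [] := concS n u.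
rewrite -ge0_integral_sum //.
  by apply: eq_integral => x _; rewrite big_map sumEFin.
by move=> u x _; rewrite lee_fin conc_ge0.
Qed.

(** The empty sum is 0 and lies in at most one of the disjoint windows. They are listed from right
    to left: once a window starts at or before 0, all later ones end there or earlier. *)
Lemma conc_sum0 z t : path (fun a b => b + delta <= a) z t -> conc_sum 0 (z :: t) <= 1.
Proof.
have tr : transitive (fun a b : R => b + delta <= a).
  move=> b a c /= h1 h2; apply: (le_trans h2); apply: le_trans h1.
  by rewrite lerDl ltW.
elim: t z => [|y t IH] z.
  move=> _; rewrite /conc_sum big_seq1 -lee_fin concE; apply: probability_le1.
  exact: measurable_preim.
move=> pz; have [z0|z0] := leP z 0; last first.
  have zz : conc 0 z = 0.
    rewrite /conc (_ : _ @^-1` _ = set0) ?measure0 //; apply/seteqP; split => w //=.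
    by rewrite /partial_sum big_ord0 in_itv /= leNgt z0.
  rewrite /conc_sum big_cons zz add0r; apply: IH.
  by move: pz => /= /andP[_].
have h0 : {in y :: t, forall u, conc 0 u = 0}.
  move=> u ut; have := order_path_min tr pz => /allP /(_ u ut) uz.
  rewrite /conc (_ : _ @^-1` _ = set0) ?measure0 //; apply/seteqP; split => w //=.
  by rewrite /partial_sum big_ord0 in_itv /= => /andP[_]; lra.
rewrite /conc_sum big_cons (eq_big_seq _ h0) big1_eq addr0 -lee_fin concE.
apply: probability_le1; exact: measurable_preim.
Qed.

End Concentration.

End Independence.

(** * Comparison of disjoint windows with a killed random walk *)

Section AveragePair.
Context {R : realType} d (T : measurableType d) (mu : probability T R).

Lemma Rintegral_cstT (c : R) : \int[mu]_x c = c.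
Proof.
transitivity (c * fine (mu setT)); first exact: Rintegral_cst.
by rewrite probability_setT mulr1.
Qed.

(** As values on [A] and on [B] always add up to at most [m], there are [al] and [be] with
    [al + be <= m] bounding [g] on [A] and on [B]; elsewhere [g <= F]. Lowering the masses of [A]
    and [B] to [s] only increases the resulting bound. *)
Lemma integral_pair_bound (g : T -> R) (A B : set T) (s F m : R) :
  measurable_fun setT g -> (forall x, 0 <= g x <= F) -> measurable A -> measurable B ->
  A `&` B = set0 -> 0 < s -> (s%:E <= mu A)%E -> (s%:E <= mu B)%E ->
  (forall x y, A x -> B y -> g x + g y <= m) ->
  (\int[mu]_x (g x)%:E <= ((1 - 2 * s) * F + s * m)%:E)%E.
Proof.
move=> mg gF mA mB AB s0 sA sB gm.
have [x0 Ax0] : A !=set0.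
  by apply/set0P/eqP => A0; move: sA; rewrite A0 measure0 lee_fin leNgt s0.
pose al := sup (g @` A).
have hs : has_sup (g @` A).
  split; first by exists (g x0), x0.
  by exists F => _ [x _ <-]; have /andP[] := gF x.
have gal x : A x -> g x <= al by move=> Ax; apply: sup_upper_bound => //; exists x.
have alF : al <= F by apply: ge_sup; [exists (g x0), x0|move=> _ [x _ <-]; have /andP[] := gF x].
(* The minimum with [F] keeps [F - be] nonnegative, so that the mass of [B] may be lowered to
   [s]. *)
pose be := Num.min F (m - al).
have gbe y : B y -> g y <= be.
  move=> By; rewrite le_min; have /andP[_ ->] /= := gF y.
  rewrite lerBrDr -lerBrDl; apply: ge_sup; first by exists (g x0), x0.
  by move=> _ [x Ax <-]; rewrite lerBrDr; exact: gm.
have beF : be <= F by rewrite ge_min lexx.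
have bem : al + be <= m by rewrite -lerBrDl ge_min lexx orbT.
pose k x := F - ((F - al) * \1_A x + (F - be) * \1_B x).
have iA (C : set T) c : measurable C -> mu.-integrable setT (EFin \o (fun x => c * \1_C x)).
  move=> mC; apply: eq_integrable (integrableZl _ c (integrable_indic mu mC)) => //.
have ic (c : R) : mu.-integrable setT (EFin \o (fun=> c)).
  exact: finite_measure_integrable_cst.
have iS : mu.-integrable setT (EFin \o (fun x => (F - al) * \1_A x + (F - be) * \1_B x)).
  by apply: eq_integrable (integrableD _ (iA A (F - al) mA) (iA B (F - be) mB)).
have ik : mu.-integrable setT (EFin \o k).
  by apply: eq_integrable (integrableB _ (ic F) iS).
have ig : mu.-integrable setT (EFin \o g).
  apply: (le_integrable _ _ _ (ic F)) => //; first exact/measurable_EFinP.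
  move=> x _ /=; have /andP[g0 g1] := gF x.
  by rewrite lee_fin !ger0_norm // (le_trans g0).
have gk x : g x <= k x.
  rewrite /k !indicE; have /andP[_ gFx] := gF x.
  case: (boolP (x \in A)) => [/set_mem Ax|_]; case: (boolP (x \in B)) => [/set_mem Bx|_].
  - by have : set0 x by rewrite -AB.
  - by rewrite mulr1 mulr0 addr0 subKr; exact: gal.
  - by rewrite mulr1 mulr0 add0r subKr; exact: gbe.
  - by rewrite !mulr0 addr0 subr0.
have fA : mu A \is a fin_num by exact: fin_num_measure.
have fB : mu B \is a fin_num by exact: fin_num_measure.
have Ek : \int[mu]_x k x = F - ((F - al) * fine (mu A) + (F - be) * fine (mu B)).
  rewrite RintegralB // RintegralD //; try exact: iA.
  rewrite Rintegral_cstT !RintegralZl //; try exact: integrable_indic.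
  by rewrite /Rintegral !integral_indic // !setIT.
apply: (@le_trans _ _ (\int[mu]_x (k x)%:E)%E).
  by apply: le_integral => // x _; rewrite lee_fin.
rewrite -[leLHS]fineK; last exact: integrable_fin_num ik.
rewrite lee_fin -/(Rintegral _ _ _) Ek.
have : s <= fine (mu A) by rewrite -lee_fin fineK.
have : s <= fine (mu B) by rewrite -lee_fin fineK.
nra.
Qed.

End AveragePair.

Section GamblerWalk.
Context {R : realType} (s : R).
Hypotheses (s0 : 0 < s) (s2 : 2 * s <= 1).

(** Survival probability at time [n] of the lazy walk on [nat] started at [r] and killed at [0]. *)
Fixpoint walk (n r : nat) : R :=
  match n with
  | 0 => (0 < r)%N%:R
  | n'.+1 => if r is r'.+1 then (1 - 2 * s) * walk n' r + s * (walk n' r.+1 + walk n' r') else 0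
  end.

Lemma walkn0 n : walk n 0 = 0. Proof. by case: n. Qed.

Lemma walk_itv n r : 0 <= walk n r <= 1.
Proof.
have := s0; have := s2; elim: n r => [|n IH] [|r] //= h2 h0; rewrite ?lexx ?ler01 //.
have {}IH r' := IH r' h2 h0.
have /andP[? ?] := IH r.+1; have /andP[? ?] := IH r.+2; have /andP[? ?] := IH r.
apply/andP; split.
  by apply: addr_ge0; apply: mulr_ge0 => //; [lra|exact: ltW|exact: addr_ge0].
apply: (@le_trans _ _ ((1 - 2 * s) * 1 + s * (1 + 1))); last by lra.
by apply: lerD; apply: ler_wpM2l; lra.
Qed.

Lemma walkS_le n r : walk n.+1 r <= walk n r.
Proof.
have h0 := s0; have h2 := s2.
elim: n r => [|n IH] [|r] //.
  have -> : walk 1 r.+1 = (1 - 2 * s) * 1 + s * (1 + (0 < r)%N%:R) by [].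
  have -> : walk 0 r.+1 = 1 by [].
  by case: (0 < r)%N => /=; lra.
have IH1 := IH r.+1; have IH2 := IH r.+2; have IH3 := IH r.
rewrite [walk n.+2 _]/= -/(walk n.+1 r) -/(walk n.+1 r.+1) -/(walk n.+1 r.+2).
rewrite [leRHS]/= lerD //; first by apply: ler_wpM2l => //; lra.
by apply: ler_wpM2l; [exact: ltW|exact: lerD].
Qed.

Lemma is_cvg_walk r : cvgn (walk ^~ r).
Proof.
apply: nonincreasing_is_cvgn.
  by apply/nonincreasing_seqP => n; exact: walkS_le.
by exists 0 => _ [n _ <-]; have /andP[] := walk_itv n r.
Qed.

(** The limit is a bounded harmonic function on [nat] vanishing at [0], hence zero. *)
Lemma cvg_walk1 : walk n 1 @[n --> \oo] --> 0.
Proof.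
pose l r := limn (walk ^~ r).
have lP r : walk n r @[n --> \oo] --> l r by exact: is_cvg_walk.
have l01 r : 0 <= l r <= 1.
  apply/andP; split.
    by apply: limr_ge; [exact: is_cvg_walk|near=> n; have /andP[] := walk_itv n r].
  by apply: limr_le; [exact: is_cvg_walk|near=> n; have /andP[] := walk_itv n r].
have l0 : l 0%N = 0.
  by apply/cvg_lim => //; rewrite (_ : walk ^~ 0%N = fun=> 0); [exact: cvg_cst|apply/funext => n; exact: walkn0].
have harm r : l r.+2 - l r.+1 = l r.+1 - l r.
  have : walk n.+1 r.+1 @[n --> \oo] --> (1 - 2 * s) * l r.+1 + s * (l r.+2 + l r).
    rewrite /=; apply: cvgD; apply: cvgMr => //.
    by apply: cvgD.
  have := lP r.+1; rewrite -(cvg_shiftS (walk ^~ r.+1)) => h1 h2.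
  have E := cvg_lim (@Rhausdorff R) h1; rewrite (cvg_lim (@Rhausdorff R) h2) in E.
  have {}E : (1 - 2 * s) * l r.+1 + s * (l r.+2 + l r) = l r.+1 by apply: E.
  have : s * (l r.+2 - l r.+1) = s * (l r.+1 - l r) by lra.
  by move/mulfI; apply; rewrite gt_eqF.
have lin r : l r.+1 - l r = l 1%N.
  by elim: r => [|r IH]; [rewrite l0 subr0|rewrite harm].
have lr r : l r = r%:R * l 1%N.
  elim: r => [|r IH]; first by rewrite l0 mul0r.
  by rewrite -natr1 mulrDl mul1r -IH -(lin r) subrKC.
suff E : l 1%N = 0 by rewrite -E; exact: lP.
apply/eqP; rewrite eq_le; have /andP[-> _] := l01 1%N; rewrite andbT leNgt; apply/negP => l1.
(* A linear function of positive slope [l 1] exceeds the bound 1 at this index. *)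
pose r := (Num.truncn (l 1%N)^-1).+1.
have : (l 1%N)^-1 < r%:R by exact: truncnS_gt.
rewrite -(ltr_pM2r l1) mulVf ?gt_eqF // -lr => h.
by have /andP[_ h'] := l01 r; have := lt_le_trans h h'; rewrite ltxx.
Unshelve. all: by end_near. Qed.

End GamblerWalk.

Section Anticoncentration.
Context {R : realType} d (Omega : measurableType d) (P : probability Omega R)
  d' (T : measurableType d') (mu : probability T R)
  (X : nat -> {RV P >-> T}) (hX : iid mu X).
Context (h : T -> R) (mh : measurable_fun setT h) (a delta s : R).
Hypotheses (delta0 : 0 < delta) (s0 : 0 < s).
Hypothesis sA : (s%:E <= mu [set x | (h x <= a)%R])%E.
Hypothesis sB : (s%:E <= mu [set x | (a + delta <= h x)%R])%E.

Let mA : measurable [set x | h x <= a].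
Proof.
have := mh measurableT (measurable_itv `]-oo, a]).
by rewrite setTI; congr measurable; apply/funext => x; rewrite /= in_itv.
Qed.

Let mB : measurable [set x | a + delta <= h x].
Proof.
have := mh measurableT (measurable_itv `[a + delta, +oo[).
by rewrite setTI; congr measurable; apply/funext => x; rewrite /= in_itv /= andbT.
Qed.

Let AB0 : [set x | h x <= a] `&` [set x | a + delta <= h x] = set0.
Proof. by apply/seteqP; split => x //= [h1 h2]; have := delta0; lra. Qed.

Let s2 : 2 * s <= 1.
Proof.
rewrite -lee_fin; apply: (@le_trans _ _ (mu ([set x | (h x <= a)%R] `|` [set x | (a + delta <= h x)%R]))).
  rewrite measureU // mulr_natl mulr2n EFinD; exact: leeD.
by apply: probability_le1; exact: measurableU.
Qed.

Notation csum := (@conc_sum R d Omega P d' T X h delta).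

(** Conditioning on the last variable shifts all windows by [h x]. For [x] and [y] on the two sides
    of the spread, two shifted families of [r] windows can be regrouped into disjoint families of
    [r + 1] and [r - 1] windows, and [integral_pair_bound] then reproduces the recursion of
    [walk]. *)
Lemma conc_sum_le n t : sorted (fun b c => c + delta <= b) t -> csum n t <= walk s n (size t).
Proof.
elim: n t => [|n IH] [|z t] st.
- by rewrite /conc_sum big_nil.
- exact: conc_sum0 st.
- by rewrite /conc_sum big_nil.
have [ms es] := conc_sumS hX mh delta n (z :: t).
rewrite -lee_fin es.
have sep x u : sorted (fun b c => c + delta <= b) u ->
    sorted (fun b c => c + delta <= b) [seq v - h x | v <- u].
  by rewrite sorted_map; apply: sub_sorted => b c /=; rewrite addrAC lerD2r.
have step := @integral_pair_bound R _ T mu (fun x => csum n [seq v - h x | v <- z :: t]) _ _ s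
  (walk s n (size t).+1) (walk s n (size t).+2 + walk s n (size t)) _ _ mA mB AB0 s0 sA sB.
apply: step.
- exact: ms.
- move=> x; apply/andP; split; first by apply: sumr_ge0 => v _; exact: conc_ge0.
  by have := IH [seq v - h x | v <- z :: t]; rewrite size_map; apply; exact: sep.
move=> x y /= hx hy; have d0 := delta0.
(* The exchange: since [h y - h x >= delta], the first window of the [x] family lies to the right of
   the whole [y] family and can be moved in front of it. *)
have -> : csum n (z - h x :: [seq v - h x | v <- t]) + csum n (z - h y :: [seq v - h y | v <- t]) =
    csum n (z - h x :: z - h y :: [seq v - h y | v <- t]) + csum n [seq v - h x | v <- t].
  by rewrite /conc_sum !big_cons; lra.
apply: lerD.
  have := IH (z - h x :: z - h y :: [seq v - h y | v <- t]); rewrite /= size_map; apply.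
  apply/andP; split; first by lra.
  exact: (sep y (z :: t)).
have := IH [seq v - h x | v <- t]; rewrite size_map; apply; apply: sep.
exact: path_sorted st.
Qed.

(** As soon as [1 / n <= delta / 2], the event lies in one window of length [delta] centered at 0,
    whose mass is at most the survival probability of the walk started at 1. *)
Lemma anticoncentration :
  fine (P [set w | `|partial_sum X h n w| < n%:R^-1]) @[n --> \oo] --> 0.
Proof.
have mS n : measurable [set w | `|partial_sum X h n w| < n%:R^-1].
  have := measurable_preim X mh n (measurable_itv `]- n%:R^-1, n%:R^-1[).
  by congr measurable; apply/funext => w /=; rewrite in_itv /= ltr_norml.
apply: (@squeeze_cvgr _ _ _ _ (fun=> 0) (walk s ^~ 1%N)); last 2 first.
- exact: cvg_cst.
- exact: cvg_walk1.
near=> n; rewrite fine_ge0 //=; have d0 := delta0.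
have nd : n%:R^-1 <= delta / 2.
  rewrite invf_ple ?posrE ?divr_gt0 ?ltr0n //; last by near: n; exact: nbhs_infty_gt.
  by near: n; exact: nbhs_infty_ger.
have := @conc_sum_le n [:: - (delta / 2)] isT; apply: le_trans.
rewrite /conc_sum big_seq1 -lee_fin (concE X mh) fineK ?fin_num_measure //.
apply: le_measure; rewrite ?inE //; first exact: measurable_preim.
move=> w /=; rewrite ltr_norml in_itv /= => /andP[h1 h2]; apply/andP; split; lra.
Unshelve. all: by end_near. Qed.

End Anticoncentration.

(** * Laws of large numbers for bounded variables *)

Section SecondMoment.
Context {R : realType} d (Omega : measurableType d) (P : probability Omega R)
  d' (T : measurableType d') (mu : probability T R)
  (X : nat -> {RV P >-> T}) (hX : iid mu X).
Context (h : T -> R) (mh : measurable_fun setT h) (D : R).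
Hypothesis hD : forall x, `|h x| <= D.
Hypothesis h0 : \int[mu]_x h x = 0.

Local Notation S := (partial_sum X h).

Lemma bounded_integrable (g : T -> R) (C : R) :
  measurable_fun setT g -> (forall x, `|g x| <= C) -> mu.-integrable setT (EFin \o g).
Proof.
move=> mg gC.
apply: (le_integrable _ _ _ (finite_measure_integrable_cst mu C measurableT)) => //.
  exact/measurable_EFinP.
by move=> x _ /=; rewrite lee_fin (le_trans (gC x)) // ler_norm.
Qed.

Lemma integral_sqr_shift (s : R) :
  (\int[mu]_x ((s + h x) ^+ 2)%:E <= (s ^+ 2 + D ^+ 2)%:E)%E.
Proof.
have ih : mu.-integrable setT (EFin \o h) by exact: bounded_integrable hD.
have ic (c : R) : mu.-integrable setT (EFin \o (fun=> c)).
  exact: finite_measure_integrable_cst.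
have D0 (x : T) : 0 <= D by exact: le_trans (normr_ge0 _) (hD x).
have ih2 : mu.-integrable setT (EFin \o (fun x => h x ^+ 2)).
  apply: (@bounded_integrable _ (D ^+ 2)); first exact: measurable_funX.
  by move=> x; rewrite normrX lerXn2r ?nnegrE ?(D0 x).
have i1 : mu.-integrable setT (EFin \o (fun x => 2 * s * h x)).
  by apply: eq_integrable (integrableZl _ (2 * s) ih).
have i2 : mu.-integrable setT (EFin \o (fun x => s ^+ 2 + 2 * s * h x)).
  by apply: eq_integrable (integrableD _ (ic _) i1).
have E : \int[mu]_x ((s + h x) ^+ 2) = s ^+ 2 + \int[mu]_x (h x ^+ 2).
  transitivity (\int[mu]_x (s ^+ 2 + 2 * s * h x + h x ^+ 2)).
    by apply: eq_Rintegral => x _; ring.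
  by rewrite RintegralD // RintegralD // Rintegral_cstT RintegralZl // h0 mulr0 addr0.
have i3 : mu.-integrable setT (EFin \o (fun x => (s + h x) ^+ 2)).
  apply: eq_integrable (integrableD _ i2 ih2) => // x _ /=.
  by rewrite -!EFinD; congr EFin; ring.
rewrite -[leLHS]fineK ?lee_fin; last exact: integrable_fin_num i3.
rewrite -/(Rintegral _ _ _) E lerD2l -[leRHS](Rintegral_cstT mu).
apply: le_Rintegral => // x _.
by rewrite -real_normK ?num_real // lerXn2r ?nnegrE ?(D0 x).
Qed.

(** Fubini on the joint law of the partial sum and the next variable: as [h] is centered, the cross
    term vanishes and each variable adds at most [D ^+ 2]. *)
Lemma second_moment n : (\int[P]_w (S n w ^+ 2)%:E <= (n%:R * D ^+ 2)%:E)%E.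
Proof.
elim: n => [|n IH].
  rewrite mul0r le_eqVlt; apply/orP; left; apply/eqP.
  under eq_integral do rewrite /partial_sum big_ord0 expr0n /=.
  exact: integral0.
pose F (u : R * T) := ((u.1 + h u.2) ^+ 2)%:E.
have mF : measurable_fun setT F.
  apply/measurable_EFinP; apply: measurable_funX.
  by apply: measurable_funD => //; exact: measurableT_comp.
have F0 u : (0 <= F u)%E by rewrite lee_fin sqr_ge0.
have mp : measurable_fun setT (fun w => (S n w, X n w)).
  by apply: measurable_fun_pair; [exact: measurable_partial_sum|exact: measurable_funPT].
have -> : (\int[P]_w (S n.+1 w ^+ 2)%:E = \int[P]_w F (S n w, X n w))%E.
  by apply: eq_integral => w _; rewrite /F /= /partial_sum big_ord_recr.
have := @ge0_integral_pushforward _ _ _ _ R _ mp P setT F measurableT mF (fun u _ => F0 u).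
rewrite preimage_setT /= => <-.
pose law := distribution P (partial_sum_rv X mh n).
have -> : (\int[pushforward P (fun w => (S n w, X n w))]_u F u = \int[law \x mu]_u F u)%E.
  apply: eq_measure_integral => E mE _; exact: joint_law.
rewrite fubini_tonelli1 //.
apply: (@le_trans _ _ (\int[law]_s (s ^+ 2 + D ^+ 2)%:E)%E).
  apply: ge0_le_integral => //.
  - by move=> s _; apply: integral_ge0 => x _; exact: F0.
  - exact: measurable_fun_fubini_tonelli_F.
  - by apply/measurable_EFinP; apply: measurable_funD => //; exact: measurable_funX.
  by move=> s _; exact: integral_sqr_shift.
under eq_integral do rewrite EFinD.
have m2 : measurable_fun setT (fun s : R => (s ^+ 2)%:E).
  by apply/measurable_EFinP; exact: measurable_funX.
have -> : (\int[law]_s ((s ^+ 2)%:E + (D ^+ 2)%:E) =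
    \int[law]_s (s ^+ 2)%:E + \int[law]_s (D ^+ 2)%:E)%E.
  by apply: ge0_integralD => // s _; rewrite lee_fin sqr_ge0.
have -> : (\int[law]__ (D ^+ 2)%:E = (D ^+ 2)%:E)%E.
  rewrite integral_cst // [X in (_ * X)%E](_ : _ = 1%E) ?mule1 //.
  exact: probability_setT.
rewrite -natr1 mulrDl mul1r EFinD leeD2r //.
rewrite ge0_integral_distribution //.
by move=> s; rewrite lee_fin sqr_ge0.
Qed.

Lemma measurable_S n : measurable_fun setT (S n).
Proof. exact: measurable_partial_sum. Qed.

Lemma partial_sum_lln_prob (e : R) : 0 < e ->
  fine (P [set w | e * n%:R <= `|S n w|]) @[n --> \oo] --> 0.
Proof.
move=> e0.
have bnd n : (0 < n)%N -> fine (P [set w | e * n%:R <= `|S n w|]) <= D ^+ 2 / e ^+ 2 / n%:R.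
  move=> n0; have nR : 0 < n%:R :> R by rewrite ltr0n.
  have mS2 : measurable_fun setT (fun w => (S n w ^+ 2)%:E).
    by apply/measurable_EFinP; apply: measurable_funX; exact: measurable_S.
  have a0 : 0 < (e * n%:R) ^+ 2 by rewrite exprn_gt0 // mulr_gt0.
  have := @le_integral_abse _ _ R P setT measurableT _ _ mS2 a0.
  under eq_integral do rewrite gee0_abs ?lee_fin ?sqr_ge0 //.
  move=> /le_trans /(_ (second_moment n)).
  have -> : setT `&` [set x | (((e * n%:R) ^+ 2)%:E <= `|(S n x ^+ 2)%:E|)%E] =
      [set w | e * n%:R <= `|S n w|].
    apply/seteqP; split => w /=; rewrite lee_fin normrX ler_pXn2r ?nnegrE ?mulr_ge0 ?(ltW e0) //.
    by case.
  have mA : measurable [set w | e * n%:R <= `|S n w|].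
    have mn : measurable_fun setT (fun w => `|S n w|).
      by apply: measurableT_comp => //; exact: measurable_S.
    have := mn measurableT _ (measurable_itv `[e * n%:R, +oo[).
    by rewrite setTI; congr measurable; apply/funext => w; rewrite /= in_itv /= andbT.
  have Pf : P [set w | e * n%:R <= `|S n w|] \is a fin_num by exact: fin_num_measure.
  move=> H0; have : ((((e * n%:R) ^+ 2) * fine (P [set w | e * n%:R <= `|S n w|]))%:E <=
     (n%:R * D ^+ 2)%:E)%E by rewrite EFinM fineK //; exact: H0.
  rewrite lee_fin exprMn => H.
  rewrite -ler_pdivlMl ?mulr_gt0 ?exprn_gt0 // in H; apply: le_trans H _.
  by rewrite le_eqVlt; apply/orP; left; apply/eqP; field; rewrite !gt_eqF.
apply: (@squeeze_cvgr _ _ _ _ (fun=> 0) (fun n => D ^+ 2 / e ^+ 2 / n%:R)); last 2 first.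
- exact: cvg_cst.
- rewrite -[X in _ --> X](mulr0 (D ^+ 2 / e ^+ 2)); apply: cvgMr.
  by apply/gtr0_cvgV0; [near=> n; rewrite ltr0n; near: n; exact: nbhs_infty_gt|exact: cvgr_idn].
near=> n; rewrite fine_ge0 //= bnd //; near: n; exact: nbhs_infty_gt.
Unshelve. all: by end_near. Qed.

Lemma nat_sqrt_exists n : exists k, (k * k <= n < k.+1 * k.+1)%N.
Proof.
elim: n => [|n [k /andP[k1 k2]]]; first by exists 0.
have [lt|le] := ltnP n.+1 (k.+1 * k.+1)%N; first by exists k; rewrite lt (leq_trans k1).
by exists k.+1; nia.
Qed.

(** The induction carries the sharper bound [2 - 1 / n], which telescopes. *)
Lemma sum_inv_sqr_le n : \sum_(k < n) (k.+1%:R ^+ 2)^-1 <= 2 :> R.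
Proof.
case: n => [|n]; first by rewrite big_ord0.
apply: (@le_trans _ _ (2 - n.+1%:R^-1)); last by rewrite gerBl invr_ge0.
elim: n => [|n IH]; first by rewrite big_ord1 expr1n invr1; lra.
rewrite big_ord_recr /=; apply: (le_trans (lerD IH (lexx _))).
rewrite -(natr1 n.+1); have : 1 <= n.+1%:R :> R by rewrite ler1n.
set x := n.+1%:R => x1.
have -> : 2 - x^-1 + ((x + 1) ^+ 2)^-1 = 2 - (x + 1)^-1 - ((x + 1) ^+ 2 * x)^-1.
  by field; apply/andP; split; lra.
by rewrite gerBl invr_ge0 mulr_ge0 // ?sqr_ge0 //; lra.
Qed.

(** The strong law along squares follows from summability of the second moments, and the gaps are
    filled using that the summands are bounded. *)
Lemma partial_sum_lln_as : {ae P, forall w, S n w / n%:R @[n --> \oo] --> 0}.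
Proof.
have D0 : 0 <= D.
  have [x _] : exists x : T, True by exists point.
  exact: le_trans (normr_ge0 _) (hD x).
pose Y k w : R := (S (k.+1 * k.+1) w / (k.+1 * k.+1)%:R) ^+ 2.
have mY k : measurable_fun setT (fun w => (Y k w)%:E).
  apply/measurable_EFinP; apply: measurable_funX; apply: measurable_funM => //.
  exact: measurable_S.
have Y0 k w : (0 <= (Y k w)%:E)%E by rewrite lee_fin sqr_ge0.
have IY : (\int[P]_w \sum_(k <oo) (Y k w)%:E < +oo)%E.
  rewrite integral_nneseries //.
  apply: (@le_lt_trans _ _ (2 * D ^+ 2)%:E); last exact: ltry.
  apply: lime_le.
    apply: is_cvg_nneseries => k _ _; apply: integral_ge0 => w _; exact: Y0.
  near=> n; rewrite big_mkord.
  apply: (@le_trans _ _ (\sum_(k < n) (D ^+ 2 * (k.+1%:R ^+ 2)^-1)%:E)%E).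
    apply: lee_sum => k _.
    have n0 : 0 < (k.+1 * k.+1)%:R :> R by rewrite ltr0n.
    have -> : (\int[P]_w (Y k w)%:E = ((k.+1 * k.+1)%:R ^- 2)%:E *
        \int[P]_w (S (k.+1 * k.+1) w ^+ 2)%:E)%E.
      rewrite -ge0_integralZl_EFin //.
      - by apply: eq_integral => w _; rewrite -EFinM /Y expr_div_n mulrC.
      - by move=> w _; rewrite lee_fin sqr_ge0.
      - by apply/measurable_EFinP; apply: measurable_funX; exact: measurable_S.
    apply: (le_trans (lee_wpmul2l _ (second_moment _))).
      by rewrite lee_fin invr_ge0 exprn_ge0.
    rewrite -EFinM lee_fin le_eqVlt natrM; apply/orP; left; apply/eqP; field.
    by rewrite addrC natr1 pnatr_eq0.
  rewrite sumEFin lee_fin -mulr_sumr mulrC ler_wpM2r ?sqr_ge0 //.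
  exact: sum_inv_sqr_le.
have mSY : measurable_fun setT (fun w => \sum_(k <oo) (Y k w)%:E)%E.
  exact: ge0_emeasurable_sum.
have iSY : P.-integrable setT (fun w => \sum_(k <oo) (Y k w)%:E)%E.
  apply/integrableP; split => //.
  under eq_integral do rewrite gee0_abs ?nneseries_ge0 //.
  by [].
have := integrable_ae measurableT iSY; apply: filterS => w /(_ Logic.I) Yfin.
have Ysum : (\sum_(k <oo) (Y k w)%:E < +oo)%E by rewrite ltey_eq Yfin.
have Ycvg : Y k w @[k --> \oo] --> 0.
  have tl := nneseries_tail_cvg Ysum (fun k _ => Y0 k w).
  have /fine_cvgP[_] : (Y k w)%:E @[k --> \oo] --> 0%:E.
    apply: (squeeze_cvge _ (cvg_cst _) tl); near=> k.
    rewrite Y0 /=.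
    have := @nneseries_lim_ge R (fun k => (Y k w)%:E) xpredT k k.+1 (fun n _ _ => Y0 n w).
    by rewrite big_nat1.
  by [].
have step n k : `|S (n + k) w| <= `|S n w| + k%:R * D.
  elim: k => [|k IHk]; first by rewrite addn0 mul0r addr0.
  rewrite addnS -natr1 mulrDl mul1r addrA.
  have -> : S (n + k).+1 w = S (n + k) w + h (X (n + k) w) by rewrite /partial_sum big_ord_recr.
  by apply: le_trans (ler_normD _ _) _; exact: lerD.
apply/cvgr0Pnorm_le => e e0.
have e2 : 0 < (e / 2) ^+ 2 by rewrite exprn_gt0 // divr_gt0.
have [K _ KP] := cvgr0_norm_le _ Ycvg _ e2.
(* From the square of [k + 1] to [n] there are at most [2 * (k + 1)] further summands, each bounded
   by [D]; [K'] makes their total at most [e / 2] times that square. *)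
have [K' KP'] : exists K' : nat, 4 * D / e < K'%:R.
  by exists (Num.truncn (4 * D / e)).+1; exact: truncnS_gt.
pose L := (maxn K.+1 K'.+1).
exists (L * L)%N => // n /= Ln.
have [k /andP[k1 k2]] := nat_sqrt_exists n.
have Lk : (L <= k)%N.
  rewrite leqNgt; apply/negP => kL.
  by have := leq_trans k2 (leq_trans (leq_mul kL kL) Ln); rewrite ltnn.
case: k k1 k2 Lk => [|k] k1 k2 Lk; first by clear -Lk; move: Lk; rewrite /L; lia.
have kK : (K <= k)%N by clear -Lk; move: Lk; rewrite /L; lia.
have kK' : (K' <= k.+1)%N by clear -Lk; move: Lk; rewrite /L; lia.
have := KP k kK; rewrite /Y ger0_norm ?sqr_ge0 // => H.
have sq0 : 0 < (k.+1 * k.+1)%:R :> R by rewrite ltr0n.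
have n0 : 0 < n%:R :> R by rewrite ltr0n (leq_trans _ k1).
have H1 : `|S (k.+1 * k.+1) w| <= e / 2 * (k.+1 * k.+1)%:R.
  rewrite -ler_pdivrMr // -[X in _ / X <= _]ger0_norm ?(ltW sq0) // -normf_div.
  by rewrite -ler_sqr ?nnegrE ?divr_ge0 ?(ltW e0) // real_normK ?num_real.
have H2 := step (k.+1 * k.+1)%N (n - k.+1 * k.+1)%N; rewrite subnKC // in H2.
have H3 : (n - k.+1 * k.+1)%:R * D <= e / 2 * (k.+1 * k.+1)%:R.
  apply: (@le_trans _ _ ((2 * k.+1)%:R * D)).
    rewrite ler_wpM2r // ler_nat leq_subLR -ltnS.
    suff -> : (k.+1 * k.+1 + 2 * k.+1).+1 = (k.+2 * k.+2)%N by [].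
    by clear; lia.
  have : 4 * D / e <= k.+1%:R by apply: le_trans (ltW KP') _; rewrite ler_nat.
  rewrite ler_pdivrMr // !natrM => H4.
  have kp : 0 < k.+1%:R :> R by rewrite ltr0n.
  nra.
rewrite normf_div [X in _ / X <= _]ger0_norm ?(ltW n0) // ler_pdivrMr //.
have : (k.+1 * k.+1)%:R <= n%:R :> R by rewrite ler_nat.
nra.
Unshelve. all: by end_near. Qed.

End SecondMoment.

(** * Uniform approximation by sums of logarithmic bumps *)

Section Bump.
Context {R : realType}.
Implicit Types c w z : R[i].

Definition log_bump c (r : R) w : R := ln (Num.max (2 * r) (nm (w - c))) - ln (Num.max r (nm (w - c))).

(** Above [r] the logarithm has slope at most [1 / r], by [ln (1 + u) <= u]. *)
Lemma ln_max_lip (r x y : R) : 0 < r -> 0 <= x -> 0 <= y ->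
  `|ln (Num.max r x) - ln (Num.max r y)| <= `|x - y| / r.
Proof.
move=> r0; wlog xy : x y / x <= y.
  move=> H x0 y0; have [xy|/ltW yx] := leP x y; first exact: H.
  by rewrite distrC [`|x - y|]distrC; exact: H.
move=> x0 y0; set a := Num.max r x; set b := Num.max r y.
have ra : r <= a by rewrite /a le_max lexx.
have a0 : 0 < a by apply: lt_le_trans ra.
have ab : a <= b by rewrite /a /b ge_max !le_max lexx xy orbT.
have b0 : 0 < b by apply: lt_le_trans ab.
have bay : b - a <= y - x.
  by rewrite /a /b; case: (leP r x); case: (leP r y); lra.
rewrite distrC ger0_norm ?subr_ge0 ?ler_ln ?posrE // distrC ger0_norm ?subr_ge0 //.
rewrite -ln_div ?posrE //.
have -> : b / a = 1 + (b - a) / a by field; rewrite gt_eqF.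
apply: (@le_trans _ _ ((b - a) / a)).
  apply: le_ln1Dx; apply: (@lt_le_trans _ _ 0); first by lra.
  by rewrite divr_ge0 ?subr_ge0 // ltW.
apply: ler_pM => //; rewrite ?subr_ge0 ?invr_ge0 ?(ltW a0) //.
by rewrite lef_pV2 ?posrE.
Qed.

Lemma bump_lip c r w z : 0 < r -> `|log_bump c r w - log_bump c r z| <= 2 * nm (w - z) / r.
Proof.
move=> r0; rewrite /log_bump.
have r20 : 0 < 2 * r by rewrite mulr_gt0.
have d : `|nm (w - c) - nm (z - c)| <= nm (w - z).
  by apply: le_trans (nm_dist_dist _ _) _; rewrite opprB addrA subrK.
have h1 := ln_max_lip r0 (nm_ge0 (w - c)) (nm_ge0 (z - c)).
have h2 := ln_max_lip r20 (nm_ge0 (w - c)) (nm_ge0 (z - c)).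
have h3 : `|nm (w - c) - nm (z - c)| / (2 * r) <= nm (w - z) / r.
  apply: ler_pM => //; first by rewrite invr_ge0 ltW.
  by rewrite lef_pV2 ?posrE //; lra.
have h4 : `|nm (w - c) - nm (z - c)| / r <= nm (w - z) / r.
  by rewrite ler_pM2r ?invr_gt0.
have -> : 2 * nm (w - z) / r = nm (w - z) / r + nm (w - z) / r by ring.
set A := ln (Num.max (2 * r) (nm (w - c))) in h2 *.
set A' := ln (Num.max (2 * r) (nm (z - c))) in h2 *.
set B := ln (Num.max r (nm (w - c))) in h1 *.
set B' := ln (Num.max r (nm (z - c))) in h1 *.
have -> : A - B - (A' - B') = (A - A') - (B - B') by ring.
apply: le_trans (ler_normB _ _) _.
by apply: lerD; [exact: le_trans h3|exact: le_trans h4].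
Qed.

Lemma bump_ge0 c r w : 0 < r -> 0 <= log_bump c r w.
Proof.
move=> r0; rewrite /log_bump subr_ge0 ler_ln ?posrE ?lt_max ?r0 ?mulr_gt0 //.
rewrite ge_max !le_max lexx orbT andbT; apply/orP; left; lra.
Qed.

Lemma bump_le_ln2 c r w : 0 < r -> log_bump c r w <= ln 2.
Proof.
move=> r0; rewrite /log_bump lerBlDr -lnM ?posrE ?lt_max ?r0 //.
rewrite ler_ln ?posrE ?mulr_gt0 ?lt_max ?r0 ?mulr_gt0 //.
rewrite ge_max ler_pM2l // le_max lexx /=.
have := nm_ge0 (w - c); have : nm (w - c) <= Num.max r (nm (w - c)) by rewrite le_max lexx orbT.
lra.
Qed.

Lemma ln2_itv : 2^-1 <= @ln R 2 <= 1.
Proof.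
apply/andP; split; last first.
  by have := @le_ln1Dx R 1; rewrite (_ : 1 + 1 = 2) //; apply; lra.
have := @le_ln1Dx R (- 2^-1); rewrite (_ : 1 - 2^-1 = 2^-1); last by lra.
rewrite lnV ?posrE //; have l2 : -1 < - 2^-1 :> R by lra.
by move=> /(_ l2); lra.
Qed.

Lemma bump_far c r w : 0 < r -> 2 * r <= nm (w - c) -> log_bump c r w = 0.
Proof.
move=> r0 h; rewrite /log_bump max_r // max_r ?subrr //; apply: le_trans h; lra.
Qed.

Lemma bump_near c r w : 0 < r -> nm (w - c) <= r -> log_bump c r w = ln 2.
Proof.
move=> r0 h; rewrite /log_bump max_l; last by apply: (le_trans h); lra.
by rewrite max_l // lnM ?posrE // addrK.
Qed.

End Bump.

Section Approximation.
Context {R : realType}.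
Implicit Types c w z : R[i].

Lemma norm_le_shift (x y a b : R) : `|y| <= a -> `|x - y| < b -> `|x| <= a + b.
Proof.
move=> ya xy; rewrite -(subrK y x) addrC; apply: le_trans (ler_normD _ _) _.
by rewrite lerD // ltW.
Qed.

Lemma sum_window (F : nat -> R) M a l : (a + l <= M)%N ->
  (forall i, F i != 0 -> (a <= i < a + l)%N) ->
  \sum_(i < M) F i = \sum_(i < l) F (a + i)%N.
Proof.
move=> alM F0.
have Fz i : ~~ (a <= i < a + l)%N -> F i = 0.
  by move=> h; apply/eqP; apply/negPn/negP => /F0; apply/negP.
rewrite -(big_mkord xpredT) (@big_cat_nat _ _ _ a) //=; last by lia.
rewrite [X in _ + X](@big_cat_nat _ _ _ (a + l)) ?leq_addr //=.
rewrite big_nat_cond big1 ?add0r; last first.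
  by move=> i /andP[/andP[h1 h2] _]; apply: Fz; rewrite negb_and -ltnNge h2.
rewrite [X in _ + X]big_nat_cond [X in _ + X]big1 ?addr0; last first.
  by move=> i /andP[/andP[h1 h2] _]; apply: Fz; rewrite negb_and -!leqNgt h1 orbT.
rewrite -{1}[a]add0n big_addn addKn big_mkord.
by apply: eq_bigr => i _; rewrite addnC.
Qed.

Lemma sum_window2 (F : nat -> nat -> R) M a b l : (a + l <= M)%N -> (b + l <= M)%N ->
  (forall i j, F i j != 0 -> (a <= i < a + l)%N && (b <= j < b + l)%N) ->
  \sum_(i < M) \sum_(j < M) F i j = \sum_(i < l) \sum_(j < l) F (a + i)%N (b + j)%N.
Proof.
move=> aM bM F0; rewrite (@sum_window (fun i => \sum_(j < M) F i j) M a l) //.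
  apply: eq_bigr => i _; apply: sum_window => // j.
  by move/F0 => /andP[].
move=> i; apply: contraR => h; rewrite big1 // => j _; apply/eqP.
by apply: contraR h => /F0 /andP[].
Qed.

(** Indices are natural numbers, so the origin sits at the index [(p, p)]. *)
Definition grid (h : R) (p i j : nat) : R[i] := ((i%:R - p%:R) * h) +i* ((j%:R - p%:R) * h).

(** A bump reaches to the distance [2 * r], that is [2 * m] grid steps, and [e] is the distance in
    steps from [w] to the reference grid point. *)
Lemma grid_window (h r : R) (p m i j a b e : nat) w : 0 < h ->
  r = m%:R * h -> nm (w - grid h p a b) <= e%:R * h -> log_bump (grid h p i j) r w != 0 ->
  (i < a + (2 * m + e) /\ a < i + (2 * m + e) /\ j < b + (2 * m + e) /\ b < j + (2 * m + e))%N.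
Proof.
move=> h0 rm wab b0.
have m0 : (0 < m)%N.
  rewrite lt0n; apply/eqP => mz; move: b0; rewrite /log_bump rm mz mul0r mulr0 subrr eqxx //.
have r0 : 0 < r by rewrite rm mulr_gt0 // ltr0n.
have close : nm (w - grid h p i j) < 2 * r.
  by rewrite ltNge; apply/negP => hh; rewrite (bump_far r0 hh) eqxx in b0.
have D : nm (grid h p i j - grid h p a b) < (2 * m + e)%:R * h.
  have -> : grid h p i j - grid h p a b = (w - grid h p a b) - (w - grid h p i j) by ring.
  apply: le_lt_trans (nm_le_add _ _) _; rewrite nm_opp natrD natrM mulrDl addrC.
  by apply: ltr_leD => //; rewrite -mulrA -rm.
have Dx := le_lt_trans (nm_Re_le _) D; have Dy := le_lt_trans (nm_Im_le _) D.
have key (u v : nat) : `|(u%:R - p%:R) * h - (v%:R - p%:R) * h| < (2 * m + e)%:R * h ->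
    (u < v + (2 * m + e))%N /\ (v < u + (2 * m + e))%N.
  rewrite -mulrBl normrM [`|h|]ger0_norm ?(ltW h0) // ltr_pM2r //.
  rewrite (_ : u%:R - p%:R - (v%:R - p%:R) = u%:R - v%:R :> R); last by ring.
  rewrite ltr_norml => /andP[h1 h2]; rewrite -!(ltr_nat R) !natrD; split; lra.
have [? ?] := key i a Dx; have [? ?] := key j b Dy.
by [].
Qed.

Lemma sum_subwindow (F : nat -> R) M a l : (a + l <= M)%N -> (forall i, 0 <= F i) ->
  \sum_(i < l) F (a + i)%N <= \sum_(i < M) F i.
Proof.
move=> alM F0; pose G i := if (a <= i < a + l)%N then F i else 0.
have -> : \sum_(i < l) F (a + i)%N = \sum_(i < l) G (a + i)%N.
  by apply: eq_bigr => i _; rewrite /G leq_addr ltn_add2l ltn_ord.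
rewrite -(@sum_window G M) //; last by move=> i; rewrite /G; case: ifP => //; rewrite eqxx.
by apply: ler_sum => i _; rewrite /G; case: ifP.
Qed.

Lemma sum2_le (F : nat -> nat -> R) l (c : R) : (forall i j, F i j <= c) ->
  \sum_(i < l) \sum_(j < l) F i j <= (l * l)%:R * c.
Proof.
move=> Fc; apply: (@le_trans _ _ (\sum_(i < l) \sum_(j < l) c)).
  by apply: ler_sum => i _; apply: ler_sum => j _.
by rewrite !sumr_const !card_ord -mulrnA mulr_natl.
Qed.

(** The sum of all bumps centered on a fine grid is nearly constant: its value at a grid point is
    always the same by translation, and a bump varies by at most [4 h / r] inside a cell. *)
Lemma log_bump_approximation (f : R[i] -> R) (B L : R) : 0 <= B -> 0 < L ->
  (forall z, `|f z| <= B) ->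
  (forall z, f z != 0 -> `|complex.Re z| <= L /\ `|complex.Im z| <= L) ->
  (forall e : R, 0 < e ->
     exists2 eta : R, 0 < eta & forall z w, nm (z - w) < eta -> `|f z - f w| <= e) ->
  forall e : R, 0 < e -> exists k m p M : nat, exists a : nat -> nat -> R,
  let r := k.+1%:R^-1 in let h := r / m.+1%:R in
  forall z, `|f z - \sum_(i < M) \sum_(j < M) a i j * log_bump (grid h p i j) r z| <= e.
Proof.
move=> B0 L0 fB fL fuc e e0.
have [eta eta0 etaP] := fuc (e / 4) (divr_gt0 e0 (ltr0Sn R 3)).
(* A bump vanishes from the distance [2 * r] on, so [2 * r < eta] lets [f] deviate by at most
   [e / 4] from its value at the center of any bump that matters. *)
have [k kP] : exists k : nat, 2 / eta < k.+1%:R.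
  by exists (Num.truncn (2 / eta)); exact: truncnS_gt.
pose r : R := k.+1%:R^-1.
have r0 : 0 < r by rewrite invr_gt0 ltr0n.
have r2 : 2 * r < eta.
  by rewrite /r ltr_pdivrMr ?ltr0n // mulrC -ltr_pdivrMr.
(* A generous constant: the end needs [256 * m * (B + e / 4) <= 3 / 4 * e * K], where
   [K >= m ^ 2 / 8]. *)
have [m' mP] : exists m' : nat, 20000 * (B / e + 1) < m'.+1%:R.
  by exists (Num.truncn (20000 * (B / e + 1))); exact: truncnS_gt.
(* an even number of subdivisions, so that the central part of a bump contains many grid points *)
pose m : nat := m'.*2.+2.
have m0 : (0 < m)%N by [].
have m2 : m = (2 * m'.+1)%N by rewrite mulnS mul2n.
have mR : 0 < m%:R :> R by rewrite ltr0n.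
pose h : R := r / m%:R.
have h0 : 0 < h by rewrite divr_gt0.
have rm : r = m%:R * h by rewrite /h mulrCA mulfV ?mulr1 ?gt_eqF.
suff [p [M [a H]]] : exists p M : nat, exists a : nat -> nat -> R, forall z,
    `|f z - \sum_(i < M) \sum_(j < M) a i j * log_bump (grid h p i j) r z| <= e.
  by exists k, m'.*2.+1, p, M, a.
clearbody h; clearbody r.
(* The square grid covers the support of [f] enlarged by [2 * r], with a margin of [2 * m + 5]
   steps, so that no window is cut off. *)
have [p pP] : exists p : nat, (L + 2 * r) / h + (2 * m + 5)%:R < p%:R.
  by exists (Num.truncn ((L + 2 * r) / h + (2 * m + 5)%:R)).+1; exact: truncnS_gt.
pose M := (2 * p)%N.
pose N w := \sum_(i < M) \sum_(j < M) log_bump (grid h p i j) r w.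
(* The common value of [N] at grid points away from the border, computed at the origin. The
   half-width [2 * m + 2] allows [2 * m] steps for a bump and 2 for the distance from [z] to the
   corner of its cell. *)
pose K := \sum_(i < 4 * m + 4) \sum_(j < 4 * m + 4) log_bump (grid h (2 * m + 2) i j) r 0.
have NK a b : (2 * m + 2 <= a)%N -> (a + (2 * m + 2) <= M)%N ->
    (2 * m + 2 <= b)%N -> (b + (2 * m + 2) <= M)%N -> N (grid h p a b) = K.
  move=> a1 a2 b1 b2.
  have l4 : (4 * m + 4 = (2 * m + 2) + (2 * m + 2))%N by clear; lia.
  rewrite /N (@sum_window2 (fun i j => log_bump (grid h p i j) r (grid h p a b)) M
    (a - (2 * m + 2)) (b - (2 * m + 2)) (4 * m + 4)).
  - apply: eq_bigr => i _; apply: eq_bigr => j _.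
    rewrite /log_bump; congr (ln (Num.max _ (nm _)) - ln (Num.max _ (nm _)));
    apply/eqP; rewrite eq_complex /=; apply/andP; split; apply/eqP;
    rewrite !natrD natrB // natrD; ring.
  - by rewrite l4 addnA subnK.
  - by rewrite l4 addnA subnK.
  move=> i j bij; have := @grid_window h r p m i j a b 0 (grid h p a b) h0 rm _ bij.
  by rewrite subrr Normc.normc0 mul0r lexx addn0 => /(_ isT); clear -a1 a2 b1 b2; lia.
have e_B : 0 <= B / e by rewrite divr_ge0 // ltW.
(* A quarter of the central part of the window already contains [(m / 2) ^ 2] grid points within [r]
   of the origin, and each of them contributes [ln 2 >= 1 / 2]. *)
have KL : m%:R ^+ 2 / 8 <= K.
  have b0 i j : 0 <= log_bump (grid h (2 * m + 2) i j) r 0 by exact: bump_ge0.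
  apply: (@le_trans _ _ (\sum_(i < m'.+1) \sum_(j < m'.+1)
     log_bump (grid h (2 * m + 2) (2 * m + 2 + i) (2 * m + 2 + j)) r 0)); last first.
    apply: (@le_trans _ _ (\sum_(i < m'.+1) \sum_(j < 4 * m + 4)
       log_bump (grid h (2 * m + 2) (2 * m + 2 + i) j) r 0)).
      apply: ler_sum => i _.
      apply: (@sum_subwindow (fun j => log_bump (grid h (2 * m + 2) (2 * m + 2 + i) j) r 0)) => //.
      by rewrite /m; clear; lia.
    apply: (@sum_subwindow (fun i => \sum_(j < 4 * m + 4) log_bump (grid h (2 * m + 2) i j) r 0)).
      by rewrite /m; clear; lia.
    by move=> i; exact: sumr_ge0.
  rewrite (eq_bigr (fun i : 'I_m'.+1 => \sum_(j < m'.+1) ln 2)); last first.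
    move=> i _; apply: eq_bigr => j _; apply: bump_near => //.
    rewrite sub0r nm_opp; apply: le_trans (nm_le_ReIm _) _.
    rewrite /= !natrD ![_ + _%:R - _]addrC !addKr !normrM !ger0_norm ?(ltW h0) //.
    rewrite -mulrDl rm -natrD ler_pM2r // ler_nat m2.
    by have := ltn_ord i; have := ltn_ord j; clear; lia.
  rewrite !sumr_const !card_ord -mulrnA -[ln 2 *+ _]mulr_natl m2 !natrM.
  have /andP[l2 _] := @ln2_itv R.
  rewrite exprMn -expr2 (_ : 2 ^+ 2 * m'.+1%:R ^+ 2 / 8 = m'.+1%:R ^+ 2 * 2^-1); last by field.
  by rewrite ler_wpM2l // exprn_ge0.
have K0 : 0 < K by apply: lt_le_trans KL; rewrite divr_gt0 // exprn_gt0.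
exists p, M, (fun i j => f (grid h p i j) / K) => z.
have -> : \sum_(i < M) \sum_(j < M) f (grid h p i j) / K * log_bump (grid h p i j) r z =
    (\sum_(i < M) \sum_(j < M) f (grid h p i j) * log_bump (grid h p i j) r z) / K.
  rewrite mulr_suml; apply: eq_bigr => i _; rewrite mulr_suml; apply: eq_bigr => j _.
  by rewrite mulrAC.
have [inside|outside] := boolP ((`|complex.Re z| <= L + 2 * r) && (`|complex.Im z| <= L + 2 * r)); last first.
  have fz : f z = 0.
    apply/eqP; apply: contraNT outside => /fL[h1 h2].
    by apply/andP; split; [apply: le_trans h1 _|apply: le_trans h2 _]; rewrite lerDl mulr_ge0 // ltW.
  rewrite fz big1 ?mul0r ?subr0 ?normr0 ?(ltW e0) // => i _; rewrite big1 // => j _.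
  have [->|fg] := eqVneq (f (grid h p i j)) 0; first by rewrite mul0r.
  have [h1 h2] := fL _ fg.
  rewrite bump_far ?mulr0 //; rewrite leNgt; apply/negP => close.
  move/negP: outside; apply; apply/andP; split.
    have : `|complex.Re z - complex.Re (grid h p i j)| < 2 * r.
      by apply: le_lt_trans close; have := nm_Re_le (z - grid h p i j); case: (z) => ? ?.
    exact: norm_le_shift.
  have : `|complex.Im z - complex.Im (grid h p i j)| < 2 * r.
    by apply: le_lt_trans close; have := nm_Im_le (z - grid h p i j); case: (z) => ? ?.
  exact: norm_le_shift.
have cell (x : R) : `|x| <= L + 2 * r -> exists a : nat,
    [/\ (2 * m + 5 <= a)%N, (a + (2 * m + 5) <= M)%N & `|x - (a%:R - p%:R) * h| <= h].
  rewrite ler_norml => /andP[x1 x2].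
  have x1' : - ((L + 2 * r) / h) <= x / h by rewrite -mulNr ler_pM2r ?invr_gt0.
  have x2' : x / h <= (L + 2 * r) / h by rewrite ler_pM2r ?invr_gt0.
  have y0 : (2 * m + 5)%:R <= x / h + p%:R by clear -x1' pP; lra.
  have y00 : 0 <= x / h + p%:R by apply: le_trans y0.
  have /andP[t1 t2] := truncn_itv y00.
  exists (Num.truncn (x / h + p%:R)); split.
  - by rewrite truncn_ge_nat.
  - rewrite -(ler_nat R) natrD /M natrM; clear -x2' pP t1; lra.
  - have -> : x - ((Num.truncn (x / h + p%:R))%:R - p%:R) * h =
       (x / h + p%:R - (Num.truncn (x / h + p%:R))%:R) * h.
      by field; rewrite gt_eqF.
    rewrite normrM [`|h|]ger0_norm ?(ltW h0) // ger0_norm; last by rewrite subr_ge0.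
    by rewrite ler_piMl ?(ltW h0) // lerBlDl natr1 ltW.
have /andP[in1 in2] := inside.
have [a [a1 a2 a3]] := cell _ in1; have [b [b1 b2 b3]] := cell _ in2.
have zg : nm (z - grid h p a b) <= 2 * h.
  apply: le_trans (nm_le_ReIm _) _; rewrite mulr_natl mulr2n.
  by move: a3 b3; case: (z) => x y /= a3 b3; exact: lerD.
have Kab : N (grid h p a b) = K by apply: NK; clear -a1 a2 b1 b2; lia.
(* At most [(4 * m + 4) ^ 2 <= 64 * m ^ 2] bumps are involved, and each varies by at most [4 / m]
   over the distance [2 * h]. *)
have NK' : `|N z - K| <= 256 * m%:R.
  rewrite -Kab /N -sumrB.
  apply: le_trans (ler_norm_sum _ _ _) _.
  apply: (@le_trans _ _ (\sum_(i < M) \sum_(j < M)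
      `|log_bump (grid h p i j) r z - log_bump (grid h p i j) r (grid h p a b)|)).
    by apply: ler_sum => i _; rewrite -sumrB; exact: ler_norm_sum.
  rewrite (@sum_window2 (fun i j => `|log_bump (grid h p i j) r z - log_bump (grid h p i j) r (grid h p a b)|)
     M (a - (2 * m + 2)) (b - (2 * m + 2)) (4 * m + 4)).
  - apply: (@le_trans _ _ (((4 * m + 4) * (4 * m + 4))%:R * (4 / m%:R))).
      apply: (@sum2_le (fun i j => `|log_bump (grid h p (a - (2 * m + 2) + i) (b - (2 * m + 2) + j)) r z -
        log_bump (grid h p (a - (2 * m + 2) + i) (b - (2 * m + 2) + j)) r (grid h p a b)|)) => i j.
      apply: le_trans (bump_lip _ _ _ r0) _.
      rewrite ler_pdivrMr //.
      have -> : 4 / m%:R * r = 4 * h by rewrite rm mulrA divfK ?gt_eqF.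
      by move: zg; clear; lra.
    rewrite mulrA ler_pdivrMr // -mulrA -!natrM ler_nat.
    by clear -m0; nia.
  - by clear -a1 a2; lia.
  - by clear -b1 b2; lia.
  move=> i j bij.
  have [bz|bz] := eqVneq (log_bump (grid h p i j) r z) 0; last first.
    have := @grid_window h r p m i j a b 2 z h0 rm zg bz.
    by clear -a1 a2 b1 b2; lia.
  have bg : log_bump (grid h p i j) r (grid h p a b) != 0.
    by apply: contraNneq bij => ->; rewrite bz subrr normr0.
  have := @grid_window h r p m i j a b 0 (grid h p a b) h0 rm _ bg.
  by rewrite subrr Normc.normc0 mul0r lexx addn0 => /(_ isT); clear -a1 a2 b1 b2; lia.
have N0 : 0 <= N z by apply: sumr_ge0 => i _; apply: sumr_ge0 => j _; exact: bump_ge0.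
have main : `|f z * N z - \sum_(i < M) \sum_(j < M) f (grid h p i j) * log_bump (grid h p i j) r z| <=
    e / 4 * N z.
  rewrite /N mulr_sumr -sumrB; apply: le_trans (ler_norm_sum _ _ _) _.
  rewrite [leRHS]mulr_sumr; apply: ler_sum => i _.
  rewrite mulr_sumr -sumrB; apply: le_trans (ler_norm_sum _ _ _) _.
  rewrite [leRHS]mulr_sumr; apply: ler_sum => j _.
  rewrite -mulrBl normrM [`|log_bump _ _ _|]ger0_norm ?bump_ge0 //.
  have [->|bz] := eqVneq (log_bump (grid h p i j) r z) 0; first by rewrite !mulr0.
  apply: ler_wpM2r; first exact: bump_ge0.
  apply: etaP; apply: le_lt_trans r2.
  by rewrite leNgt; apply: contra_neqN bz => /ltW; exact: bump_far.
set Q := \sum_(i < M) _ in main *.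
have EQ : `|f z - Q / K| * K = `|f z * K - Q|.
  by rewrite -[X in _ * X](gtr0_norm K0) -normrM mulrBl divfK ?gt_eqF.
rewrite -(ler_pM2r K0) EQ.
have -> : f z * K - Q = (f z * N z - Q) - f z * (N z - K) by ring.
apply: le_trans (ler_normB _ _) _; rewrite normrM.
have t1 : `|f z| * `|N z - K| <= B * (256 * m%:R) by apply: ler_pM.
have t2 : N z <= K + 256 * m%:R by move: NK'; rewrite ler_norml => /andP[_]; clear; lra.
have t3 : e / 4 * N z <= e / 4 * (K + 256 * m%:R) by rewrite ler_pM2l // divr_gt0.
have mB : 20000 * (B + e) <= e * m%:R.
  have : 20000 * (B / e + 1) * e <= m%:R * e.
    rewrite ler_pM2r // (le_trans (ltW mP)) // ler_nat /m.
    by clear; lia.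
  have -> : 20000 * (B / e + 1) * e = 20000 * (B + e).
    by rewrite -mulrA; congr (_ * _); rewrite mulrDl mul1r divfK ?gt_eqF.
  by rewrite [m%:R * e]mulrC.
have t4 : e * (m%:R ^+ 2 / 8) <= e * K by rewrite ler_pM2l.
have t5 : 20000 * (B + e) * m%:R <= e * m%:R * m%:R by rewrite ler_pM2r.
move: main t1 t3 t4 t5 B0 (ltW e0) (ltW mR); clear => main t1 t3 t4 t5 B1 e1 mR'.
rewrite expr2 in t4; nra.
Qed.

End Approximation.

(** * Test functions and zero measures *)

Section Topology.
Context {R : realType}.
Implicit Types f : R[i] -> R.

(** Continuity is stated with the real-valued modulus, since the norm of [R[i]^o] takes its values
    in [R[i]]. *)
Definition nm_continuous f := forall z (e : R), 0 < e ->
  exists2 d : R, 0 < d & forall w, nm (z - w) < d -> `|f z - f w| < e.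

Lemma nbhs_nm (z : R[i]^o) (d : R) : 0 < d -> nbhs z [set w : R[i]^o | nm (z - w) < d].
Proof.
move=> d0; apply/nbhs_ballP; exists d%:C; first by rewrite /= ltcR.
by move=> w /=; rewrite /ball /= /ball_ /= ltcR.
Qed.

Lemma nm_continuousP f : nm_continuous f -> continuous (f : R[i]^o -> R).
Proof.
move=> cf z; apply/(@cvgrPdist_lt R R _ _ (nbhs_filter (z : R[i]^o))) => e e0.
have [d d0 H] := cf z e e0.
by apply: filterS (nbhs_nm z d0) => w /= /H.
Qed.

Lemma Re_nm_continuous : nm_continuous (@complex.Re R).
Proof.
move=> z e e0; exists e => // w; apply: le_lt_trans.
by have := nm_Re_le (z - w); rewrite raddfB.
Qed.

Lemma Im_nm_continuous : nm_continuous (@complex.Im R).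
Proof.
move=> z e e0; exists e => // w; apply: le_lt_trans.
by have := nm_Im_le (z - w); rewrite raddfB.
Qed.

Lemma nm_continuous_measurable f : nm_continuous f ->
  measurable_fun setT (f : borelC R -> R).
Proof.
move=> /nm_continuousP/continuousP cf.
apply: (measurability _ (RGenOpens.measurableE R)) => _ [_ [a [b ->]] <-].
rewrite setTI; apply: sub_sigma_algebra; apply: cf; exact: interval_open.
Qed.

Lemma cmeas_id : cmeas (fun z : borelC R => z : R[i]).
Proof.
by split; apply: nm_continuous_measurable; [exact: Re_nm_continuous | exact: Im_nm_continuous].
Qed.

Lemma smooth_nm_continuous f : smooth f -> nm_continuous f.
Proof.
move=> /(_ [::]) [/= cf _] [a b] e e0.
have /cvgrPdist_lt /(_ e e0) /nbhs_ballP[d /= d0 H] := cf (a, b).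
exists d => // -[a' b'] dw; apply: (H (a', b')); split; rewrite /ball /= /ball_ /=.
  by apply: le_lt_trans dw; have := nm_Re_le ((a +i* b) - (a' +i* b')).
by apply: le_lt_trans dw; have := nm_Im_le ((a +i* b) - (a' +i* b')).
Qed.

Lemma nm_continuous_compact_bounded f (K : set R[i]) : nm_continuous f ->
  @compact R[i]^o K -> exists2 B : R, 0 < B & forall z, K z -> `|f z| <= B.
Proof.
move=> cf cK.
have cfK : compact (f @` K).
  by apply: (@continuous_compact R[i]^o) => //; apply: continuous_subspaceT; exact: nm_continuousP.
have [M [_ HM]] := compact_bounded cfK.
exists (`|M| + 1) => [|z Kz]; first by rewrite ltr_wpDl.
by apply: (HM (`|M| + 1)); [rewrite (le_lt_trans (ler_norm _)) ?ltrDl | exists z].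
Qed.

Variable f : test_function R.

Lemma test_nm_continuous : nm_continuous f.
Proof. exact: smooth_nm_continuous (test_smooth f). Qed.

Lemma test_support_nbhd z : f z != 0 -> closure [set z : R[i]^o | f z != 0] z.
Proof. by move=> fz; apply: subset_closure. Qed.

Lemma test_bounded : exists2 B : R, 0 < B & forall z, `|f z| <= B.
Proof.
have [B B0 HB] := nm_continuous_compact_bounded test_nm_continuous (@test_compact_support R f).
exists B => // z; have [->|fz] := eqVneq (f z) 0; first by rewrite normr0 ltW.
exact/HB/test_support_nbhd.
Qed.

Lemma test_support_bounded : exists2 L : R, 0 < L &
  forall z, f z != 0 -> `|complex.Re z| <= L /\ `|complex.Im z| <= L.
Proof.
have [L L0 HL] := nm_continuous_compact_bounded Re_nm_continuous (@test_compact_support R f).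
have [L' L'0 HL'] := nm_continuous_compact_bounded Im_nm_continuous (@test_compact_support R f).
exists (L + L'); first by rewrite addr_gt0.
move=> z /test_support_nbhd Kz; split.
  by rewrite (le_trans (HL z Kz)) // lerDl ltW.
by rewrite (le_trans (HL' z Kz)) // lerDr ltW.
Qed.

(** Heine's theorem with the base point in the compact support. In a pair of points where [f] does
    not vanish at both, one of the two can serve as base point. *)
Lemma test_unif_continuous (e : R) : 0 < e ->
  exists2 eta : R, 0 < eta & forall z w, nm (z - w) < eta -> `|f z - f w| <= e.
Proof.
move=> e0.
have /compact_near_coveringP cov := @test_compact_support R f.
have [eta /= eta0 H] : exists2 eta : R, 0 < eta &
    forall z, closure [set z : R[i]^o | f z != 0] z ->
    forall w, nm (z - w) < eta -> `|f z - f w| <= e.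
  have {cov} := cov _ (0^'+ : set_system R) (fun d z => forall w, nm (z - w) < d -> `|f z - f w| <= e) _.
  case=> [z _|d /= d0 H].
    have [d d0 H] := test_nm_continuous z (divr_gt0 e0 (ltr0n _ 2)).
    exists ([set x : R[i]^o | nm (z - x) < d / 2], [set t : R | t < d / 2]) => /=.
      by split; [apply: nbhs_nm; rewrite divr_gt0 | apply: nbhs_right_lt; rewrite divr_gt0].
    move=> [x t] [/= zx td] w xw.
    have zw : nm (z - w) < d.
      have := nm_le_add (z - x) (x - w); rewrite addrA subrK; lra.
    have := H x _; have := H w zw; have := ler_distD (f z) (f x) (f w).
    rewrite [`|f x - f z|]distrC => h1 h2 h3.
    have : `|f z - f x| < e / 2 by apply: h3; lra.
    lra.
  exists (d / 2); first by rewrite divr_gt0.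
  move=> z Kz w zw; apply: (H (d / 2)) => //=; last by rewrite divr_gt0.
  rewrite sub0r normrN gtr0_norm ?divr_gt0 //; lra.
exists eta => // z w zw.
have [fz|fz] := eqVneq (f z) 0; last by apply: H => //; exact: test_support_nbhd.
have [fw|fw] := eqVneq (f w) 0; first by rewrite fz fw subrr normr0 ltW.
by rewrite distrC; apply: H; [exact: test_support_nbhd | rewrite nm_distC].
Qed.

End Topology.

(** * Zeros of polynomials and their uniform measure *)

Section Zeros.
Context {R : realType}.
Implicit Types (p : {poly R[i]}) (s : seq R[i]).

Lemma zerosE p : p = lead_coef p *: \prod_(z <- zeros p) ('X - z%:P).
Proof. by rewrite {1}/zeros; case: closed_field_poly_normal. Qed.

(** Unique factorization; [zeros] is a chosen list in an unknown order, so it is known only up to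
    permutation. *)
Lemma zeros_scale_prod (c : R[i]) s : c != 0 ->
  perm_eq (zeros (c *: \prod_(z <- s) ('X - z%:P))) s.
Proof.
move=> c0; apply: prod_XsubC_eq.
have := zerosE (c *: \prod_(z <- s) ('X - z%:P)).
rewrite lead_coefZ lead_coef_prod_XsubC mulr1.
by move=> /(scalerI c0) /esym.
Qed.

Lemma zeros_prod s : perm_eq (zeros (\prod_(z <- s) ('X - z%:P))) s.
Proof. by have := zeros_scale_prod s (oner_neq0 _); rewrite scale1r. Qed.

(** In characteristic 0 the top coefficient [size s] of the derivative is nonzero, so the degree
    drops by exactly one. *)
Lemma deriv_prod_XsubC s (p := \prod_(z <- s) ('X - z%:P)) : (0 < size s)%N ->
  size (zeros p^`()) = (size s).-1 /\
  p^`() = (size s)%:R *: \prod_(w <- zeros p^`()) ('X - w%:P).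
Proof.
move=> s0.
have sp : size p = (size s).+1 by rewrite /p size_prod_XsubC.
have lp : p`_(size s) = 1.
  by have := lead_coef_prod_XsubC s xpredT id; rewrite lead_coefE -/p sp.
have cd : p^`()`_(size s).-1 = (size s)%:R.
  by rewrite coef_deriv prednK // lp.
have s_neq0 : (size s)%:R != 0 :> R[i] by rewrite pnatr_eq0 -lt0n.
have sd : size p^`() = size s.
  apply/eqP; rewrite eqn_leq; apply/andP; split.
    have p0 : p != 0 by rewrite -size_poly_gt0 sp.
    by have := lt_size_deriv p0; rewrite sp ltnS.
  rewrite leqNgt; apply/negP => lt.
  have := cd; rewrite nth_default; last by rewrite -ltnS prednK.
  by move=> /esym/eqP; rewrite (negPf s_neq0).
have ld : lead_coef p^`() = (size s)%:R by rewrite lead_coefE sd cd.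
have E := zerosE p^`(); rewrite ld in E; split=> //.
have := congr1 (fun q : {poly _} => size q) E.
rewrite size_scale // size_prod_XsubC sd => ->; by [].
Qed.

(** With at least one zero the total mass is a positive integer, so [mnormalize] does not fall back
    on its default measure. *)
Lemma zero_measure_setE p (A : set (borelC R)) : (0 < size (zeros p))%N ->
  zero_measure p A = (((size (zeros p))%:R^-1)%:E *
    msum (fun i => dirac ((zeros p)`_i : borelC R)) (size (zeros p)) A)%E.
Proof.
move=> s0.
have normE (m : {measure set (borelC R) -> \bar R}) (Q : probability (borelC R) R) n :
    (0 < n)%N -> m setT = n%:R%:E -> mnormalize m Q A = ((n%:R^-1)%:E * m A)%E.
  move=> n0 mT; rewrite /mnormalize mT eqe pnatr_eq0 -leqn0 leqNgt n0 /=.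
  by rewrite muleC.
apply: normE => //.
rewrite /= /msum (eq_bigr (fun=> 1%:E)) => [|i _]; last by rewrite /= diracE in_setT.
by rewrite sumEFin sumr_const card_ord.
Qed.

Lemma zero_measure_integral p (f : R[i] -> R) : (0 < size (zeros p))%N ->
  measurable_fun setT (f : borelC R -> R) ->
  \int[zero_measure p]_(z in setT) f z =
    (size (zeros p))%:R^-1 * \sum_(z <- zeros p) f z.
Proof.
move=> s0 mf; set s := zeros p; set n := size s.
have k0 : 0 <= n%:R^-1 :> R by rewrite invr_ge0.
have ge0 (g : R[i] -> R) : measurable_fun setT (g : borelC R -> R) -> (forall z, 0 <= g z) ->
    (\int[zero_measure p]_z (g z)%:E = (n%:R^-1 * \sum_(z <- s) g z)%:E)%E.
  move=> mg g0.
  transitivity (\int[mscale (NngNum k0) (msum (fun i => @dirac _ (borelC R) (s`_i) R) n)]_z (g z)%:E)%E.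
    by apply: eq_measure_integral => A mA _; exact: zero_measure_setE.
  have mgE : measurable_fun setT (fun z : borelC R => (g z)%:E) by exact/measurable_EFinP.
  rewrite ge0_integral_mscale //; last by move=> z _; rewrite lee_fin.
  rewrite ge0_integral_measure_sum //; last by move=> z _; rewrite lee_fin.
  rewrite EFinM; congr (_ * _)%E.
  rewrite (big_nth 0) big_mkord -sumEFin; apply: eq_bigr => i _.
  by rewrite integral_dirac // diracE in_setT mul1e.
rewrite /Rintegral integralE.
have -> : (\int[zero_measure p]_z ((fun z => (f z)%:E)^\+ z) =
    (n%:R^-1 * \sum_(z <- s) Num.max (f z) 0)%:E)%E.
  rewrite -ge0; first by apply: eq_integral => z _; rewrite funeposE -EFin_max.
    by apply: measurable_maxr => //; exact: measurable_cst.
  by move=> z; rewrite le_max lexx orbT.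
have -> : (\int[zero_measure p]_z ((fun z => (f z)%:E)^\- z) =
    (n%:R^-1 * \sum_(z <- s) Num.max (- f z) 0)%:E)%E.
  rewrite -ge0; first by apply: eq_integral => z _; rewrite funenegE -EFin_max.
    by apply: measurable_maxr => //; exact: measurableT_comp.
  by move=> z; rewrite le_max lexx orbT.
rewrite -EFinB /= -mulrBr -sumrB; congr (_ * _); apply: eq_bigr => z _.
by case: (leP (f z) 0); case: (leP (- f z) 0); lra.
Qed.

End Zeros.

Lemma cvg_finsum (R : realType) (T I : Type) (F : set_system T) (s : seq I)
    (u : I -> T -> R) (l : I -> R) : Filter F ->
  (forall i, u i t @[t --> F] --> l i) ->
  \sum_(i <- s) u i t @[t --> F] --> \sum_(i <- s) l i.
Proof.
move=> FF ul; elim: s => [|i s IH].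
  by under eq_fun do rewrite big_nil; rewrite big_nil; exact: cvg_cst.
by under eq_fun do rewrite big_cons; rewrite big_cons; exact: cvgD.
Qed.

(** * From bumps to all test functions *)

Section BumpIntegral.
Context {R : realType}.
Implicit Types (c z : R[i]) (nu : probC R).

Lemma bump_nm_continuous c r : 0 < r -> nm_continuous (log_bump c r).
Proof.
move=> r0 z e e0; exists (e * r / 2) => [|w zw]; first by rewrite divr_gt0 // mulr_gt0.
apply: le_lt_trans (bump_lip c z w r0) _.
rewrite ltr_pdivrMr //; lra.
Qed.

Lemma measurable_bump c r : 0 < r -> measurable_fun setT (log_bump c r : borelC R -> R).
Proof. by move=> r0; apply: nm_continuous_measurable; exact: bump_nm_continuous. Qed.

Lemma norm_bump c r z : 0 < r -> `|log_bump c r z| <= ln 2.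
Proof. by move=> r0; rewrite ger0_norm ?bump_ge0 ?bump_le_ln2. Qed.

Lemma integrable_bump nu c r : 0 < r -> nu.-integrable setT (EFin \o (log_bump c r : borelC R -> R)).
Proof.
move=> r0; have mb := measurable_bump c r0.
exact: (@bounded_integrable R _ _ nu _ _ mb (fun z => norm_bump c z r0)).
Qed.

Lemma measurable_test (f : test_function R) : measurable_fun setT (f : borelC R -> R).
Proof. by apply: nm_continuous_measurable; exact: test_nm_continuous. Qed.

Lemma integrable_test nu (f : test_function R) :
  nu.-integrable setT (EFin \o (f : borelC R -> R)).
Proof.
have [B _ fB] := test_bounded f.
exact: (bounded_integrable _ (measurable_test f) fB).
Qed.

(** All parameters are natural numbers: almost sure statements about this family involve only
    countably many null sets. *)
Definition bump_integral nu k m p (i j : nat) : R :=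
  let r : R := k.+1%:R^-1 in \int[nu]_z log_bump (grid (r / m.+1%:R) p i j) r z.

(** A three-epsilon argument: the uniform approximation has the same error for all probability
    measures. With an arbitrary filter it serves both for almost sure convergence and for
    convergence in probability. *)
Lemma cvg_test_integral (T : Type) (F : set_system T) (nu : T -> probC R) (nu0 : probC R)
    (f : test_function R) : Filter F ->
  (forall k m p i j, bump_integral (nu t) k m p i j @[t --> F] --> bump_integral nu0 k m p i j) ->
  test_integral (nu t) f @[t --> F] --> test_integral nu0 f.
Proof.
move=> FF cb; have [B B0 fB] := test_bounded f; have [L L0 fL] := test_support_bounded f.
apply/cvgrPdist_lt => e e0.
have e3 : 0 < e / 3 by rewrite divr_gt0.
have [k [m [p [M [a]]]]] :=
  log_bump_approximation (ltW B0) L0 fB fL (test_unif_continuous f) e3.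
move=> /=; set r : R := k.+1%:R^-1; set h := r / _ => fa.
have r0 : 0 < r by rewrite invr_gt0.
pose g z : R := \sum_(i < M) \sum_(j < M) a i j * log_bump (grid h p i j) r z.
pose I nu := \sum_(i < M) \sum_(j < M) a i j * bump_integral nu k m p i j.
have ib nu1 (i j : nat) :
    nu1.-integrable setT (EFin \o (fun z : borelC R => a i j * log_bump (grid h p i j) r z)).
  have := integrableZl measurableT (a i j) (integrable_bump nu1 (grid h p i j) r0).
  exact: eq_integrable.
have ig nu1 : nu1.-integrable setT (EFin \o (g : borelC R -> R)).
  by apply: integrable_EFin_sum => // i; apply: integrable_EFin_sum => // j; exact: ib.
have gI nu1 : \int[nu1]_z g z = I nu1.
  rewrite Rintegral_bigsum // => [|i]; last by apply: integrable_EFin_sum => // j; exact: ib.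
  apply: eq_bigr => i _; rewrite Rintegral_bigsum // => [|j]; last exact: ib.
  apply: eq_bigr => j _; rewrite RintegralZl //; exact: integrable_bump.
have fI nu1 : `|test_integral nu1 f - I nu1| <= e / 3.
  have itf := integrable_test nu1 f.
  rewrite -gI /test_integral -(RintegralB measurableT itf (ig nu1)).
  have ifg : nu1.-integrable setT (EFin \o (fun z : borelC R => f z - g z)).
    have := integrableB measurableT (integrable_test nu1 f) (ig nu1).
    exact: eq_integrable.
  apply: le_trans (le_normr_Rintegral measurableT ifg) _.
  rewrite -[leRHS](Rintegral_cstT nu1); apply: le_Rintegral => //.
  - exact: (integrable_norm ifg).
  - exact: finite_measure_integrable_cst.
have cI : I (nu t) @[t --> F] --> I nu0.
  rewrite /I; apply: cvg_finsum => i; apply: cvg_finsum => j.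
  by apply: cvgMr; exact: cb.
move/cvgrPdist_lt: cI => /(_ _ e3); apply: filterS => t It.
have := fI nu0; have := fI (nu t); move: It; rewrite !ltr_norml !ler_norml; lra.
Qed.

End BumpIntegral.

(** * Almost sure convergence of the zeros *)

Section AlmostSure.
Context {R : realType} (mu : probability (borelC R) R).
Context d (Omega : measurableType d) (P : probability Omega R).
Context (X : nat -> {RV P >-> borelC R}) (hX : iid mu X).

Definition sample n w : seq R[i] := [seq (X i w : R[i]) | i <- iota 0 n].

Lemma size_sample n w : size (sample n w) = n.
Proof. by rewrite size_map size_iota. Qed.

Lemma random_polyE n w : random_poly X n w = \prod_(x <- sample n w) ('X - x%:P).
Proof.
rewrite /random_poly big_map -(big_mkord xpredT (fun i => 'X - (X i w : R[i])%:P)).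
by rewrite /index_iota subn0.
Qed.

Lemma sum_sample (h : R[i] -> R) n w : \sum_(x <- sample n w) h x = partial_sum X (h : borelC R -> R) n w.
Proof. by rewrite /partial_sum big_map -(big_mkord xpredT (fun i => h (X i w))) /index_iota subn0. Qed.

Lemma random_poly_integral n w (h : R[i] -> R) : (0 < n)%N ->
  measurable_fun setT (h : borelC R -> R) ->
  \int[zero_measure (random_poly X n w)]_z h z = partial_sum X (h : borelC R -> R) n w / n%:R.
Proof.
move=> n0 mh; have pz := zeros_prod (sample n w).
have sz : size (zeros (random_poly X n w)) = n.
  by rewrite random_polyE (perm_size pz) size_sample.
rewrite zero_measure_integral ?sz // mulrC -sum_sample; congr (_ / _).
by rewrite random_polyE; exact: perm_big.
Qed.

Lemma partial_sumB (h : borelC R -> R) (c : R) n w :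
  partial_sum X (fun z => h z - c) n w = partial_sum X h n w - n%:R * c.
Proof. by rewrite /partial_sum sumrB sumr_const card_ord mulr_natl. Qed.

Lemma lln_bounded_prep (h : borelC R -> R) (D : R) : measurable_fun setT h ->
  (forall z, `|h z| <= D) ->
  let g z := h z - \int[mu]_x h x in
  [/\ measurable_fun setT g, forall z, `|g z| <= D + `|\int[mu]_x h x| & \int[mu]_z g z = 0].
Proof.
move=> mh hD g; split.
- by apply: measurable_funB => //; exact: measurable_cst.
- by move=> z; apply: le_trans (ler_normB _ _) _; rewrite lerD2r.
- have ih := bounded_integrable mu mh hD.
  rewrite /g RintegralB //; last exact: finite_measure_integrable_cst.
  by rewrite Rintegral_cstT subrr.
Qed.

Lemma sample_mean_as (h : borelC R -> R) (D : R) : measurable_fun setT h ->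
  (forall z, `|h z| <= D) ->
  {ae P, forall w, partial_sum X h n w / n%:R @[n --> \oo] --> \int[mu]_x h x}.
Proof.
move=> mh hD; have [mg gD g0] := lln_bounded_prep mh hD.
have := partial_sum_lln_as hX mg gD g0; apply: filterS => w H.
have {}H : partial_sum X (fun z => h z - \int[mu]_x h x) n w / n%:R + \int[mu]_x h x
    @[n --> \oo] --> \int[mu]_x h x.
  by rewrite -[X in _ --> X]add0r; exact: cvgD H (cvg_cst _).
apply: cvg_trans H; apply: near_eq_cvg; near=> n.
rewrite /= partial_sumB mulrBl -[_ * _ / n%:R]mulrAC divff ?mul1r ?addrA ?subrK //.
by rewrite pnatr_eq0 -lt0n; near: n; exact: nbhs_infty_gt.
Unshelve. all: by end_near. Qed.

(** The null sets of the countably many bumps are merged before a test function is chosen, so that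
    one null set serves for all test functions. *)
Lemma random_poly_cvg_as : weak_cvg_as P (fun n w => zero_measure (random_poly X n w)) mu.
Proof.
have H : {ae P, forall w, forall k m p i j : nat,
    bump_integral (zero_measure (random_poly X n w)) k m p i j @[n --> \oo] --> bump_integral mu k m p i j}.
  apply: ae_foralln => k; apply: ae_foralln => m; apply: ae_foralln => p.
  apply: ae_foralln => i; apply: ae_foralln => j.
  rewrite /bump_integral; set r : R := k.+1%:R^-1; set c := grid _ _ _ _.
  have r0 : 0 < r by rewrite invr_gt0.
  have := sample_mean_as (measurable_bump c r0) (fun z => norm_bump c z r0).
  apply: filterS => w; apply: cvg_trans; apply: near_eq_cvg; near=> n.
  rewrite /= random_poly_integral //; last exact: measurable_bump.
  by near: n; exact: nbhs_infty_gt.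
apply: filterS H => w H f; exact: cvg_test_integral.
Unshelve. all: by end_near. Qed.

End AlmostSure.

(** A neighbourhood in the initial topology contains the preimage of an open set of the product, and
    convergence in the product is convergence of every coordinate. *)
Lemma weak_topC_near {R : realType} (T : Type) (F : set_system T) (nu : T -> probC R) (nu0 : probC R) :
  Filter F ->
  (forall f : test_function R, test_integral (nu t) f @[t --> F] --> test_integral nu0 f) ->
  forall N : set (weak_topC R), nbhs (nu0 : weak_topC R) N -> \forall t \near F, N (nu t).
Proof.
move=> FF H N [_ [[B oB <-] /= Bmu BN]].
have cB : (fun t => @test_integral R (nu t) : prod_topology (fun _ : test_function R => R)) t @[t --> F]
    --> (@test_integral R nu0 : prod_topology (fun _ : test_function R => R)).
  apply/cvg_sup => f A [_ [[C oC <-] /= Cmu CA]].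
  have : nbhs (test_integral nu0 f) C by apply: open_nbhs_nbhs.
  move=> /(H f) HC; have {}HC : F [set t | C (test_integral (nu t) f)] by exact: HC.
  by apply: (@filterS _ F _ _ [set t | A (@test_integral R (nu t))] _ HC) => t; exact: CA.
have : nbhs (@test_integral R nu0 : prod_topology (fun _ : test_function R => R)) B.
  exact: open_nbhs_nbhs.
move=> /cB HB; have {}HB : F [set t | B (@test_integral R (nu t))] by exact: HB.
by apply: (@filterS _ F _ [set t | B (@test_integral R (nu t))] [set t | N (nu t)] _ HB) => t; exact: BN.
Qed.

(** * Convergence in probability of the critical points *)

Section InProbability.
Context {R : realType} d (Omega : measurableType d) (P : probability Omega R).

(** Convergence along this filter on the pairs (n, w) is convergence in probability as n tends to
    infinity, which makes the library of limits available for it. *)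
Definition in_prob : set_system (nat * Omega) := [set A | forall e : R, 0 < e ->
  \forall n \near \oo, exists B : set Omega,
    [/\ measurable B, B `<=` [set w | A (n, w)] & (P (~` B) <= e%:E)%E]].

Global Instance in_prob_filter : Filter in_prob.
Proof.
split=> [|A B HA HB|A B AB HA].
- move=> e e0; near=> n; exists setT; split => //.
  by rewrite setCT measure0 lee_fin ltW.
- move=> e e0; have e2 : 0 < e / 2 by rewrite divr_gt0.
  have := HA _ e2; have := HB _ e2; apply: filterS2 => n [B' [mB' sB' PB']] [A' [mA' sA' PA']].
  exists (A' `&` B'); split; first exact: measurableI.
    by move=> w [/sA' Aw /sB' Bw]; split.
  rewrite setCI; apply: le_trans (measureU2 _ _ _) _; try exact: measurableC.
  by rewrite [leRHS](_ : _ = (e / 2)%:E + (e / 2)%:E)%E ?leeD // -EFinD -splitr.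
- move=> e /HA; apply: filterS => n [A' [mA' sA' PA']].
  by exists A'; split=> // w /sA' /AB.
Unshelve. all: by end_near. Qed.

Lemma cvg_in_prob_fst : p.1 @[p --> in_prob] --> \oo.
Proof.
move=> A [N _ NA] e e0; exists N => // n /= Nn; exists setT; split => //.
  by move=> w _; apply: NA.
by rewrite setCT measure0 lee_fin ltW.
Qed.

Lemma in_prob_cvg0 (E : nat -> set Omega) : (forall n, measurable (E n)) ->
  fine (P (E n)) @[n --> \oo] --> (0 : R) -> \forall p \near in_prob, ~ E p.1 p.2.
Proof.
move=> mE cE e e0; have /cvgr0_norm_le := cE.
move=> /(_ e e0); apply: filterS => n En.
exists (~` E n); split => //; first exact: measurableC.
rewrite setCK -[leLHS]fineK ?fin_num_measure // lee_fin.
by apply: le_trans En; exact: ler_norm.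
Qed.

(** The measurable sets that [in_prob] provides compete in the supremum defining [inner_prob]. *)
Lemma in_prob_inner_prob (A : set (nat * Omega)) : in_prob A ->
  inner_prob P [set w | A (n, w)] @[n --> \oo] --> 1%E.
Proof.
move=> HA.
have le1 n : (inner_prob P [set w | A (n, w)] <= 1)%E.
  by apply: ge_ereal_sup => _ [B [mB _] <-]; exact: probability_le1.
have ge0 n : (0 <= inner_prob P [set w | A (n, w)])%E.
  by apply: ereal_sup_ubound; exists set0; [split => //|rewrite measure0].
have fin n : inner_prob P [set w | A (n, w)] \is a fin_num.
  by rewrite ge0_fin_numE // (le_lt_trans (le1 n)) // ltry.
apply/fine_cvgP; split; first by near=> n; exact: fin.
apply/cvgrPdist_le => e e0; have := HA e e0; apply: filterS => n [B [mB sB PB]].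
have h1 : fine (inner_prob P [set w | A (n, w)]) <= 1 by rewrite -lee_fin fineK.
have h2 : 1 - e <= fine (inner_prob P [set w | A (n, w)]).
  rewrite -lee_fin fineK //; apply: (@le_trans _ _ (P B)).
    have := probability_setC P mB; rewrite /=.
    rewrite -(fineK (fin_num_measure P _ mB)) -EFinB => h.
    by move: PB; rewrite h !lee_fin; lra.
  by apply: ereal_sup_ubound; exists B.
rewrite ger0_norm /=; lra.
Unshelve. all: by end_near. Qed.

Lemma weak_cvg_in_probP (nu : nat -> Omega -> probC R) (nu0 : probC R) :
  (forall f : test_function R,
    test_integral (nu p.1 p.2) f @[p --> in_prob] --> test_integral nu0 f) ->
  weak_cvg_in_prob P nu nu0.
Proof.
move=> H N N0; apply: (@in_prob_inner_prob (fun p => N (nu p.1 p.2))).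
exact: (weak_topC_near _ H).
Qed.

End InProbability.

Lemma markov_ge0 {R : realType} d (Omega : measurableType d) (P : {measure set Omega -> \bar R})
    (Y : Omega -> \bar R) (K a : R) : measurable_fun setT Y -> (forall w, (0 <= Y w)%E) ->
  (\int[P]_w Y w <= K%:E)%E -> 0 < a -> (P [set w | a%:E <= Y w] <= (K / a)%:E)%E.
Proof.
move=> mY Y0 YK a0; have := @le_integral_abse _ _ R P setT measurableT _ _ mY a0.
under eq_integral do rewrite gee0_abs //.
move=> /le_trans /(_ YK).
have -> : setT `&` [set x | (a%:E <= `|Y x|)%E] = [set w | (a%:E <= Y w)%E].
  by rewrite setTI; apply/seteqP; split => w /=; rewrite gee0_abs.
rewrite muleC; move: (P _) => [p||] //=.
- by rewrite -EFinM !lee_fin ler_pdivlMr.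
- by rewrite gt0_mulye ?lte_fin // leye_eq.
- by rewrite leNye.
Qed.

(** * From fixed points to whole circles *)

Section SectionMeasure.
Context {R : realType} d (Omega : measurableType d) (P : probability Omega R).
Local Notation leb := (@lebesgue_measure R).
Local Notation I01 := (`[0, 1[%classic : set R).

(** By Tonelli the expected length of the sections is the integral over [t] of the probabilities,
    which tends to 0 by dominated convergence with the indicator of [I01] as majorant. Markov's
    inequality concludes. *)
Lemma section_measure_cvg0 (S : nat -> set (Omega * R)) (e : R) :
  (forall n, measurable (S n)) -> (forall n w t, S n (w, t) -> I01 t) ->
  (forall t, fine (P (ysection (S n) t)) @[n --> \oo] --> 0) -> 0 < e ->
  fine (P [set w | (e%:E <= leb (xsection (S n) w))%E]) @[n --> \oo] --> 0.
Proof.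
move=> mS S01 St e0; pose phi n t := P (ysection (S n) t).
have mphi n : measurable_fun setT (phi n) by exact: measurable_fun_ysection.
have mpsi n : measurable_fun setT (fun w => leb (xsection (S n) w)).
  exact: (measurable_fun_xsection leb (mS n)).
have tonelli n : (\int[P]_w leb (xsection (S n) w) = \int[leb]_t phi n t)%E.
  transitivity (\int[P]_w fubini_F leb (EFin \o \1_(S n)) w)%E.
    apply: eq_integral => w _; have := indic_fubini_tonelli_FE leb (mS n).
    by move=> /(congr1 (fun h => h w)) /= <-.
  transitivity (\int[leb]_t fubini_G P (EFin \o \1_(S n)) t)%E.
    exact: (indic_fubini_tonelli P leb (mS n)).
  apply: eq_integral => t _; have := indic_fubini_tonelli_GE P (mS n).
  by move=> /(congr1 (fun h => h t)) /= ->.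
have phi_le n t : (`|phi n t| <= (\1_I01 t)%:E)%E.
  rewrite gee0_abs ?measure_ge0 // indicE; have [tI|tI] := boolP (t \in I01).
    by apply: probability_le1; exact: measurable_ysection.
  rewrite /phi (_ : ysection _ _ = set0) ?measure0 //.
  apply/seteqP; split => // w; rewrite /ysection /= inE => /S01 It.
  by move: tI; rewrite (mem_set It).
have phi0 t : phi n t @[n --> \oo] --> 0%E.
  apply/fine_cvgP; split; last exact: St.
  by near=> n; apply: fin_num_measure; exact: measurable_ysection.
have cphi : (\int[leb]_t phi n t)%E @[n --> \oo] --> (\int[leb]_t (cst 0 t))%E.
  have [||_ _ //] := @dominated_convergence _ _ _ leb setT measurableT phi (cst 0%E)
    (fun t => (\1_I01 t)%:E) mphi (measurable_cst _) _ (integrable_indic_itv _ _ _ _).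
    by apply: aeW => t _; exact: phi0.
  by apply: aeW => t n _; exact: phi_le.
rewrite integral0 in cphi; move/fine_cvgP: cphi => [fin cphi].
apply: (@squeeze_cvgr _ _ _ _ (fun=> 0) (fun n => fine (\int[leb]_t phi n t)%E / e)); last 2 first.
- exact: cvg_cst.
- by rewrite -[X in _ --> X](mul0r e^-1); apply: cvgMl.
near=> n; rewrite fine_ge0 //=.
have fn : (\int[leb]_t phi n t)%E \is a fin_num by near: n.
have := @markov_ge0 R _ _ P _ (fine (\int[leb]_t phi n t)%E) e (mpsi n) (fun w => measure_ge0 _ _) _ e0.
rewrite tonelli fineK // => /(_ (lexx _)).
have mE : measurable [set w | (e%:E <= leb (xsection (S n) w))%E].
  by rewrite -[X in measurable X]setTI; exact: emeasurable_fun_c_infty.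
by move=> H; rewrite -lee_fin fineK ?fin_num_measure //; exact: H.
Unshelve. all: by end_near. Qed.

End SectionMeasure.

(** * Dichotomy between spread and almost everywhere constant functions *)

Section AeConstant.
Context {R : realType} d (T : measurableType d) (mu : probability T R).

Lemma not_ae_false : ~ {ae mu, forall x : T, False}.
Proof.
move=> [N [mN N0 sN]]; have NT : N = setT by apply/seteqP; split => // x _; apply: sN => /=.
have := @probability_setT _ _ _ mu; rewrite -NT => N1.
have : (0%E : \bar R) = 1%E by rewrite -N1 -N0.
by move/eqP; rewrite eqe eq_sym oner_eq0.
Qed.

(** The value is the infimum of the levels below which h has positive mass. *)
Lemma spread_or_ae_constant (h : T -> R) : measurable_fun setT h ->
  (exists a delta s : R, [/\ 0 < delta, 0 < s, (s%:E <= mu [set x | (h x <= a)%R])%E &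
     (s%:E <= mu [set x | (a + delta <= h x)%R])%E]) \/
  exists v, {ae mu, forall x, h x = v}.
Proof.
move=> mh.
have mle a : measurable [set x | h x <= a].
  have := mh measurableT _ (measurable_itv `]-oo, a]).
  by rewrite setTI; congr measurable; apply/funext => w; rewrite /= in_itv.
have mge a : measurable [set x | a <= h x].
  have := mh measurableT _ (measurable_itv `[a, +oo[).
  by rewrite setTI; congr measurable; apply/funext => w; rewrite /= in_itv /= andbT.
pose lo a := fine (mu [set x | h x <= a]); pose hi a := fine (mu [set x | a <= h x]).
have lo0 a : 0 <= lo a by rewrite fine_ge0.
have hi0 a : 0 <= hi a by rewrite fine_ge0.
have loE a : mu [set x | h x <= a] = (lo a)%:E by rewrite fineK // fin_num_measure.
have hiE a : mu [set x | a <= h x] = (hi a)%:E by rewrite fineK // fin_num_measure.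
have lo_ae a : lo a = 0 -> {ae mu, forall x, a < h x}.
  move=> l0; exists [set x | h x <= a]; split => //; first by rewrite loE l0.
  by move=> x /= /negP; rewrite -leNgt.
have hi_ae a : hi a = 0 -> {ae mu, forall x, h x < a}.
  move=> l0; exists [set x | a <= h x]; split => //; first by rewrite hiE l0.
  by move=> x /= /negP; rewrite -leNgt.
case: (pselect (exists a delta, [/\ 0 < delta, 0 < lo a & 0 < hi (a + delta)])).
  move=> [a [delta [d0 l0 h0]]]; left; exists a, delta, (Num.min (lo a) (hi (a + delta))).
  by split=> //; rewrite ?loE ?hiE ?lee_fin ?lt_min ?l0 ?ge_min ?lexx ?orbT.
move=> /forallNP H; right.
have {}H a b : a < b -> lo a = 0 \/ hi b = 0.
  move=> ab; have := H a => /forallNP /(_ (b - a)) Hab.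
  have := lo0 a; rewrite le_eqVlt => /orP[/eqP <-|la]; first by left.
  have := hi0 b; rewrite le_eqVlt => /orP[/eqP <-|hb]; first by right.
  by exfalso; apply: Hab; split => //; rewrite ?subr_gt0 // addrC subrK.
pose A := [set a | 0 < lo a].
(* Otherwise [h] would exceed every integer almost everywhere. *)
have A0 : A !=set0.
  apply: contrapT => /forallNP nA; apply: not_ae_false.
  have : {ae mu, forall x, forall n : nat, n%:R < h x}.
    apply: ae_foralln => n; apply: lo_ae; apply/eqP.
    by rewrite eq_le lo0 andbT leNgt; apply/negP => /nA.
  apply: filterS => x Hx; have := Hx (Num.bound `|h x|).
  have /(le_lt_trans (ler_norm (h x))) := archi_boundP (normr_ge0 (h x)).
  by move=> /lt_trans h1 /h1; rewrite ltxx.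
have [m hm] : exists m : nat, 0 < hi (- m%:R).
  apply: contrapT => /forallNP nA; apply: not_ae_false.
  have : {ae mu, forall x, forall n : nat, h x < - n%:R}.
    apply: ae_foralln => n; apply: hi_ae; apply/eqP.
    by rewrite eq_le hi0 andbT leNgt; apply/negP => /nA.
  apply: filterS => x Hx; have := Hx (Num.bound `|h x|).
  have : - `|h x| <= h x by rewrite lerNl -normrN ler_norm.
  have := archi_boundP (normr_ge0 (h x)); lra.
have Alb : lbound A (- m%:R).
  move=> a la; rewrite leNgt; apply/negP => /H[] h0.
    by move: la; rewrite /A /= h0 ltxx.
  by move: hm; rewrite h0 ltxx.
have infA : has_inf A by split => //; exists (- m%:R).
exists (inf A).
(* Some level just above the infimum has positive mass below it, so by [H] there is no mass further
   up. *)
have le_ae : {ae mu, forall x, forall k : nat, h x < inf A + k.+1%:R^-1}.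
  apply: ae_foralln => k; apply: hi_ae.
  have k0 : 0 < k.+1%:R^-1 :> R by rewrite invr_gt0.
  have [a /= la /H[]//] := inf_adherent k0 infA.
  by move=> l0; move: la; rewrite /A /= l0 ltxx.
have ge_ae : {ae mu, forall x, forall k : nat, inf A - k.+1%:R^-1 < h x}.
  apply: ae_foralln => k; apply: lo_ae; apply/eqP; rewrite eq_le lo0 andbT leNgt.
  have k0 : 0 < k.+1%:R^-1 :> R by rewrite invr_gt0.
  apply/negP => la; have : inf A <= inf A - k.+1%:R^-1 by apply: ge_inf infA.2 _ la.
  by rewrite leNgt ltrBlDr ltrDl k0.
apply: filterS2 le_ae ge_ae => x h1 h2; apply/eqP; rewrite eq_le; apply/andP; split.
  by rewrite leNgt; apply/negP => /ltr_add_invr[k]; rewrite ltNge (ltW (h1 k)).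
by rewrite leNgt; apply/negP => /ltr_add_invr[k]; rewrite -ltrBrDr ltNge (ltW (h2 k)).
Qed.

End AeConstant.

Section SmallMeasure.
Context {R : realType} (mu : probability (borelC R) R).
Context d (Omega : measurableType d) (P : probability Omega R).
Context (X : nat -> {RV P >-> borelC R}) (hX : iid mu X).

(** Composition with [f] covers both a fixed [z] and joint measurability in the sample point and the
    circle parameter, which Tonelli's theorem requires. *)
Lemma cmeas_logderiv_sample d' (U : measurableType d') n (f : U -> Omega) (z : U -> R[i]) :
  measurable_fun setT f -> cmeas z ->
  cmeas (fun u => logderiv (sample X n (f u)) (z u)).
Proof.
move=> mf mz.
rewrite (_ : (fun u => _) = fun u => \sum_(i <- iota 0 n) (z u - (X i (f u) : R[i]))^-1); last first.
  by apply/funext => u; rewrite /logderiv /sample big_map.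
apply: cmeas_sum => i; apply: cmeasV; apply: cmeasB => //.
apply: (@cmeas_comp _ _ (borelC R) _ _ (fun x => x : R[i]) (fun u => X i (f u))); first exact: cmeas_id.
exact: measurableT_comp.
Qed.

Lemma measurable_small_logderiv_sample n z :
  measurable [set w | nm (logderiv (sample X n w) z) < n%:R^-1].
Proof.
have m : measurable_fun setT (fun w => nm (logderiv (sample X n w) z)).
  apply: cmeas_nm; apply: (@cmeas_logderiv_sample _ Omega n id (fun=> z)).
    exact: measurable_id.
  exact: cmeas_cst.
have := m measurableT _ (measurable_itv `]-oo, n%:R^-1[).
by rewrite setTI; congr measurable; apply/funext => w; rewrite /= in_itv.
Qed.

(** To be applied with [h x] the real or the imaginary part of [(z - x)^-1], whose partial sums are
    the corresponding part of [logderiv]. *)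
Lemma logderiv_dominated (z : R[i]) (h : R[i] -> R) (a delta s : R) :
  measurable_fun setT (h : borelC R -> R) ->
  (forall n w, `|partial_sum X (h : borelC R -> R) n w| <= nm (logderiv (sample X n w) z)) ->
  0 < delta -> 0 < s -> (s%:E <= mu [set x | (h x <= a)%R])%E ->
  (s%:E <= mu [set x | (a + delta <= h x)%R])%E ->
  fine (P [set w | nm (logderiv (sample X n w) z) < n%:R^-1]) @[n --> \oo] --> 0.
Proof.
move=> mh hle d0 s0 sA sB; have ac := anticoncentration hX mh d0 s0 sA sB.
apply: (@squeeze_cvgr _ _ _ _ (fun=> 0)
  (fun n => fine (P [set w | `|partial_sum X (h : borelC R -> R) n w| < n%:R^-1])));
  last 2 first.
- exact: cvg_cst.
- exact: ac.
near=> n; rewrite fine_ge0 //=.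
have mA := measurable_small_logderiv_sample n z.
have mB : measurable [set w | `|partial_sum X (h : borelC R -> R) n w| < n%:R^-1].
  have m : measurable_fun setT (fun w => `|partial_sum X (h : borelC R -> R) n w|).
    by apply: measurableT_comp => //; exact: measurable_partial_sum.
  have := m measurableT _ (measurable_itv `]-oo, n%:R^-1[).
  by rewrite setTI; congr measurable; apply/funext => w; rewrite /= in_itv.
rewrite -lee_fin !fineK ?fin_num_measure //; apply: le_measure; rewrite ?inE // => w /=.
by apply: le_lt_trans.
Unshelve. all: by end_near. Qed.

(** If both coordinates of [(z - x)^-1] are almost everywhere constant, so is [x], because inversion
    is an involution, also at [x = z] where the inverse has the default value 0. *)
Lemma small_logderiv_or_dirac :
  (forall z, fine (P [set w | nm (logderiv (sample X n w) z) < n%:R^-1]) @[n --> \oo] --> 0) \/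
  exists x0 : R[i], {ae mu, forall x : borelC R, (x : R[i]) = x0}.
Proof.
case: (pselect (exists x0 : R[i], {ae mu, forall x : borelC R, (x : R[i]) = x0})); first by right.
move=> ndirac; left => z.
have [mRe mIm] : cmeas (fun x : borelC R => (z - (x : R[i]))^-1).
  by apply: cmeasV; apply: cmeasB; [exact: cmeas_cst | exact: cmeas_id].
have sumE (f : {additive R[i] -> R}) n w :
    partial_sum X (fun x : borelC R => f (z - (x : R[i]))^-1) n w = f (logderiv (sample X n w) z).
  by rewrite -(sum_sample X (fun x => f (z - x)^-1)) /logderiv raddf_sum.
have [[a [de [s [d0 s0 sA sB]]]]|[u hu]] := spread_or_ae_constant mu mRe.
  apply: (logderiv_dominated mRe _ d0 s0 sA sB) => n w.
  by rewrite (sumE (@complex.Re R)) nm_Re_le.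
have [[a [de [s [d0 s0 sA sB]]]]|[v hv]] := spread_or_ae_constant mu mIm.
  apply: (logderiv_dominated mIm _ d0 s0 sA sB) => n w.
  by rewrite (sumE (@complex.Im R)) nm_Im_le.
exfalso; apply: ndirac; exists (z - (u +i* v)^-1).
apply: filterS2 hu hv => x <- <-.
have -> : complex.Re (z - (x : R[i]))^-1 +i* complex.Im (z - (x : R[i]))^-1 = (z - (x : R[i]))^-1.
  by case: (_^-1).
by rewrite invrK opprB addrC subrK.
Qed.

Lemma small_measure_in_prob c r :
  (forall z, fine (P [set w | nm (logderiv (sample X n w) z) < n%:R^-1]) @[n --> \oo] --> 0) ->
  small_measure (sample X p.1 p.2) c r @[p --> in_prob P] --> 0.
Proof.
move=> Hz.
(* Sections of [S n] at a parameter lie in the events controlled by [Hz]; sections at a sample point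
   are the exceptional arcs. *)
pose S n : set (Omega * R) := (setT `*` `[0, 1[%classic) `&`
  [set p | nm (logderiv (sample X n p.1) (circle c r p.2)) < n%:R^-1].
have mS n : measurable (S n).
  apply: measurableI; first exact: measurableX.
  have m : measurable_fun setT (fun p : Omega * R => nm (logderiv (sample X n p.1) (circle c r p.2))).
    apply: cmeas_nm; apply: cmeas_logderiv_sample; first exact: measurable_fst.
    by apply: (@cmeas_comp _ _ _ _ _ (circle c r) snd); [exact: cmeas_circle | exact: measurable_snd].
  have := m measurableT _ (measurable_itv `]-oo, n%:R^-1[).
  by rewrite setTI; congr measurable; apply/funext => w; rewrite /= in_itv.
have S01 n w t : S n (w, t) -> (`[0, 1[%classic : set R) t by move=> [[_ ]].
have St t : fine (P (ysection (S n) t)) @[n --> \oo] --> 0.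
  apply: (@squeeze_cvgr _ _ _ _ (fun=> 0)
    (fun n => fine (P [set w | nm (logderiv (sample X n w) (circle c r t)) < n%:R^-1]))); last 2 first.
  - exact: cvg_cst.
  - exact: Hz.
  near=> n; rewrite fine_ge0 //= -lee_fin.
  have mA := measurable_small_logderiv_sample n (circle c r t).
  have mB : measurable (ysection (S n) t) by exact: measurable_ysection.
  rewrite !fineK ?fin_num_measure //; apply: le_measure; rewrite ?inE // => w.
  by rewrite /ysection /= inE => -[].
have smE n w : small_measure (sample X n w) c r = fine (lebesgue_measure (xsection (S n) w)).
  rewrite /small_measure size_sample; congr (fine (lebesgue_measure _)).
  apply/seteqP; split => t /=; rewrite /xsection /= inE.
    by move=> [It Nt].
  by move=> [[_ It] Nt].
apply/cvgr0Pnorm_lt => e e0.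
have mE n : measurable [set w | (e%:E <= lebesgue_measure (xsection (S n) w))%E].
  rewrite -[X in measurable X]setTI; apply: emeasurable_fun_c_infty => //.
  exact: (measurable_fun_xsection (@lebesgue_measure R) (mS n)).
have := in_prob_cvg0 mE (section_measure_cvg0 mS S01 St e0).
apply: (@filterS _ (in_prob P) (in_prob_filter P)) => -[n w] /= /negP; rewrite -ltNge smE => He.
rewrite ger0_norm ?fine_ge0 // -lte_fin fineK //.
by rewrite ge0_fin_numE // (lt_trans He) // ltry.
Unshelve. all: by end_near. Qed.

End SmallMeasure.

(** From [ln n = 2 * ln (sqrt n) < 2 * sqrt n]. *)
Lemma ln_natr_div_cvg0 (R : realType) : ln (n%:R : R) / n%:R @[n --> \oo] --> 0.
Proof.
apply/cvgr0Pnorm_lt => e e0; near=> n.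
have n0 : 0 < n%:R :> R by rewrite ltr0n; near: n; exact: nbhs_infty_gt.
have n1 : 1 <= n%:R :> R by rewrite ler1n; near: n; exact: nbhs_infty_gt.
have nbig : (2 / e) ^+ 2 < n%:R by near: n; exact: nbhs_infty_gtr.
rewrite ger0_norm; last by rewrite divr_ge0 ?ln_ge0.
set s := Num.sqrt (n%:R : R); have s0 : 0 < s by rewrite sqrtr_gt0.
have sE : s ^+ 2 = n%:R by rewrite sqr_sqrtr // ltW.
have es : 2 / e < s.
  by rewrite -(@ltr_pXn2r _ 2) ?nnegrE ?(ltW s0) ?sE // divr_ge0 // ltW.
rewrite ltr_pdivrMr // -sE lnXn //; have := ln_sublinear s0.
rewrite ltr_pdivrMr // in es; move: es s0 => es s0 ls.
rewrite expr2 mulrA mulr2n; apply: (@lt_le_trans _ _ (2 * s)); first by rewrite mulrDl mul1r ltrD.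
by rewrite ler_pM2r // mulrC ltW.
Unshelve. all: by end_near. Qed.

(** * Tight sequences of sample means *)

Section Tightness.
Context {R : realType} d (Omega : measurableType d) (P : probability Omega R).

Lemma in_prob_mul_tight (u v : nat * Omega -> R) :
  u p @[p --> in_prob P] --> 0 ->
  (forall e : R, 0 < e -> exists2 K : R, 0 < K &
    \forall n \near \oo, exists B : set Omega,
      [/\ measurable B, B `<=` [set w | `|v (n, w)| <= K] & (P (~` B) <= e%:E)%E]) ->
  u p * v p @[p --> in_prob P] --> 0.
Proof.
move=> u0 tv; apply/cvgr0Pnorm_lt => a a0 e e0.
have e2 : 0 < e / 2 by rewrite divr_gt0.
have [K K0 HK] := tv _ e2.
have aK : 0 < a / K by rewrite divr_gt0.
have Hu : \forall p \near in_prob P, `|u p| < a / K by move/cvgr0Pnorm_lt : u0; apply.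
have := Hu _ e2; apply: filterS2 HK => n [A [mA sA PA]] [B [mB sB PB]].
exists (A `&` B); split; first exact: measurableI.
  move=> w [/sA /= vK /sB /= uK]; rewrite normrM.
  have [v0|v0] := eqVneq `|v (n, w)| 0; first by rewrite v0 mulr0.
  apply: (@lt_le_trans _ _ (a / K * `|v (n, w)|)); first by rewrite ltr_pM2r // lt_def v0 /=.
  by rewrite -[leRHS](divfK (lt0r_neq0 K0)) ler_pM2l.
rewrite setCI; apply: le_trans (measureU2 _ _ _) _; try exact: measurableC.
by rewrite [leRHS](_ : _ = (e / 2)%:E + (e / 2)%:E)%E ?leeD // -EFinD -splitr.
Qed.

Context (mu : probability (borelC R) R) (X : nat -> {RV P >-> borelC R}) (hX : iid mu X).

(** Markov's inequality for a nonnegative mean of expectation at most [K1]; the 1 added to [K1]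
    keeps the threshold positive. Through this bound the logarithmic moment of [mu] controls the
    potential of the zeros. *)
Lemma sample_mean_tight (g : borelC R -> R) (K1 : R) : measurable_fun setT g ->
  (forall x, 0 <= g x) -> (\int[mu]_x (g x)%:E <= K1%:E)%E ->
  forall e : R, 0 < e -> exists2 K : R, 0 < K &
    \forall n \near \oo, exists B : set Omega,
      [/\ measurable B, B `<=` [set w | `|partial_sum X g n w / n%:R| <= K] &
        (P (~` B) <= e%:E)%E].
Proof.
move=> mg g0 gK e e0.
have mgE : measurable_fun setT (fun x => (g x)%:E) by exact/measurable_EFinP.
have K10 : 0 <= K1.
  by rewrite -lee_fin; apply: le_trans gK; apply: integral_ge0 => x _; rewrite lee_fin.
have K0 : 0 < (K1 + 1) / e by rewrite divr_gt0 // ltr_wpDl.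
exists ((K1 + 1) / e) => //; near=> n.
have n0 : 0 < n%:R :> R by rewrite ltr0n; near: n; exact: nbhs_infty_gt.
have S0 w : 0 <= partial_sum X g n w by apply: sumr_ge0.
have mS : measurable_fun setT (fun w => (partial_sum X g n w)%:E).
  by apply/measurable_EFinP; exact: measurable_partial_sum.
have ES : (\int[P]_w (partial_sum X g n w)%:E <= (n%:R * K1)%:E)%E.
  under eq_integral do rewrite -sumEFin.
  rewrite ge0_integral_sum //; last 2 first.
  - by move=> i; apply/measurable_EFinP; exact: measurableT_comp.
  - by move=> i w _; rewrite lee_fin.
  have E i : (\int[P]_w (g (X i w))%:E = \int[mu]_x (g x)%:E)%E.
    transitivity (\int[distribution P (X i)]_x (g x)%:E)%E.
      by rewrite ge0_integral_distribution // => x; rewrite lee_fin.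
    by apply: eq_measure_integral => A mA _; exact: hX.2.
  apply: (@le_trans _ _ (\sum_(i < n) K1%:E)%E).
    by apply: lee_sum => i _; rewrite E.
  by rewrite sumEFin sumr_const card_ord mulr_natl.
have a0 : 0 < n%:R * ((K1 + 1) / e) by rewrite mulr_gt0.
have PS := @markov_ge0 R _ _ P _ _ _ mS (fun w => S0 w) ES a0.
have mE : measurable [set w | ((n%:R * ((K1 + 1) / e))%:E <= (partial_sum X g n w)%:E)%E].
  by rewrite -[X in measurable X]setTI; exact: emeasurable_fun_c_infty.
exists (~` [set w | ((n%:R * ((K1 + 1) / e))%:E <= (partial_sum X g n w)%:E)%E]).
split; first exact: measurableC.
  move=> w /= /negP; rewrite lee_fin -ltNge => /ltW.
  by rewrite ger0_norm ?divr_ge0 ?(ltW n0) // ler_pdivrMr // mulrC.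
rewrite setCK; apply: le_trans PS _; rewrite lee_fin.
rewrite -mulf_div divff ?mul1r ?gt_eqF // invf_div mulrA ler_pdivrMr ?ltr_wpDl // mulrC.
by rewrite ler_pM2l // lerDl.
Unshelve. all: by end_near. Qed.

End Tightness.

(** * Potentials of the critical points, in probability *)

Section CriticalPoints.
Context {R : realType} (mu : probability (borelC R) R).
Context d (Omega : measurableType d) (P : probability Omega R).
Context (X : nat -> {RV P >-> borelC R}) (hX : iid mu X).

Definition critical_points n w : seq R[i] := zeros (random_poly X n w)^`().

Lemma critical_pointsP n w : (0 < n)%N -> size (critical_points n w) = n.-1 /\
  (\prod_(x <- sample X n w) ('X - x%:P))^`() =
    n%:R *: \prod_(z <- critical_points n w) ('X - z%:P).
Proof.
move=> n0; have := @deriv_prod_XsubC R (sample X n w).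
by rewrite size_sample -random_polyE; apply.
Qed.

Lemma critical_points_integral n w (h : R[i] -> R) : (1 < n)%N ->
  measurable_fun setT (h : borelC R -> R) ->
  \int[zero_measure (random_poly X n w)^`()]_z h z =
    (\sum_(z <- critical_points n w) h z) / n.-1%:R.
Proof.
move=> n1 mh; have [sz _] := critical_pointsP w (ltnW n1).
by rewrite zero_measure_integral -/(critical_points n w) ?sz 1?mulrC //; case: n n1 sz => [|[]].
Qed.

Lemma log_plusD_le (a t : R) : 0 <= a -> 0 <= t ->
  log_plus (a + t) <= ln (1 + a) + 1 + log_plus t.
Proof.
move=> a0 t0.
have h : a + t <= (1 + a) * (1 + t) by have := mulr_ge0 a0 t0; lra.
apply: (@le_trans _ _ (log_plus ((1 + a) * (1 + t)))).
  by apply: ler_log_plus h; rewrite addr_ge0.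
have a1 : 1 <= 1 + a by rewrite lerDl.
have t1 : 1 <= 1 + t by rewrite lerDl.
have -> : log_plus ((1 + a) * (1 + t)) = ln (1 + a) + ln (1 + t).
  rewrite /log_plus lnM ?posrE ?(lt_le_trans ltr01) //.
  by apply/max_idPl; rewrite addr_ge0 // ln_ge0.
by rewrite -addrA lerD2l -log_plus1D // log_plus_1D_le.
Qed.

Hypothesis hmu : (\int[mu]_z (log_plus (nm (z : R[i])))%:E < +oo)%E.

Lemma measurable_log_plus_nm (a : R) :
  measurable_fun setT (fun x : borelC R => log_plus (a + nm (x : R[i]))).
Proof.
apply: (measurableT_comp (@measurable_log_plus R)).
apply: measurable_funD; first exact: measurable_cst.
exact: (cmeas_nm (@cmeas_id R)).
Qed.

Lemma log_plus_mean_bound (a : R) : 0 <= a ->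
  exists K : R, (\int[mu]_x (log_plus (a + nm (x : R[i])))%:E <= K%:E)%E.
Proof.
move=> a0; pose C := ln (1 + a) + 1.
have C0 : 0 <= C by rewrite addr_ge0 // ln_ge0 // lerDl.
have m0 : measurable_fun setT (fun x : borelC R => log_plus (nm (x : R[i]))).
  have := measurable_log_plus_nm 0.
  by congr measurable_fun; apply/funext => x; rewrite add0r.
have I0 : (0 <= \int[mu]_z (log_plus (nm (z : R[i])))%:E)%E.
  by apply: integral_ge0 => z _; rewrite lee_fin log_plus_ge0.
exists (C + fine (\int[mu]_z (log_plus (nm (z : R[i])))%:E)%E).
rewrite EFinD fineK ?ge0_fin_numE //.
apply: (@le_trans _ _ (\int[mu]_x (C%:E + (log_plus (nm (x : R[i])))%:E))%E).
  apply: ge0_le_integral => //.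
  - by move=> x _; rewrite lee_fin log_plus_ge0.
  - by apply/measurable_EFinP; exact: measurable_log_plus_nm.
  - by apply/measurable_EFinP; apply: measurable_funD => //; exact: measurable_cst.
  - by move=> x _; rewrite -EFinD lee_fin log_plusD_le // nm_ge0.
rewrite ge0_integralD //; last 2 first.
- by move=> x _; rewrite lee_fin log_plus_ge0.
- exact/measurable_EFinP.
rewrite leeD2r // integral_cst // [X in (_ * X)%E](_ : _ = 1%E) ?mule1 //.
exact: probability_setT.
Qed.

(** The first alternative of [small_logderiv_or_dirac]. *)
Hypothesis small_prob : forall z,
  fine (P [set w | nm (logderiv (sample X n w) z) < n%:R^-1]) @[n --> \oo] --> 0.

Definition log_potential (r : R) (c : R[i]) (s : seq R[i]) : R :=
  \sum_(x <- s) ln (Num.max r (nm (x - c))).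

(** [critical_potential] divided by [n]. The parameter [M] depends on [e] and [r] but not on [n] and
    makes the contribution of the singularities less than [e / 2]; the other terms tend to 0, the
    potential of the zeros being tight and multiplied by [small_measure]. *)
Lemma log_potential_in_prob c r : 0 < r ->
  (ln p.1%:R + log_potential r c (critical_points p.1 p.2) -
     log_potential r c (sample X p.1 p.2)) / p.1%:R @[p --> in_prob P] --> 0.
Proof.
move=> r0; have a0 : 0 <= nm c + r by rewrite addr_ge0 ?nm_ge0 // ltW.
pose g (x : borelC R) := log_plus (nm c + r + nm (x : R[i])).
have [K gK] := log_plus_mean_bound a0.
have mg := measurable_log_plus_nm (nm c + r).
have tg := sample_mean_tight hX mg (fun x => log_plus_ge0 _) gK.
have sm0 := small_measure_in_prob c r small_prob.
have smg := in_prob_mul_tight sm0 (v := fun p => partial_sum X g p.1 p.2 / p.1%:R) tg.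
have cc0 : 0 < circ_const :> R.
  by rewrite /circ_const divr_gt0 // cos1_gt0.
apply/cvgr0Pnorm_lt => e e0.
(* From [expR (- M) < M^-1], this value gives [4 * circ_const * (expR (- M) / r) < e / 2]. *)
pose M := 8 * circ_const / (r * e).
have M0 : 0 < M by apply: divr_gt0; exact: mulr_gt0.
have Me : 4 * circ_const * (expR (- M) / r) < e / 2.
  have h : expR (- M) < M^-1.
    rewrite expRN ltf_pV2 ?posrE ?expR_gt0 //.
    by apply: lt_le_trans (expR_ge1Dx M); rewrite ltrDr.
  have -> : e / 2 = 4 * circ_const * (M^-1 / r).
    by rewrite /M; field; rewrite !gt_eqF.
  have c4 : 0 < 4 * circ_const :> R by exact: mulr_gt0.
  have ri : 0 < r^-1 by rewrite invr_gt0.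
  by rewrite (ltr_pM2l c4) (ltr_pM2r ri).
pose q (p : nat * Omega) := 2 * (ln p.1%:R / p.1%:R) + M * p.1%:R^-1 +
  (small_measure (sample X p.1 p.2) c r * (partial_sum X g p.1 p.2 / p.1%:R) +
   small_measure (sample X p.1 p.2) c r * M).
have q0 : q p @[p --> in_prob P] --> 0.
  have cl : (ln p.1%:R / p.1%:R : R) @[p --> in_prob P] --> 0.
    have := cvg_comp _ _ (cvg_in_prob_fst P) (@ln_natr_div_cvg0 R); exact.
  have iv : (n%:R : R)^-1 @[n --> \oo] --> 0.
    by apply/gtr0_cvgV0; [near=> n; rewrite ltr0n; near: n; exact: nbhs_infty_gt|exact: cvgr_idn].
  have cv : (p.1%:R : R)^-1 @[p --> in_prob P] --> 0.
    have := cvg_comp _ _ (cvg_in_prob_fst P) iv; exact.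
  rewrite -[X in _ --> X](_ : 2 * 0 + M * 0 + (0 + 0 * M) = 0 :> R); last by ring.
  apply: cvgD; first by apply: cvgD; apply: cvgMr.
  by apply: cvgD => //; apply: cvgMl.
have qe : \forall p \near in_prob P, `|q p| < e / 2.
  by move/cvgr0Pnorm_lt : q0; apply; rewrite divr_gt0.
have n2 : \forall p \near in_prob P, (1 < p.1)%N.
  exact: (cvg_in_prob_fst P (nbhs_infty_gt 1)).
apply: (@filterS2 _ _ (in_prob_filter P) _ _ _ _ qe n2) => -[n w] /= {}qe n1.
have [sz dP] := critical_pointsP w (ltnW n1).
have n0 : 0 < n%:R :> R by rewrite ltr0n ltnW.
have := @critical_potential R c r (sample X n w) (critical_points n w) M r0.
rewrite size_sample sz => /(_ n1 erefl (ltW M0) dP).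
rewrite -/(log_potential r c _) -/(log_potential r c _).
rewrite (sum_sample X (fun x => log_plus (nm c + r + nm x))) -/g => H.
rewrite normrM [`|_^-1|]gtr0_norm ?invr_gt0 // ltr_pdivrMr //.
apply: le_lt_trans H _.
have -> : 2 * ln n%:R + M + n%:R * (4 * circ_const * (expR (- M) / r)) +
  small_measure (sample X n w) c r * (partial_sum X g n w + n%:R * M) =
  (q (n, w) + 4 * circ_const * (expR (- M) / r)) * n%:R.
  by rewrite /q /=; field; rewrite !gt_eqF.
by rewrite ltr_pM2r //; move: qe Me; rewrite ltr_norml => /andP[_]; clear; lra.
Unshelve. all: by end_near. Qed.

Lemma log_bump_sumE (c : R[i]) r s : \sum_(x <- s) log_bump c r x =
  log_potential (2 * r) c s - log_potential r c s.
Proof. by rewrite /log_potential -sumrB. Qed.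

(** The term [ln n] from the leading coefficient of the derivative is the same at the radii [2 * r]
    and [r], and cancels. *)
Lemma log_bump_sum_in_prob c r : 0 < r ->
  (\sum_(z <- critical_points p.1 p.2) log_bump c r z -
     \sum_(x <- sample X p.1 p.2) log_bump c r x) / p.1%:R @[p --> in_prob P] --> 0.
Proof.
move=> r0; have r20 : 0 < 2 * r by rewrite mulr_gt0.
have E : (fun p : nat * Omega => (\sum_(z <- critical_points p.1 p.2) log_bump c r z -
     \sum_(x <- sample X p.1 p.2) log_bump c r x) / p.1%:R) = fun p =>
  (ln p.1%:R + log_potential (2 * r) c (critical_points p.1 p.2) -
     log_potential (2 * r) c (sample X p.1 p.2)) / p.1%:R -
  (ln p.1%:R + log_potential r c (critical_points p.1 p.2) -
     log_potential r c (sample X p.1 p.2)) / p.1%:R.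
  by apply/funext => p; rewrite !log_bump_sumE -mulrBl; congr (_ / _); ring.
rewrite E -[X in _ --> X](subrr (0 : R)); apply: cvgB; exact: log_potential_in_prob.
Qed.

End CriticalPoints.

(** * Weak convergence of the critical points *)

Section CriticalConvergence.
Context {R : realType} (mu : probability (borelC R) R).
Context d (Omega : measurableType d) (P : probability Omega R).
Context (X : nat -> {RV P >-> borelC R}) (hX : iid mu X).

Lemma in_prob_ae (A : set Omega) : {ae P, forall w, A w} ->
  \forall p \near in_prob P, A p.2.
Proof.
move=> [N [mN N0 sN]] e e0; near=> n; exists (~` N); split; first exact: measurableC.
  by move=> w Nw /=; apply: contrapT => nA; apply: Nw; exact: sN.
by rewrite setCK [X in (X <= _)%E](_ : _ = 0%E) ?lee_fin ?ltW.
Unshelve. all: by end_near. Qed.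

Lemma sample_mean_in_prob (h : borelC R -> R) (D : R) : measurable_fun setT h ->
  (forall z, `|h z| <= D) ->
  partial_sum X h p.1 p.2 / p.1%:R @[p --> in_prob P] --> \int[mu]_x h x.
Proof.
move=> mh hD; have [mg gD g0] := lln_bounded_prep mu mh hD.
apply/cvgrPdist_lt => e e0.
have mE n : measurable [set w | e * n%:R <= `|partial_sum X (fun z => h z - \int[mu]_x h x) n w|].
  have m : measurable_fun setT (fun w => `|partial_sum X (fun z => h z - \int[mu]_x h x) n w|).
    by apply: measurableT_comp => //; exact: measurable_partial_sum.
  have := m measurableT _ (measurable_itv `[e * n%:R, +oo[).
  by rewrite setTI; congr measurable; apply/funext => w; rewrite /= in_itv /= andbT.
have lln := in_prob_cvg0 mE (partial_sum_lln_prob hX mg gD g0 e0).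
have n0 : in_prob P [set p | (0 < p.1)%N] by exact: (cvg_in_prob_fst P (nbhs_infty_gt 0)).
apply: (@filterS2 _ _ (in_prob_filter P) _ _ _ _ lln n0) => -[n w] /= /negP.
rewrite -ltNge partial_sumB => Sn n1; have nR : 0 < n%:R :> R by rewrite ltr0n.
have -> : \int[mu]_x h x - partial_sum X h n w / n%:R =
    - ((partial_sum X h n w - n%:R * \int[mu]_x h x) / n%:R) by field; rewrite gt_eqF.
by rewrite normrN normrM [`|_^-1|]gtr0_norm ?invr_gt0 // ltr_pdivrMr.
Qed.

(** Almost surely the polynomial is a power of ['X - x0%:P], and its critical points are [n - 1]
    copies of [x0]; from [n = 2] on both means equal [h x0]. *)
Lemma mean_gap_dirac (x0 : R[i]) (h : R[i] -> R) : {ae mu, forall x : borelC R, (x : R[i]) = x0} ->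
  (\sum_(z <- critical_points X p.1 p.2) h z) / p.1.-1%:R -
    (\sum_(x <- sample X p.1 p.2) h x) / p.1%:R @[p --> in_prob P] --> 0.
Proof.
move=> [N [mN N0 sN]].
have Xx0 : {ae P, forall w, forall i, (X i w : R[i]) = x0}.
  apply: ae_foralln => i; exists (X i @^-1` N); split.
  - by rewrite -[X in measurable X]setTI; exact: measurable_funPT.
  - by transitivity (mu N); [exact: iid_law | exact: N0].
  - by move=> w /= Xw; apply: sN.
apply/cvgr0Pnorm_lt => e e0.
have n2 : in_prob P [set p | (1 < p.1)%N] by exact: (cvg_in_prob_fst P (nbhs_infty_gt 1)).
apply: (@filterS2 _ _ (in_prob_filter P) _ _ _ _ (in_prob_ae Xx0) n2) => -[n w] /= Xw n1.
have sE : sample X n w = nseq n x0.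
  rewrite -{2}(size_sample X n w); apply/all_pred1P; rewrite all_map.
  by apply/allP => i _ /=; rewrite Xw.
have cE : perm_eq (critical_points X n w) (nseq n.-1 x0).
  have [sz] := critical_pointsP X w (ltnW n1).
  rewrite sE => dP; apply: prod_XsubC_eq.
  have n0 : n%:R != 0 :> R[i] by rewrite pnatr_eq0 -lt0n ltnW.
  apply: (scalerI n0); rewrite -dP !big_nseq !iter_mulr_1 deriv_exp derivXsubC mul1r.
  by rewrite -scaler_nat.
have S m : \sum_(z <- nseq m x0) h z = h x0 * m%:R by rewrite big_nseq iter_addr_0 mulr_natr.
rewrite (perm_big _ cE) sE !S.
rewrite !mulfK ?subrr ?normr0 // pnatr_eq0; first by move: n1; clear; case: n.
by move: n1; clear; case: n => [|[]].
Qed.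

Lemma mean_gap_in_prob c r : 0 < r ->
  (\int[mu]_z (log_plus (nm (z : R[i])))%:E < +oo)%E ->
  (\sum_(z <- critical_points X p.1 p.2) log_bump c r z) / p.1.-1%:R -
    (\sum_(x <- sample X p.1 p.2) log_bump c r x) / p.1%:R @[p --> in_prob P] --> 0.
Proof.
move=> r0 hmu; have [Hz|[x0 /mean_gap_dirac]] := small_logderiv_or_dirac hX; last exact.
have gap := log_bump_sum_in_prob hX hmu Hz c r0.
have iv : ln 2 * (n%:R : R)^-1 @[n --> \oo] --> 0.
  rewrite -[X in _ --> X](mulr0 (ln 2)); apply: cvgMr.
  by apply/gtr0_cvgV0; [near=> n; rewrite ltr0n; near: n; exact: nbhs_infty_gt|exact: cvgr_idn].
have cv : ln 2 * (p.1%:R : R)^-1 @[p --> in_prob P] --> 0.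
  have := cvg_comp _ _ (cvg_in_prob_fst P) iv; exact.
apply/cvgr0Pnorm_lt => e e0; have e2 : 0 < e / 2 by rewrite divr_gt0.
have n2 : in_prob P [set p | (1 < p.1)%N] by exact: (cvg_in_prob_fst P (nbhs_infty_gt 1)).
move/cvgr0Pnorm_lt : gap => /(_ _ e2) gap; move/cvgr0Pnorm_lt : cv => /(_ _ e2) cv.
apply: (@filterS3 _ _ (in_prob_filter P) _ _ _ _ _ gap cv n2) => -[n w] /= {}gap {}cv n1.
have [sz _] := critical_pointsP X w (ltnW n1).
set A := \sum_(z <- _) _ in gap *; set B := \sum_(x <- _) _ in gap *.
have A0 : 0 <= A by apply: sumr_ge0 => z _; exact: bump_ge0.
have A1 : A <= n.-1%:R * ln 2.
  apply: (@le_trans _ _ (\sum_(z <- critical_points X n w) ln 2)).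
    by apply: ler_sum => z _; exact: bump_le_ln2.
  by rewrite big_const_seq count_predT iter_addr_0 sz mulr_natl.
have n0 : 0 < n%:R :> R by rewrite ltr0n ltnW.
have m0 : 0 < n.-1%:R :> R by rewrite ltr0n; move: n1; clear; case: n => [|[]].
have nm1 : n%:R = n.-1%:R + 1 :> R by rewrite natr1 prednK // ltnW.
(* Passing from the normalization [n] to [n - 1] costs a mean of values bounded by [ln 2], divided
   by [n]. *)
have -> : A / n.-1%:R - B / n%:R = (A - B) / n%:R + A / n.-1%:R / n%:R.
  by rewrite nm1; field; rewrite -nm1 !gt_eqF.
apply: le_lt_trans (ler_normD _ _) _.
have h : `|A / n.-1%:R / n%:R| <= `|ln 2 * n%:R^-1|.
  rewrite !ger0_norm ?divr_ge0 ?(ltW n0) ?(ltW m0) ?ln_ge0 ?ler1n //.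
  by rewrite ler_pM2r ?invr_gt0 // ler_pdivrMr // mulrC.
by move: gap cv h; clear; lra.
Unshelve. all: by end_near. Qed.

Lemma critical_points_cvg_in_prob :
  (\int[mu]_z (log_plus (nm (z : R[i])))%:E < +oo)%E ->
  weak_cvg_in_prob P (fun n w => zero_measure (random_poly X n w)^`()) mu.
Proof.
move=> hmu; apply: weak_cvg_in_probP => f.
apply: (@cvg_test_integral _ _ _ (fun p : nat * Omega => zero_measure (random_poly X p.1 p.2)^`())).
move=> k m q i j; rewrite /bump_integral; set r : R := k.+1%:R^-1; set c := grid _ _ _ _.
have r0 : 0 < r by rewrite invr_gt0.
have mb := measurable_bump c r0.
have H : (\sum_(z <- critical_points X p.1 p.2) log_bump c r z) / p.1.-1%:R -
    (\sum_(x <- sample X p.1 p.2) log_bump c r x) / p.1%:R +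
    partial_sum X (log_bump c r : borelC R -> R) p.1 p.2 / p.1%:R @[p --> in_prob P] -->
    \int[mu]_z log_bump c r z.
  rewrite -[X in _ --> X]add0r; apply: cvgD; first exact: mean_gap_in_prob.
  exact: sample_mean_in_prob mb (fun z => norm_bump c z r0).
apply: cvg_trans H; apply: near_eq_cvg.
have n2 : in_prob P [set p | (1 < p.1)%N] by exact: (cvg_in_prob_fst P (nbhs_infty_gt 1)).
apply: (@filterS _ _ (in_prob_filter P) _ _ _ n2) => -[n w] /= n1.
by rewrite critical_points_integral // (sum_sample X (log_bump c r)) subrK.
Qed.

End CriticalConvergence.

Theorem corollary1p12 (R : realType) (mu : probability (borelC R) R)
    (hmu : (\int[mu]_z (log_plus (Normc.normc (z : R[i])))%:E < +oo)%E)
    (d : measure_display) (Omega : measurableType d) (P : probability Omega R)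
    (X : nat -> {RV P >-> borelC R}) (hX : iid mu X) :
  weak_cvg_as P (fun n w => zero_measure (random_poly X n w)) mu /\
  weak_cvg_in_prob P (fun n w => zero_measure (random_poly X n w)^`()) mu.
Proof.
by split; [exact: random_poly_cvg_as | exact: critical_points_cvg_in_prob].
Qed.
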